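(* Let $P_x$ be the probability that $\sum_{n\le x}\frac{f(n)}{n}<0$, where $f$ is a random completely multiplicative function with $f(p)=\pm1$ with probabilities $1/2$ independently at each prime $p$. Then, as $x\to+\infty$, $$P_x \ll \exp\left(-\exp\left(\frac{\log x\,\log_4 x}{(1+o(1))\log_3 x}\right)\right),$$ where $o(1)$ denotes some function of $x$ tending to $0$ as $x\to+\infty$.
   Context: $\log_k x$ denotes the $k$-fold iterated natural logarithm. $A\ll B$ (with $B\ge0$) means $|A|\le KB$ for some absolute constant $K>0$. *)

(* Defs.v *)
From HB Require Import structures.
From mathcomp Require Import all_boot all_order all_algebra.
From mathcomp Require Import all_classical all_reals all_analysis.

Set Implicit Arguments.
Unset Strict Implicit.
Unset Printing Implicit Defensive.
Import Order.TTheory GRing.Theory Num.Theory.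
Import numFieldNormedType.Exports.
Local Open Scope classical_set_scope.
Local Open Scope ring_scope.

(* The value f 0 is left unconstrained: arithmetic functions live on n >= 1. *)
Definition completely_multiplicative (R : realType) (f : nat -> R) : Prop :=
  f 1%N = 1 /\
  forall m n : nat, (0 < m)%N -> (0 < n)%N -> f (m * n)%N = f m * f n.

(* Mutual independence of the subfamily (X i), i in D: the product rule for
   every finite subfamily and all Borel sets. *)
Definition mutually_independent (d : measure_display) (T : measurableType d)
    (R : realType) (P : probability T R) (I : eqType) (D : set I)
    (X : I -> {RV P >-> R}) : Prop :=
  forall (s : seq I) (B : I -> set R), uniq s ->
    (forall i, i \in s -> D i) -> (forall i, i \in s -> measurable (B i)) ->
    P [set w | forall i, i \in s -> B i (X i w)]
    = (\prod_(i <- s) P [set w | B i (X i w)])%E.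

Definition random_completely_multiplicative (d : measure_display)
    (T : measurableType d) (R : realType) (P : probability T R)
    (f : nat -> {RV P >-> R}) : Prop :=
  [/\ forall w, completely_multiplicative (fun n => f n w),
      forall p, prime p -> P [set w | f p w = 1] = (2^-1)%:E /\
                           P [set w | f p w = -1] = (2^-1)%:E
    & mutually_independent [set p | prime p] f].

(* For x >= 0 the range is 1 <= n <= x, as Num.truncn x is the floor of x. *)
Definition prob_neg_sum (d : measure_display) (T : measurableType d)
    (R : realType) (P : probability T R) (f : nat -> {RV P >-> R}) (x : R) :
    \bar R :=
  P [set w | \sum_(1 <= n < (Num.truncn x).+1) f n w / n%:R < 0].

(* The k-fold iterated logarithm. As ln is 0 on nonpositive reals, this has its
   usual meaning only for x large enough in terms of k. *)
Definition iter_ln (R : realType) (k : nat) (x : R) : R := iter k (@ln R) x.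

(* Main.v *)
(** Fix the signs at the primes up to [y] and reveal the others in increasing
order.  Up to [O(log x / y)], the sum over [n <= x] is its part over [y]-smooth
[n] plus a martingale whose increments are [O(log x / p)]; a Chernoff bound
shows that this martingale is below [- lam] with probability at most
[exp (- c lam^2 y / log^2 x)].  It remains to bound below, for every sign
pattern, the sum [S(x)] of [g(n)/n] over the [y]-smooth [n <= x].

The full sum over [y]-smooth numbers is an Euler product [F >> 1 / log y].
Writing [g = mu * h] with [h = 1 * g >= 0] gives [S(t) = O(F)] for [t >= y^2],
provided that the partial sums of [mu(n)/n] are [O((log t)^(-1 - 1/12))]; these
come from lower bounds for [zeta] near [Re s = 1].  The tail [U(t)], for
[t = y^w], satisfies the delay inequality
[|U(t)| log t <= int_t |U(v)| dv/v + sum_(q <= y) Lambda(q)/q |U(t/q)| + small],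
which, iterated [i] times, gains a factor [2^i / i!].  So [S(x) >= F/2] as soon
as [y^i <= x] and [C i 2^i log log y <= i!]; with [y = x^(1/i)] this holds for
[i] about [log_3 x / log_4 x], and the probability is then at most
[exp (- x^(1/(i+1)))]. *)

Require Import Defs.
From HB Require Import structures.
From mathcomp Require Import all_boot all_order all_algebra.
From mathcomp Require Import all_classical all_reals all_analysis.
From mathcomp Require Import zify ring lra.
From mathcomp Require Import measurable_realfun complex.
Set Implicit Arguments.
Unset Strict Implicit.
Unset Printing Implicit Defensive.
Import Order.TTheory GRing.Theory Num.Theory.
Import numFieldNormedType.Exports.
Local Open Scope classical_set_scope.
Local Open Scope ring_scope.
Local Notation Re := complex.Re.
Local Notation Im := complex.Im.

(** * Arithmetic functions *)

Section Arithmetic.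
Context {V : nmodType}.
Implicit Types (G : nat -> V) (F : nat -> nat -> V).

Lemma sum_multiples (X d : nat) G : (0 < d)%N ->
  \sum_(1 <= k < X.+1 | (d %| k)%N) G k =
  \sum_(1 <= e < (X %/ d).+1) G (d * e)%N.
Proof.
move=> d0; elim: X => [|X IH]; first by rewrite div0n !big_geq.
rewrite big_mkcond big_nat_recr//= -big_mkcond /= IH.
rewrite divnS//; case: ifP => [dX|_]; last by rewrite addr0 add0n.
rewrite add1n [RHS]big_nat_recr//=; congr (_ + G _).
by have := divnS X d0; rewrite dX /= add1n => <-; rewrite mulnC divnK.
Qed.

Lemma sum_div_pairs (X : nat) F :
  \sum_(1 <= k < X.+1) \sum_(1 <= d < X.+1 | (d %| k)%N) F d (k %/ d)%N =
  \sum_(1 <= d < X.+1) \sum_(1 <= e < (X %/ d).+1) F d e.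
Proof.
under eq_bigr do rewrite big_mkcond.
rewrite exchange_big_nat /= big_nat [RHS]big_nat; apply: eq_bigr => d /andP[d0 _].
rewrite -big_mkcond sum_multiples//.
by apply: eq_bigr => e _; rewrite mulKn.
Qed.

Lemma sum_divisors_bound (X k : nat) G : (0 < k <= X)%N ->
  \sum_(1 <= d < X.+1 | (d %| k)%N) G d = \sum_(1 <= d < k.+1 | (d %| k)%N) G d.
Proof.
move=> /andP[k0 kX]; rewrite (@big_cat_nat _ _ _ k.+1)//= [X in _ + X]big_nat_cond.
rewrite [X in _ + X]big_pred0 ?addr0// => d; apply/negP => /andP[/andP[kd _] dk].
by have := dvdn_leq k0 dk; rewrite leqNgt kd.
Qed.

Lemma sum_pairs_sym (X : nat) F :
  \sum_(1 <= d < X.+1) \sum_(1 <= e < (X %/ d).+1) F d e =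
  \sum_(1 <= e < X.+1) \sum_(1 <= d < (X %/ e).+1) F d e.
Proof.
have E (G : nat -> nat -> V) : \sum_(1 <= d < X.+1) \sum_(1 <= e < (X %/ d).+1) G d e =
   \sum_(1 <= d < X.+1) \sum_(1 <= e < X.+1) (if (d * e <= X)%N then G d e else 0).
  rewrite big_nat [RHS]big_nat; apply: eq_bigr => d /andP[d0 dX].
  have leX : (X %/ d <= X)%N by exact: leq_div.
  rewrite [RHS](@big_cat_nat _ _ _ (X %/ d).+1)//= [X in _ + X]big_nat_cond.
  rewrite [X in _ + X]big1 ?addr0; last first.
    move=> e; rewrite andbT => /andP[le _]; rewrite ifF// mulnC; apply/negbTE; rewrite -ltnNge.
    by rewrite -ltn_divLR.
  rewrite big_nat [RHS]big_nat; apply: eq_bigr => e /andP[e0].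
  by rewrite ltnS leq_divRL// mulnC => ->.
rewrite E (E (fun e d => F d e)) exchange_big_nat /=.
by apply: eq_bigr => e _; apply: eq_bigr => d _; rewrite mulnC.
Qed.

End Arithmetic.

Section Moebius.

(* The value at 0 is 1. *)
Definition moebius (n : nat) : int :=
  if all (fun p => logn p n <= 1)%N (primes n) then (-1) ^+ size (primes n) else 0.

Lemma moebius_le1 n : `|moebius n| <= 1.
Proof. by rewrite /moebius; case: ifP; rewrite ?normr0// normrX normrN1 expr1n. Qed.

Lemma moebius_prime_mul (p n : nat) : prime p -> (0 < n)%N ->
  moebius (p * n) = if (p %| n)%N then 0 else - moebius n.
Proof.
move=> pp n0; have p0 := prime_gt0 pp; have pn0 : (0 < p * n)%N by rewrite muln_gt0 p0.
case: ifP => pn.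
  rewrite /moebius ifF//; apply/negbTE/allPn; exists p.
    by rewrite mem_primes pp pn0 dvdn_mulr.
  by rewrite lognM// (pfactorK 1 pp : logn p p = 1%N) -ltnNge ltnS logn_gt0 mem_primes pp n0.
have pP : perm_eq (primes (p * n)) (p :: primes n).
  apply: uniq_perm => /=; first exact: primes_uniq.
    by rewrite primes_uniq andbT mem_primes pp n0 pn.
  by move=> q; rewrite primesM// in_cons primes_prime// inE.
have -> : moebius (p * n) = if all (fun q => logn q (p * n) <= 1)%N (p :: primes n) then (-1) ^+ (size (primes n)).+1 else 0.
  by rewrite /moebius (perm_size pP) (perm_all _ pP).
have lp0 : logn p n = 0%N by apply/eqP; rewrite -leqn0 leqNgt logn_gt0 mem_primes pp n0 pn.
rewrite /moebius /= lognM// (pfactorK 1 pp : logn p p = 1%N) lp0 /=.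
have -> : all (fun q => logn q (p * n) <= 1)%N (primes n) = all (fun q => logn q n <= 1)%N (primes n).
  apply: eq_in_all => q; rewrite mem_primes => /and3P[qp _ qn].
  rewrite lognM// (logn_prime _ pp) (_ : q == p = false)//.
  by apply/negbTE/eqP => e; rewrite -e qn in pn.
by case: ifP => _; rewrite ?oppr0// exprS mulN1r.
Qed.

Lemma sum_moebius (n : nat) : (0 < n)%N ->
  \sum_(1 <= d < n.+1 | (d %| n)%N) moebius d = (n == 1)%:R.
Proof.
move=> n0; have [->|n1] := eqVneq n 1%N.
  by rewrite big_mkcond big_nat1.
have {n1} n1 : (1 < n)%N by rewrite ltn_neqAle eq_sym n1.
set p := pdiv n; have pp : prime p by exact: pdiv_prime.
have pn : (p %| n)%N by exact: pdiv_dvd.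
have p0 := prime_gt0 pp.
rewrite (bigID (fun d => (p %| d)%N)) /=.
have -> : \sum_(1 <= d < n.+1 | (d %| n)%N && (p %| d)%N) moebius d =
   \sum_(1 <= d < n.+1 | (p %| d)%N) (if (d %| n)%N then moebius d else 0).
  by under eq_bigl do rewrite andbC; rewrite big_mkcondr.
rewrite sum_multiples// addrC.
have -> : \sum_(1 <= e < (n %/ p).+1) (if (p * e %| n)%N then moebius (p * e) else 0) =
  \sum_(1 <= e < (n %/ p).+1 | (e %| n)%N && ~~ (p %| e)%N) - moebius e.
  rewrite [RHS]big_mkcond; apply: eq_big_nat => e /andP[e0 _].
  rewrite moebius_prime_mul//; case: (boolP (p %| e)%N) => pe /=.
    by rewrite andbF; case: ifP.
  rewrite andbT Gauss_dvd; last by rewrite prime_coprime.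
  by rewrite pn.
rewrite sumrN; apply/eqP; rewrite subr_eq0; apply/eqP.
have np : (n %/ p <= n)%N by exact: leq_div.
rewrite (@big_cat_nat _ _ _ (n %/ p).+1)//= [X in _ + X]big_nat_cond.
rewrite [X in _ + X]big_pred0 ?addr0// => d; apply/negP => /and3P[/andP[npd _] dn pd].
have : (d * p %| n)%N by rewrite Gauss_dvd ?dn// coprime_sym prime_coprime.
move=> /dvdn_leq -/(_ n0); rewrite -leq_divRL//.
by rewrite leqNgt npd.
Qed.

End Moebius.

Section Mangoldt.
Variable R : realType.
Implicit Types (n d p k : nat).

Definition mangoldt (n : nat) : R :=
  if primes n is [:: p] then ln p%:R else 0.

Lemma ln_nat_ge0 n : 0 <= ln (n%:R : R).
Proof.
by case: n => [|n]; [rewrite ln0|rewrite ln_ge0// ler1n].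
Qed.

Lemma mangoldt_ge0 n : 0 <= mangoldt n.
Proof. by rewrite /mangoldt; case: (primes n) => [|p [|]]//; exact: ln_nat_ge0. Qed.

Lemma mangoldt_prime p k : prime p -> (0 < k)%N -> mangoldt (p ^ k)%N = ln p%:R.
Proof. by move=> pp k0; rewrite /mangoldt primesX// primes_prime. Qed.

Lemma mangoldt_neq0 n : mangoldt n != 0 ->
  exists p, exists2 k, (0 < k)%N /\ prime p & n = (p ^ k)%N.
Proof.
have [->|n0] := posnP n; first by rewrite /mangoldt /= eqxx.
rewrite /mangoldt; case E: (primes n) => [|p [|? ?]]; rewrite ?eqxx// => _.
have pn : p \in primes n by rewrite E inE.
exists p, (logn p n); first by split; [rewrite logn_gt0|move: pn; rewrite mem_primes => /andP[]].
by rewrite {1}(prod_prime_decomp n0) prime_decompE E /= big_seq1.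
Qed.

Lemma sum_mangoldt n : (0 < n)%N ->
  \sum_(1 <= d < n.+1 | (d %| n)%N) mangoldt d = ln n%:R.
Proof.
elim/ltn_ind: n => n IH n0; have [->|n1] := eqVneq n 1%N.
  by rewrite big_mkcond big_nat1 /= ln1.
have {n1} n1 : (1 < n)%N by rewrite ltn_neqAle eq_sym n1.
set p := pdiv n; have pp : prime p by exact: pdiv_prime.
have pn : (p %| n)%N by exact: pdiv_dvd.
have p0 := prime_gt0 pp.
set m := (n %/ p)%N.
have nE : n = (p * m)%N by rewrite mulnC divnK.
have m0 : (0 < m)%N by move: n0; rewrite nE muln_gt0 => /andP[].
have mn : (m < n)%N by rewrite nE ltn_Pmull// prime_gt1.
rewrite (bigID (fun d => (d %| m)%N)) /=.
have -> : \sum_(1 <= d < n.+1 | (d %| n)%N && (d %| m)%N) mangoldt d = ln m%:R.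
  rewrite -IH// -(@sum_divisors_bound _ n m)// ?m0 ?(ltnW mn)//.
  by apply: eq_bigl => d; rewrite andbC; case: (boolP (d %| m)%N) => //= dm; rewrite nE dvdn_mull.
set k := logn p n.
have k0 : (0 < k)%N by rewrite logn_gt0 mem_primes pp n0.
have key d : (0 < d)%N -> (d %| n)%N -> ~~ (d %| m)%N -> mangoldt d != 0 -> d = (p ^ k)%N.
  move=> d0 dn dm /mangoldt_neq0[q [j [j0 qp] dE]].
  have jn : (j <= logn q n)%N by rewrite -pfactor_dvdn// -dE.
  have jm : ~~ (j <= logn q m)%N by rewrite -pfactor_dvdn// -dE.
  have H : logn q n = ((q == p) + logn q m)%N by rewrite nE lognM// (logn_prime _ pp).
  rewrite dE /k; move: jn jm H; case: (eqVneq q p) => [->|_] jn jm H; last by lia.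
  by congr (_ ^ _)%N; lia.
have pkn : (p ^ k %| n)%N by rewrite pfactor_dvdn.
have pkm : ~~ (p ^ k %| m)%N.
  by rewrite pfactor_dvdn// /k {1}nE lognM// (pfactorK 1 pp : logn p p = 1%N) add1n ltnn.
rewrite big_mkcond (bigD1_seq (p ^ k)%N) /=; last 2 first.
- by rewrite mem_index_iota expn_gt0 p0 ltnS dvdn_leq.
- exact: iota_uniq.
- rewrite pkn pkm mangoldt_prime// big_nat_cond big1 ?addr0; last first.
    move=> d /andP[/andP[d0 _]]; case: ifP => // /andP[dn dm].
    by apply: contraNeq => dneq; apply/eqP; exact: key.
  by rewrite [in RHS]nE natrM lnM ?posrE ?ltr0n// addrC.
Qed.

End Mangoldt.

Section Chebyshev.
Variable R : realType.
Implicit Types (n d p k m : nat).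

Lemma ler_sum_nat_subset (F : nat -> R) (m n N : nat) : (n <= N)%N ->
  (forall i, 0 <= F i) -> \sum_(m <= i < n) F i <= \sum_(m <= i < N) F i.
Proof.
move=> nN F0; have [mn|nm] := leqP m n; last by rewrite big_geq ?(ltnW nm)// sumr_ge0.
by rewrite [leRHS](@big_cat_nat _ _ _ n)//= lerDl sumr_ge0.
Qed.

Lemma harmonic_ln_le n : (0 < n)%N ->
  \sum_(1 <= k < n.+1) k%:R^-1 <= 1 + ln (n%:R : R).
Proof.
elim: n => // -[|n] IH _; first by rewrite big_nat1 invr1 ln1 addr0.
rewrite big_nat_recr//=; have {}IH := IH isT.
have n0 : (0 : R) < n.+1%:R by rewrite ltr0n.
have n1 : (0 : R) < n.+2%:R by rewrite ltr0n.
have : ln (n.+1%:R / n.+2%:R : R) <= - n.+2%:R^-1.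
  have -> : n.+1%:R / n.+2%:R = 1 + - n.+2%:R^-1 :> R.
    have e : n.+2%:R = n.+1%:R + 1 :> R by rewrite natr1.
    rewrite e in n1 *; move: n1; move: (n.+1%:R) => t t1.
    by field; exact: lt0r_neq0.
  by rewrite le_ln1Dx// ltrN2 invf_lt1// ltr1n.
rewrite ln_div ?posrE// => H.
by move: (ln _) (ln _) (_^-1) (\sum_(1 <= i < _) _) IH H => a b c d; lra.
Qed.

Lemma ln_fact n : ln (n`!%:R : R) = \sum_(1 <= d < n.+1) mangoldt R d * (n %/ d)%:R.
Proof.
have -> : ln (n`!%:R : R) = \sum_(1 <= k < n.+1) ln k%:R.
  elim: n => [|n IH]; first by rewrite big_geq// ln1.
  rewrite factS natrM lnM ?posrE ?ltr0n ?fact_gt0// IH addrC.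
  by rewrite [RHS]big_nat_recr.
transitivity (\sum_(1 <= k < n.+1) \sum_(1 <= d < n.+1 | (d %| k)%N) mangoldt R d).
  by apply: eq_big_nat => k /andP[k0 kn]; rewrite sum_divisors_bound ?k0// sum_mangoldt.
rewrite (sum_div_pairs n (fun d _ => mangoldt R d)).
by apply: eq_bigr => d _; rewrite sumr_const_nat subn1 /= mulr_natr.
Qed.

Definition psi n : R := \sum_(1 <= d < n.+1) mangoldt R d.

Lemma fact_half n : (n`! <= 2 ^ n * (n./2).+1 * ((n./2)`! * (n./2)`!))%N.
Proof.
set m := n./2; have mn : (m <= n)%N by rewrite /m; lia.
rewrite -(bin_fact mn) -mulnA leq_mul//.
  rewrite -[2%N]/(1 + 1)%N Pascal (bigD1_ord (Ordinal (mn : m < n.+1)%N)) //=.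
  by rewrite !exp1n !muln1 leq_addr.
rewrite [leqRHS]mulnCA leq_mul2l; apply/orP; right.
have [->|->] : (n - m = m)%N \/ (n - m = m.+1)%N by rewrite /m; lia.
  by rewrite leq_pmull.
by rewrite factS.
Qed.

Lemma psi_half n : psi n <= psi n./2 + 2 * n%:R.
Proof.
set m := n./2; have mn : (m <= n)%N by rewrite /m; lia.
have : psi n - psi m <= ln (n`!%:R : R) - 2 * ln (m`!%:R : R).
  rewrite !ln_fact /psi (@big_cat_nat _ _ _ m.+1)//= [X in X <= _]addrC addKr.
  have -> : \sum_(1 <= d < m.+1) mangoldt R d * (m %/ d)%:R =
            \sum_(1 <= d < n.+1) mangoldt R d * (m %/ d)%:R.
    rewrite [RHS](@big_cat_nat _ _ _ m.+1)//= [X in _ + X]big_nat_cond.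
    rewrite [X in _ + X]big1 ?addr0// => d /andP[/andP[md _] _].
    by rewrite divn_small// mulr0.
  rewrite mulr_sumr -sumrB.
  have F0 d : (2 * (m %/ d) <= n %/ d)%N.
    have [->|d0] := posnP d; first by rewrite !divn0.
    rewrite leq_divRL//; have := leq_trunc_div m d.
    by move: (m %/ d)%N => q; rewrite /m; lia.
  rewrite [leRHS](@big_cat_nat _ _ _ m.+1)//=.
  rewrite -[leLHS]add0r lerD//.
    apply: sumr_ge0 => d _; rewrite mulrCA -mulrBr mulr_ge0 ?mangoldt_ge0//.
    by rewrite subr_ge0 -natrM ler_nat.
  rewrite big_nat [leRHS]big_nat; apply: ler_sum => d /andP[md dn].
  have -> : (m %/ d = 0)%N by exact: divn_small.
  rewrite !mulr0 subr0 ler_peMr ?mangoldt_ge0// ler1n divn_gt0 ?(leq_ltn_trans _ md)//.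
have : ln (n`!%:R : R) <= ln (2 ^ n * m.+1 * (m`! * m`!))%:R.
  rewrite ler_ln ?posrE ?ltr0n ?muln_gt0 ?fact_gt0 ?expn_gt0// ler_nat.
  exact: fact_half.
rewrite !natrM !lnM ?posrE ?mulr_gt0 ?ltr0n ?fact_gt0 ?expn_gt0//.
rewrite natrX lnXn// -mulr_natr.
have : ln (2 : R) <= 1 by have := @le_ln1Dx R 1; rewrite -[1 + 1]/(2 : R); apply; lra.
have : ln (m.+1%:R : R) <= m%:R by rewrite -add1n natrD le_ln1Dx// (lt_le_trans _ (ler0n _ _))// ltrN10.
have : (m%:R : R) <= n%:R by rewrite ler_nat.
move=> h1 h2 h3; have : ln (2 : R) * n%:R <= n%:R by rewrite ler_piMl.
lra.
Qed.

Lemma psi_le n : psi n <= 4 * n%:R.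
Proof.
elim/ltn_ind: n => -[_|n IH]; first by rewrite /psi big_geq// mulr0.
apply: (le_trans (psi_half _)).
have h : (n.+1./2 < n.+1)%N by lia.
apply: le_trans (lerD (IH _ h) (lexx _)) _.
have : (2 * n.+1./2 <= n.+1)%N by lia.
rewrite -(ler_nat R) natrM; lra.
Qed.


Lemma sum_mangoldt_div_le n : (0 < n)%N ->
  \sum_(1 <= d < n.+1) mangoldt R d / d%:R <= ln n%:R + 4.
Proof.
move=> n0; have n0' : (0 : R) < n%:R by rewrite ltr0n.
have fle : ln (n`!%:R : R) <= n%:R * ln n%:R.
  rewrite mulr_natl -lnXn// ler_ln ?posrE ?exprn_gt0 ?ltr0n ?fact_gt0// -natrX ler_nat.
  by rewrite -ffactnn ffact_prod -[X in (n ^ X)%N]card_ord -prod_nat_const leq_prod// => i _; rewrite leq_subr.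
rewrite -(ler_pM2l n0') mulrDr.
apply: le_trans (lerD fle (lexx _)); rewrite ln_fact.
have := psi_le n; rewrite /psi => psile.
rewrite -lerBlDr; apply: le_trans (lerB (lexx _) _) _; first by rewrite mulrC; exact: psile.
rewrite mulr_sumr -sumrB big_nat [leRHS]big_nat; apply: ler_sum => d /andP[d0 _].
have d0' : (0 : R) < d%:R by rewrite ltr0n.
rewrite mulrCA -[X in _ - X]mulr1 -mulrBr ler_wpM2l ?mangoldt_ge0//.
rewrite lerBlDr ler_pdivrMr// natr1 -natrM ler_nat.
by rewrite ltnW// ltn_ceil.
Qed.

End Chebyshev.

(** * Complex exponentials *)

Section TrigoBounds.
Variable R : realType.
Implicit Types x y t : R.

Lemma sqr_norm x : `|x| ^+ 2 = x ^+ 2. Proof. exact: real_normK (num_real x). Qed.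

Lemma abs_sin_le x : `|sin x| <= `|x|.
Proof.
wlog x0 : x / 0 <= x.
  move=> H; have [x0|x0] := leP 0 x; first exact: H.
  by rewrite -normrN -sinN -(normrN x) H// oppr_ge0 ltW.
have [->|xn0] := eqVneq x 0; first by rewrite sin0.
have {x0 xn0} x0 : 0 < x by rewrite lt_neqAle eq_sym xn0.
have [c _] := @MVT R sin cos 0 x x0 (fun y _ => is_derive_sin y) (continuous_subspaceT (@continuous_sin R)).
rewrite sin0 !subr0 => ->; rewrite normrM ler_piMl//; exact: cos_max.
Qed.

Lemma cos_half x : cos x = 1 - 2 * sin (x / 2) ^+ 2.
Proof.
have {1}-> : x = (x / 2) *+ 2 by rewrite -mulr_natr divfK// pnatr_eq0.
by rewrite cos_mulr2n cos2sin2; ring.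
Qed.

Lemma one_sub_cos_le_sqr x : 0 <= 1 - cos x <= x ^+ 2 / 2.
Proof.
rewrite subr_ge0 cos_le1/= cos_half.
have : `|sin (x / 2)| ^+ 2 <= `|x / 2| ^+ 2 by rewrite lerXn2r ?nnegrE ?abs_sin_le.
rewrite !sqr_norm expr_div_n; move: (sin _ ^+ 2) (x ^+ 2) => u v; lra.
Qed.

Lemma one_sub_cos_le_abs x : 1 - cos x <= `|x|.
Proof.
rewrite cos_half opprB addrCA subrr addr0 -sqr_norm.
have h1 := abs_sin_le (x / 2); have h2 := sin_max (x / 2).
rewrite normrM (ger0_norm (_ : 0 <= 2^-1)) ?invr_ge0// in h1.
have : `|sin (x / 2)| ^+ 2 <= `|sin (x / 2)| by rewrite expr2 ler_piMl.
by move: h1; move: `|sin _| (`|sin _| ^+ 2) => u v; lra.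
Qed.

Lemma abs_sin_sub_le x : `|sin x - x| <= x ^+ 2.
Proof.
wlog x0 : x / 0 <= x.
  move=> H; have [x0|x0] := leP 0 x; first exact: H.
  by have := H (- x); rewrite sqrrN sinN opprK addrC distrC oppr_ge0; apply; exact: ltW.
have [->|xn0] := eqVneq x 0; first by rewrite sin0 subr0 normr0 expr0n.
have {x0 xn0} x0 : 0 < x by rewrite lt_neqAle eq_sym xn0.
have cont : continuous (fun t : R => sin t - t).
  by move=> y; apply: continuousB; [exact: continuous_sin|exact: cvg_id].
have [c] := @MVT R (fun t => sin t - t) (fun t => cos t - 1) 0 x x0
  (fun y _ => is_deriveB (is_derive_sin y) (is_derive_id y 1))
  (continuous_subspaceT cont).
rewrite in_itv/= => /andP[c0 cx].
rewrite sin0 !subr0 => ->; rewrite normrM (gtr0_norm x0) expr2 ler_wpM2r ?(ltW x0)//.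
rewrite distrC ger0_norm ?subr_ge0 ?cos_le1// (le_trans (one_sub_cos_le_abs c))//.
by rewrite gtr0_norm// ltW.
Qed.

Lemma expRN_bounds x : 0 <= x -> 0 <= expR (- x) - (1 - x) <= x ^+ 2.
Proof.
move=> x0; have := expR_ge1Dx (- x); have := expR_ge1Dx x.
have := expR_gt0 x; have := expR_gt0 (- x); have := expRxMexpNx_1 x.
move: (expR x) (expR (- x)) => u v uv v0 u0 h1 h2; apply/andP; split; first lra.
have k1 : v * (1 + x) <= 1 by rewrite -[leRHS]uv mulrC ler_pM2r.
have x1 : 0 < 1 + x by lra.
rewrite lerBlDr -(ler_pM2r x1); apply: le_trans k1 _.
have -> : (x ^+ 2 + (1 - x)) * (1 + x) = 1 + x ^+ 3 by ring.
by rewrite lerDl exprn_ge0.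
Qed.

End TrigoBounds.

Section ComplexNorm.
Variable R : realType.
Implicit Types z w s : R[i].
Implicit Types a b c : R.

Definition cabs z : R := Normc.normc z.
Local Arguments cabs : simpl never.

Lemma cabs_norm z : (cabs z)%:C%C = `|z|. Proof. by []. Qed.
Lemma cabsE a b : cabs (Complex a b) = Num.sqrt (a ^+ 2 + b ^+ 2). Proof. by []. Qed.
Lemma cabs0 : cabs 0 = 0. Proof. exact: Normc.normc0. Qed.
Lemma cabs1 : cabs 1 = 1. Proof. exact: Normc.normc1. Qed.
Lemma cabs_ge0 z : 0 <= cabs z. Proof. by case: z => a b; rewrite cabsE sqrtr_ge0. Qed.
Lemma cabsM z w : cabs (z * w) = cabs z * cabs w. Proof. exact: Normc.normcM. Qed.
Lemma cabsV z : cabs z^-1 = (cabs z)^-1. Proof. exact: Normc.normcV. Qed.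
Lemma cabsD z w : cabs (z + w) <= cabs z + cabs w. Proof. exact: le_normcD. Qed.
Lemma cabsN z : cabs (- z) = cabs z. Proof. exact: normcN. Qed.
Lemma cabsB z w : cabs (z - w) <= cabs z + cabs w.
Proof. by rewrite -(cabsN w) cabsD. Qed.
Lemma cabs_distC z w : cabs (z - w) = cabs (w - z).
Proof. by rewrite -cabsN opprB. Qed.
Lemma cabs_sub z w : cabs z - cabs w <= cabs (z - w).
Proof. by rewrite lerBlDr; apply: le_trans (cabsD _ _); rewrite subrK. Qed.
Lemma cabs_eq0 z : (cabs z == 0) = (z == 0).
Proof. by apply/eqP/eqP => [/Normc.eq0_normc//|->]; exact: cabs0. Qed.
Lemma cabs_gt0 z : (0 < cabs z) = (z != 0).
Proof. by rewrite lt_neqAle cabs_ge0 andbT eq_sym cabs_eq0. Qed.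
Lemma cabsR a : cabs (a%:C)%C = `|a|.
Proof. by rewrite cabsE /= expr0n addr0 sqrtr_sqr. Qed.
Lemma complex_nat_inv n : ((n%:R : R)^-1)%:C%C = n%:R^-1 :> R[i].
Proof. by rewrite fmorphV rmorph_nat. Qed.
Lemma cabs_nat n : cabs (n%:R) = n%:R.
Proof. by rewrite -(rmorph_nat (real_complex R)) cabsR normr_nat. Qed.
Lemma cabsX z n : cabs (z ^+ n) = cabs z ^+ n.
Proof. by elim: n => [|n IH]; rewrite ?expr0 ?cabs1// !exprS cabsM IH. Qed.
Lemma cabs_Re z : `|Re z| <= cabs z.
Proof.
by case: z => a b; rewrite cabsE /= -sqrtr_sqr ler_sqrt ?addr_ge0 ?sqr_ge0// lerDl sqr_ge0.
Qed.
Lemma cabs_Im z : `|Im z| <= cabs z.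
Proof.
by case: z => a b; rewrite cabsE /= -sqrtr_sqr ler_sqrt ?addr_ge0 ?sqr_ge0// lerDr sqr_ge0.
Qed.
Lemma cabs_sqr z : cabs z ^+ 2 = Re z ^+ 2 + Im z ^+ 2.
Proof. by case: z => a b; rewrite cabsE sqr_sqrtr// addr_ge0 ?sqr_ge0. Qed.
Lemma cabs_le z : cabs z <= `|Re z| + `|Im z|.
Proof.
rewrite -ler_sqr ?nnegrE ?addr_ge0 ?cabs_ge0// cabs_sqr sqrrD !sqr_norm.
by rewrite addrAC lerDl mulrn_wge0// mulr_ge0.
Qed.
Lemma cabs_sum (I : Type) (r : seq I) (P : pred I) (F : I -> R[i]) :
  cabs (\sum_(i <- r | P i) F i) <= \sum_(i <- r | P i) cabs (F i).
Proof.
elim/big_ind2 : _ => [|x a y b xa yb|]//; first by rewrite cabs0.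
by apply: le_trans (cabsD _ _) _; exact: lerD.
Qed.
Lemma cabs_prod (I : Type) (r : seq I) (P : pred I) (F : I -> R[i]) :
  cabs (\prod_(i <- r | P i) F i) = \prod_(i <- r | P i) cabs (F i).
Proof. by apply: (big_morph cabs cabsM cabs1). Qed.

Definition cexp w : R[i] := Complex (expR (Re w) * cos (Im w)) (expR (Re w) * sin (Im w)).

Lemma cexp0 : cexp 0 = 1.
Proof. by rewrite /cexp /= expR0 cos0 sin0 mulr1 mulr0. Qed.
Lemma cexpD z w : cexp (z + w) = cexp z * cexp w.
Proof.
case: z w => [a b] [c d]; rewrite /cexp; simpc => /=.
by rewrite expRD cosD sinD; congr Complex; ring.
Qed.
Lemma cabs_cexp w : cabs (cexp w) = expR (Re w).
Proof.
rewrite /cexp cabsE !exprMn -mulrDr cos2Dsin2 mulr1 sqrtr_sqr ger0_norm// expR_ge0.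
Qed.
Lemma cexpR a : cexp (a%:C)%C = (expR a)%:C%C.
Proof. by rewrite /cexp /= cos0 sin0 mulr1 mulr0. Qed.
Lemma cexpN_taylor w : 0 <= Re w -> cabs (1 - cexp (- w) - w) <= 3 * cabs w ^+ 2.
Proof.
case: w => a b /= a0; rewrite cabs_sqr /= /cexp /=.
apply: le_trans (cabs_le _) _ => /=.
rewrite sinN cosN.
have /andP[h1 h2] := expRN_bounds a0.
have /andP[h3 h4] := one_sub_cos_le_sqr b.
have h5 := abs_sin_sub_le b; have h6 := abs_sin_le b.
have h7 : expR (- a) <= 1 by rewrite expR_le1 oppr_le0.
have h8 := expR_gt0 (- a); have h9 := cos_le1 b.
have e1 : `|1 - expR (- a) * cos b - a| <= a ^+ 2 + b ^+ 2 / 2.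
  have -> : 1 - expR (- a) * cos b - a =
    expR (- a) * (1 - cos b) - (expR (- a) - (1 - a)) by ring.
  apply: le_trans (ler_normB _ _) _; rewrite (ger0_norm h1) addrC lerD//.
  by rewrite ger0_norm ?mulr_ge0 ?(ltW h8)// (le_trans _ h4)// ler_piMl.
have e2 : `|0 - expR (- a) * - sin b - b| <= b ^+ 2 + a * `|b|.
  have -> : 0 - expR (- a) * - sin b - b = (sin b - b) - (1 - expR (- a)) * sin b by ring.
  apply: le_trans (ler_normB _ _) _; rewrite lerD// normrM ler_pM//.
  by rewrite ger0_norm ?subr_ge0//; lra.
apply: le_trans (lerD e1 e2) _.
have : a * `|b| <= (a ^+ 2 + b ^+ 2) / 2.
  rewrite -(sqr_norm b); move: `|b| => t; have := sqr_ge0 (a - t).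
  by rewrite sqrrB -mulr_natr; move: (a ^+ 2) (t ^+ 2) (a * t) => u v w; lra.
have := sqr_ge0 a; have := sqr_ge0 b; lra.
Qed.

(* n^(-s), with the junk value 1 at n = 0. *)
Definition npow s (n : nat) : R[i] := cexp (- s * (ln n%:R)%:C%C).

Lemma npow1 s : npow s 1 = 1.
Proof. by rewrite /npow ln1 mulr0 cexp0. Qed.
Lemma npowM s (m n : nat) : (0 < m)%N -> (0 < n)%N -> npow s (m * n) = npow s m * npow s n.
Proof.
by move=> m0 n0; rewrite /npow natrM lnM ?posrE ?ltr0n// rmorphD mulrDr cexpD.
Qed.
Lemma npowD s w (n : nat) : npow (s + w) n = npow s n * npow w n.
Proof. by rewrite /npow opprD mulrDl cexpD. Qed.
Lemma npow_nat (n : nat) : (0 < n)%N -> npow 1 n = n%:R^-1.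
Proof.
move=> n0; rewrite /npow mulN1r -rmorphN cexpR expRN lnK ?posrE ?ltr0n// fmorphV.
by rewrite rmorph_nat.
Qed.
Lemma cabs_npow s (n : nat) : cabs (npow s n) = expR (- (Re s) * ln n%:R).
Proof. by rewrite cabs_cexp; congr expR; case: s => a b; simpc. Qed.
Lemma cabs_npow_le1 s (n : nat) : 0 <= Re s -> cabs (npow s n) <= 1.
Proof. by move=> s0; rewrite cabs_npow expR_le1 mulNr oppr_le0 mulr_ge0 ?ln_nat_ge0. Qed.

Lemma npow_step s (n : nat) : (0 < n)%N -> 0 <= Re s ->
  cabs (npow s n - npow s n.+1 - s * npow (1 + s) n) <=
  (3 * cabs s ^+ 2 + cabs s) / n%:R ^+ 2.
Proof.
move=> n0 s0; have n0' : (0 : R) < n%:R by rewrite ltr0n.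
set d : R := ln (n.+1%:R) - ln (n%:R).
have d0 : 0 <= d by rewrite subr_ge0 ler_ln ?posrE ?ltr0n// ler_nat.
have dn : d <= n%:R^-1.
  rewrite /d -ln_div ?posrE ?ltr0n//.
  have -> : n.+1%:R / n%:R = 1 + n%:R^-1 :> R by rewrite -natr1 mulrDl divff ?lt0r_neq0// mul1r.
  by rewrite le_ln1Dx// (lt_le_trans (ltrN10 _))// invr_ge0.
have dn2 : `|d - n%:R^-1| <= (n%:R ^+ 2)^-1.
  have n1 : (0 : R) < n.+1%:R by rewrite ltr0n.
  have : 1 - n%:R / n.+1%:R <= d.
    have := @expR_ge1Dx R (- d).
    have -> : expR (- d) = n%:R / n.+1%:R by rewrite /d opprB expRB !lnK ?posrE.
    by move: (_ / _) d {d0 dn} => u e; lra.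
  rewrite ler0_norm ?subr_le0// opprB -[n.+1%:R]natr1 => h.
  rewrite -[n.+1%:R]natr1 in n1; rewrite lerBlDr -lerBlDl; apply: le_trans h.
  have -> : 1 - n%:R / (n%:R + 1) = (n%:R + 1)^-1 :> R by field; rewrite lt0r_neq0.
  rewrite lerBlDr -lerBlDl.
  have -> : n%:R^-1 - (n%:R + 1)^-1 = (n%:R * (n%:R + 1))^-1 :> R by field; rewrite !lt0r_neq0.
  by rewrite lef_pV2 ?posrE ?exprn_gt0 ?mulr_gt0// expr2 ler_wpM2l ?ltW// ltrDl.
have E : npow s n.+1 = npow s n * cexp (- (s * d%:C%C)).
  by rewrite /npow -cexpD; congr cexp; rewrite /d rmorphB /= mulrBr; ring.
have -> : npow s n - npow s n.+1 - s * npow (1 + s) n =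
  npow s n * ((1 - cexp (- (s * d%:C%C)) - s * d%:C%C) + s * (d - n%:R^-1)%:C%C).
  by rewrite E npowD npow_nat// (_ : (d - _)%:C%C = d%:C%C - n%:R^-1); [ring|rewrite rmorphB /= complex_nat_inv].
rewrite cabsM; apply: le_trans (ler_piMl (cabs_ge0 _) (cabs_npow_le1 _ s0)) _.
apply: le_trans (cabsD _ _) _; rewrite mulrDl cabsM cabsR; apply: lerD.
  apply: le_trans (cexpN_taylor _) _.
    by case: s s0 {E} => a b /= a0; simpc; rewrite mulr_ge0.
  rewrite cabsM cabsR exprMn (ger0_norm d0) -mulrA ler_wpM2l// ler_wpM2l ?sqr_ge0//.
  by rewrite -exprVn lerXn2r ?nnegrE// invr_ge0.
by rewrite ler_wpM2l ?cabs_ge0.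
Qed.

Lemma sum_inv_sqr_le (M N : nat) : (0 < M)%N ->
  \sum_(M <= n < N) (n%:R ^+ 2)^-1 <= 2 / M%:R :> R.
Proof.
move=> M0; have [MN|NM] := leqP M N; last first.
  by rewrite big_geq ?divr_ge0// ltnW.
apply: (@le_trans _ _ (\sum_(M <= n < N) (2 * (n%:R^-1 - n.+1%:R^-1)))).
  rewrite big_nat [leRHS]big_nat; apply: ler_sum => n /andP[Mn _].
  have n0 : (0 : R) < n%:R by rewrite ltr0n (leq_trans M0).
  have n1 : (1 : R) <= n%:R by rewrite ler1n (leq_trans M0).
  rewrite -[n.+1%:R]natr1; have n2 : (0 : R) < n%:R + 1 by lra.
  have -> : 2 * (n%:R^-1 - (n%:R + 1)^-1) = 2 / (n%:R * (n%:R + 1)) :> R.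
    by field; rewrite !lt0r_neq0.
  rewrite ler_pdivlMr ?mulr_gt0// mulrC ler_pdivrMr ?exprn_gt0//.
  by rewrite expr2 mulrCA ler_pM2l// mulr_natl mulr2n lerD2l.
rewrite -mulr_sumr.
have -> : \sum_(M <= i < N) (i%:R^-1 - i.+1%:R^-1) = M%:R^-1 - N%:R^-1 :> R.
  rewrite -[RHS]opprB -(@telescope_sumr _ M N (fun i => i%:R^-1))// -sumrN.
  by apply: eq_bigr => i _; rewrite opprB.
have : (0 : R) <= N%:R^-1 by rewrite invr_ge0.
lra.
Qed.

Definition zsum s (N : nat) : R[i] := \sum_(1 <= n < N) npow (1 + s) n.

Lemma zsum_euler s (M N : nat) : (0 < M <= N)%N -> 0 <= Re s -> s != 0 ->
  cabs (zsum s N - zsum s M - (npow s M - npow s N) / s) <= (6 * cabs s + 2) / M%:R.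
Proof.
move=> /andP[M0 MN] s0 sn0; have cs0 : 0 < cabs s by rewrite cabs_gt0.
have -> : zsum s N - zsum s M = \sum_(M <= n < N) npow (1 + s) n.
  by rewrite /zsum (@big_cat_nat _ _ _ M)//= [X in X - _]addrC addrK.
have -> : npow s M - npow s N = \sum_(M <= n < N) (npow s n - npow s n.+1).
  by rewrite -[LHS]opprB -telescope_sumr// -sumrN; apply: eq_bigr => n _; rewrite opprB.
rewrite -(ler_pM2l cs0) -cabsM mulrBr mulrCA divff// mulr1 mulr_sumr -sumrB.
apply: le_trans (cabs_sum _ _ _) _.
apply: (@le_trans _ _ (\sum_(M <= n < N) (3 * cabs s ^+ 2 + cabs s) * (n%:R ^+ 2)^-1)).
  rewrite big_nat [leRHS]big_nat; apply: ler_sum => n /andP[Mn _].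
  by rewrite cabs_distC npow_step// (leq_trans M0).
rewrite -mulr_sumr; apply: le_trans (ler_wpM2l _ (sum_inv_sqr_le N M0)) _.
  by rewrite addr_ge0 ?mulr_ge0 ?sqr_ge0 ?cabs_ge0.
rewrite le_eqVlt; apply/orP; left; apply/eqP; field.
by rewrite pnatr_eq0 -lt0n.
Qed.

End ComplexNorm.
Arguments cabs {R} z : simpl never.
Arguments cexp {R} w : simpl never.
Arguments npow {R} s n : simpl never.

(** * Smooth numbers and Euler products *)

Section Smooth.

Definition smooth (y n : nat) := all (fun p => p <= y)%N (primes n).

Lemma smooth_le (y n : nat) : (n <= y)%N -> smooth y n.
Proof.
move=> ny; apply/allP => p; rewrite mem_primes => /and3P[_ n0 /dvdn_leq pn].
exact: leq_trans (pn n0) ny.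
Qed.

Lemma smooth0 (n : nat) : (0 < n)%N -> smooth 0 n = (n == 1)%N.
Proof.
move=> n0; apply/idP/eqP => [/allP sm|->//].
apply/eqP; rewrite eqn_leq n0 andbT leqNgt; apply/negP => n1.
have pn : pdiv n \in primes n by rewrite -[_ \in _]/(pdiv n \in \pi(n)) pi_pdiv.
by have := sm _ pn; rewrite leqNgt pdiv_gt0.
Qed.

Lemma smoothM (y m n : nat) : (0 < m)%N -> (0 < n)%N ->
  smooth y (m * n) = smooth y m && smooth y n.
Proof.
move=> m0 n0; apply/allP/andP => [H|[/allP Hm /allP Hn] p].
  by split; apply/allP => p pm; apply: H; rewrite primesM// pm ?orbT.
by rewrite primesM// => /orP[/Hm|/Hn].
Qed.

Lemma smooth_prime (y p : nat) : prime p -> smooth y p = (p <= y)%N.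
Proof. by move=> pp; rewrite /smooth primes_prime//= andbT. Qed.

Lemma smoothS (y n : nat) : (0 < n)%N -> smooth y n =
  smooth y.+1 n && ~~ (prime y.+1 && (y.+1 %| n)%N).
Proof.
move=> n0; apply/allP/andP => [H|[/allP H1 H2] p pn].
  split; first by apply/allP => p /H/leqW.
  by apply/negP => /andP[pp pn]; have := H y.+1; rewrite mem_primes pp n0 pn ltnn => /(_ isT).
have := H1 _ pn; rewrite leq_eqVlt ltnS => /orP[/eqP e|//].
by move: pn H2; rewrite e mem_primes => /and3P[-> _ ->].
Qed.

Variable K : numFieldType.
Implicit Types (g w : nat -> K) (y m n p : nat).

Definition ssum g y m := \sum_(1 <= n < m.+1 | smooth y n) g n.
Definition euler g y := \prod_(1 <= p < y.+1 | prime p) (1 - g p)^-1.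
Definition cmult g := g 1%N = 1 /\ forall m n, (0 < m)%N -> (0 < n)%N -> g (m * n)%N = g m * g n.

Lemma ssum0r g y : ssum g y 0 = 0.
Proof. by rewrite /ssum big_geq. Qed.

Lemma ssum_total g y m : (m <= y)%N -> ssum g y m = \sum_(1 <= n < m.+1) g n.
Proof.
move=> my; rewrite /ssum big_mkcond; apply: eq_big_nat => n /andP[_ nm].
by rewrite smooth_le// (leq_trans _ my).
Qed.

Lemma ssum_base g m : ssum g 0 m = if (0 < m)%N then g 1%N else 0.
Proof.
case: m => [|m]; first exact: ssum0r.
rewrite /ssum big_mkcond big_ltn//= big_nat_cond big1 ?addr0// => n.
rewrite andbT => /andP[n1 _]; rewrite smooth0 ?(ltn_trans _ n1)//.
by case: eqP n1 => // ->.
Qed.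

Lemma ssum_nonprime g y m : ~~ prime y.+1 -> ssum g y.+1 m = ssum g y m.
Proof.
move=> py; rewrite /ssum big_mkcond [RHS]big_mkcond; apply: eq_big_nat => n /andP[n0 _].
by rewrite (smoothS y n0) (negbTE py) andbT.
Qed.

Lemma ssum_prime g y m : cmult g -> prime y.+1 ->
  ssum g y.+1 m = ssum g y m + g y.+1 * ssum g y.+1 (m %/ y.+1).
Proof.
move=> [_ gM] py; rewrite /ssum (bigID (fun n => (y.+1 %| n)%N)) /= addrC; congr (_ + _).
  rewrite big_mkcond [RHS]big_mkcond; apply: eq_big_nat => n /andP[n0 _].
  by rewrite (smoothS y n0) py.
under eq_bigl do rewrite andbC.
rewrite big_mkcondr sum_multiples// mulr_sumr [RHS]big_mkcond.
apply: eq_big_nat => e /andP[e0 _]; rewrite smoothM// smooth_prime// leqnn /=.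
by case: ifP => // _; rewrite gM.
Qed.

Lemma euler_nonprime g y : ~~ prime y.+1 -> euler g y.+1 = euler g y.
Proof. by move=> py; rewrite /euler big_mkcond big_nat_recr//= (negbTE py) mulr1 -big_mkcond. Qed.

Lemma euler_prime g y : prime y.+1 -> euler g y.+1 = euler g y * (1 - g y.+1)^-1.
Proof. by move=> py; rewrite /euler big_mkcond big_nat_recr//= py -big_mkcond. Qed.

Lemma euler_gt0 g y : (forall p, prime p -> g p < 1) -> 0 < euler g y.
Proof.
by move=> g1; apply: prodr_gt0 => p pp; rewrite invr_gt0 subr_gt0 g1.
Qed.

Lemma ssum_ge0 g y m : (forall n, 0 <= g n) -> 0 <= ssum g y m.
Proof. by move=> g0; apply: sumr_ge0. Qed.

Lemma euler_sub_ssum g w y m : cmult g ->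
  (forall n, 0 < w n) -> (forall n, (0 < n)%N -> 1 <= w n) -> w 1%N = 1 ->
  (forall m n, (0 < m <= n)%N -> w m <= w n) ->
  (forall m n, (0 < m)%N -> (0 < n)%N -> w (m * n)%N = w m * w n) ->
  (forall p, prime p -> (p <= y)%N -> `|g p| * w p < 1) ->
  `|euler g y - ssum g y m| * w m.+1 <= euler (fun n => `|g n| * w n) y.
Proof.
move=> gM w0 w1 w11 wmono wM; elim: y m => [|y IH] m gw.
  rewrite ssum_base /euler !big_geq//; case: m => [|m] /=; first by rewrite subr0 normr1 mul1r w11.
  by rewrite gM.1 subrr normr0 mul0r ler01.
have {}IH m' := IH m' (fun p pp py => gw p pp (leqW py)).
have [py|py] := boolP (prime y.+1); last by rewrite ssum_nonprime// !euler_nonprime.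
have gwp := gw _ py (leqnn _).
have gp1 : `|g y.+1| < 1 by apply: le_lt_trans gwp; rewrite ler_peMr// w1.
have g1 : 1 - g y.+1 != 0.
  rewrite subr_eq0; apply/eqP => e; move: gp1; rewrite -e normr1 ltxx//.
set C := euler (fun n => `|g n| * w n).
have CE : C y.+1 = C y + (`|g y.+1| * w y.+1) * C y.+1.
  rewrite /C euler_prime//; field.
  by rewrite subr_eq0 gt_eqF.
have EE : euler g y.+1 = euler g y + g y.+1 * euler g y.+1.
  by rewrite euler_prime//; field.
have base : `|euler g y.+1| * w 1%N <= C y.+1.
  rewrite w11 mulr1 /C !euler_prime// normrM normfV.
  have := IH 0%N; rewrite ssum0r subr0 w11 mulr1 => IH0.
  apply: ler_pM => //.
  rewrite lef_pV2 ?posrE ?normr_gt0 ?subr_gt0//.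
  apply: le_trans (lerB_dist _ _); rewrite normr1 lerD2l lerN2 ler_peMr// w1//.
elim/ltn_ind: m => -[|m] IHm; first by rewrite ssum0r subr0.
have -> : euler g y.+1 - ssum g y.+1 m.+1 = (euler g y - ssum g y m.+1) +
  g y.+1 * (euler g y.+1 - ssum g y.+1 (m.+1 %/ y.+1)).
  by rewrite {1}EE {1}(ssum_prime _ gM py); ring.
apply: le_trans (ler_wpM2r (ltW (w0 _)) (ler_normD _ _)) _.
rewrite mulrDl CE lerD// normrM -mulrA -mulrA ler_wpM2l//.
have lt : (m.+1 %/ y.+1 < m.+1)%N by rewrite ltn_Pdiv// prime_gt1.
apply: le_trans (ler_wpM2l (ltW (w0 _)) (IHm _ lt)).
rewrite mulrCA ler_wpM2l// -wM//; apply: wmono => /=.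
by rewrite mulnC -ltnS ltnS; apply: ltn_ceil.
Qed.

End Smooth.

Section PowerSums.
Variable R : realType.
Implicit Types (n p k m y : nat) (a b : R).

(* The real power n^(-a), with the junk value 1 at n = 0. *)
Definition rnp a n : R := expR (- a * ln n%:R).

Lemma rnp_gt0 a n : 0 < rnp a n. Proof. exact: expR_gt0. Qed.
Lemma rnp1 a : rnp a 1 = 1. Proof. by rewrite /rnp ln1 mulr0 expR0. Qed.
Lemma rnpM a m n : (0 < m)%N -> (0 < n)%N -> rnp a (m * n) = rnp a m * rnp a n.
Proof. by move=> m0 n0; rewrite /rnp natrM lnM ?posrE ?ltr0n// mulrDr expRD. Qed.
Lemma rnpD a b n : rnp (a + b) n = rnp a n * rnp b n.
Proof. by rewrite /rnp opprD mulrDl expRD. Qed.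
Lemma rnp_nat n : (0 < n)%N -> rnp 1 n = n%:R^-1.
Proof. by move=> n0; rewrite /rnp mulN1r expRN lnK ?posrE ?ltr0n. Qed.
Lemma rnpN a n : rnp (- a) n = (rnp a n)^-1.
Proof. by rewrite /rnp opprK -expRN mulNr opprK. Qed.
Lemma rnp_le1 a n : 0 <= a -> rnp a n <= 1.
Proof. by move=> a0; rewrite /rnp expR_le1 mulNr oppr_le0 mulr_ge0 ?ln_nat_ge0. Qed.
Lemma rnp_mono a m n : 0 <= a -> (0 < m <= n)%N -> rnp a n <= rnp a m.
Proof.
move=> a0 /andP[m0 mn]; rewrite /rnp ler_expR !mulNr lerN2 ler_wpM2l//.
by rewrite ler_ln ?posrE ?ltr0n ?ler_nat// (leq_trans m0).
Qed.

Lemma sum_rnp_tail a m n : 0 < a -> (0 < m)%N ->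
  \sum_(m.+1 <= k < n) rnp (1 + a) k <= rnp a m / a.
Proof.
move=> a0 m0; have [mn|nm] := leqP m.+1 n; last first.
  by rewrite big_geq ?(ltnW nm)// divr_ge0 ?ltW ?rnp_gt0.
apply: (@le_trans _ _ (\sum_(m.+1 <= k < n) (rnp a k.-1 - rnp a k) / a)).
  rewrite big_nat [leRHS]big_nat; apply: ler_sum => -[//|k] /andP[mk _] /=.
  have k0 : (0 < k)%N by rewrite (leq_trans m0).
  rewrite rnpD rnp_nat// ler_pdivlMr// lerBrDr.
  have -> : rnp a k = rnp a k.+1 * expR (a * (ln k.+1%:R - ln k%:R)).
    by rewrite /rnp -expRD; congr expR; ring.
  rewrite -mulrA mulrC -[X in _ + X]mulr1 -mulrA -mulrDr ler_pM2l ?rnp_gt0//.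
  apply: le_trans (expR_ge1Dx _); rewrite addrC lerD2l ler_pM2l//.
  have d1 : (0 : R) < k%:R by rewrite ltr0n.
  have d2 : (0 : R) < k.+1%:R by rewrite ltr0n.
  have : ln (k%:R / k.+1%:R : R) <= - k.+1%:R^-1.
    have -> : k%:R / k.+1%:R = 1 + - k.+1%:R^-1 :> R.
      by rewrite -[k.+1%:R]natr1; field; rewrite natr1 lt0r_neq0.
    by rewrite le_ln1Dx// ltrN2 invf_lt1// ltr1n.
  by rewrite ln_div ?posrE//; move: (ln _) (ln _) (_^-1) => u v c; lra.
rewrite -mulr_suml ler_pM2r ?invr_gt0//.
have -> : \sum_(m.+1 <= i < n) (rnp a i.-1 - rnp a i) = rnp a m - rnp a n.-1.
  rewrite big_add1 /= -[RHS]opprB -(@telescope_sumr _ m n.-1 (fun i => rnp a i)); last by rewrite -ltnS prednK// (leq_trans _ mn).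
  by rewrite -sumrN; apply: eq_bigr => i _; rewrite opprB.
by rewrite gerBl ltW// rnp_gt0.
Qed.

Lemma sum_rnp_le a n : 0 < a -> \sum_(1 <= k < n) rnp (1 + a) k <= 1 + a^-1.
Proof.
move=> a0; have [n1|n1] := leqP n 1.
  by rewrite big_geq// addr_ge0// invr_ge0 ltW.
by rewrite big_ltn// rnp1 lerD2l; have := @sum_rnp_tail a 1 n a0 isT; rewrite rnp1 mul1r.
Qed.

Lemma rnp_unbounded a (A : R) : 0 < a -> exists m : nat, A <= rnp (- a) m.+1.
Proof.
move=> a0; exists (Num.truncn (expR (A / a))).
rewrite /rnp opprK; have h : expR (A / a) < (Num.truncn (expR (A / a))).+1%:R.
  by have /andP[] := truncn_itv (expR_ge0 (A / a)).
have := expR_ge1Dx (a * ln (Num.truncn (expR (A / a))).+1%:R).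
have : a * ln (expR (A / a)) <= a * ln (Num.truncn (expR (A / a))).+1%:R.
  by rewrite ler_wpM2l ?(ltW a0)// ler_ln ?posrE ?expR_gt0 ?ltr0n// ltW.
rewrite expRK mulrCA divff ?lt0r_neq0// mulr1.
by move: (expR (_ * _)) => u; lra.
Qed.

Lemma cmult_rnp a : cmult (rnp a).
Proof. by split; [exact: rnp1|exact: rnpM]. Qed.

Lemma rnp_prime_lt1 a p : 0 < a -> prime p -> rnp a p < 1.
Proof.
move=> a0 pp; rewrite /rnp expR_lt1 mulNr oppr_lt0 mulr_gt0// ln_gt0// ltr1n.
exact: prime_gt1.
Qed.

Lemma euler_le_of_ssum (g : nat -> R) b y (A : R) : cmult g -> 0 < b ->
  (forall p, prime p -> (p <= y)%N -> `|g p| * rnp (- b) p < 1) ->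
  (forall m, ssum g y m <= A) -> euler g y <= A.
Proof.
move=> gM b0 gb H; rewrite leNgt; apply/negP => lt.
set C := euler (fun n => `|g n| * rnp (- b) n) y.
have [m hm] := rnp_unbounded (C / (euler g y - A) + 1) b0.
have := @euler_sub_ssum _ g (rnp (- b)) y m gM (fun n => rnp_gt0 _ _).
have w1 n : (0 < n)%N -> 1 <= rnp (- b) n by rewrite rnpN invf_ge1 ?rnp_gt0 ?rnp_le1// ltW.
have wm m' n : (0 < m' <= n)%N -> rnp (- b) m' <= rnp (- b) n.
  by move=> h; rewrite !rnpN lef_pV2 ?posrE ?rnp_gt0// rnp_mono// ltW.
move=> /(_ w1 (rnp1 _) wm (fun _ _ => @rnpM _ _ _) gb); rewrite -/C => HC.
have d0 : 0 < euler g y - A by rewrite subr_gt0.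
have : (euler g y - A) * rnp (- b) m.+1 <= C.
  apply: le_trans HC; rewrite ler_pM2r ?rnp_gt0//.
  by apply: le_trans (ler_norm _); rewrite lerD2l lerN2.
apply/negP; rewrite -ltNge; apply: lt_le_trans (ler_wpM2l (ltW d0) hm).
by rewrite mulrDr mulrCA divff ?lt0r_neq0// !mulr1 ltrDl.
Qed.

Lemma euler_rnp_le a y : 0 < a -> euler (rnp (1 + a)) y <= 1 + a^-1.
Proof.
move=> a0; have a2 : 0 < a / 2 by rewrite divr_gt0.
apply: (@euler_le_of_ssum _ (a / 2)) => //; first exact: cmult_rnp.
  move=> p pp _; rewrite ger0_norm ?ltW ?rnp_gt0// -rnpD rnp_prime_lt1//; lra.
move=> m; apply: le_trans (sum_rnp_le m.+1 a0).
rewrite /ssum big_mkcond; apply: ler_sum => n _; case: ifP => // _.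
exact/ltW/rnp_gt0.
Qed.

Lemma ln2_ge : 2^-1 <= ln (2 : R).
Proof.
rewrite -[leLHS]expRK ler_ln ?posrE ?expR_gt0//.
rewrite -[leRHS]invrK -[leLHS]invrK -expRN lef_pV2 ?posrE ?expR_gt0 ?invr_gt0//.
by apply: le_trans (expR_ge1Dx _); lra.
Qed.

Lemma euler_factor_aux (q r e l : R) : 0 <= l -> 0 < q -> q <= 2^-1 ->
  1 - l <= r -> 1 + 2 * (l * q) <= e -> 1 - q * r <= e * (1 - q).
Proof.
move=> l0 q0 q2 h1 h2.
have : 0 <= (l * q) * (1 - 2 * q) by rewrite !mulr_ge0 ?(ltW q0)//; lra.
have : (1 + 2 * (l * q)) * (1 - q) <= e * (1 - q) by rewrite ler_wpM2r//; lra.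
have : (1 - l) * q <= r * q by rewrite ler_wpM2r ?(ltW q0)//; lra.
by rewrite [q * r]mulrC; move: (e * (1 - q)) (r * q) => u v; lra.
Qed.

Lemma euler_nat_le : exists2 C : R, 0 < C &
  forall y, (1 < y)%N -> euler (fun n => n%:R^-1 : R) y <= C * ln y%:R.
Proof.
exists (3 * expR 18); first by rewrite mulr_gt0 ?expR_gt0.
move=> y y1; have l2 := ln2_ge.
have ly : ln 2 <= ln (y%:R : R) by rewrite ler_ln ?posrE ?ltr0n ?ler_nat// ltnW.
have ly0 : 0 < ln (y%:R : R) by apply: lt_le_trans ly; lra.
set a := (ln (y%:R : R))^-1; have a0 : 0 < a by rewrite invr_gt0.
have key : euler (fun n => n%:R^-1 : R) y <=
   euler (rnp (1 + a)) y * expR (2 * a * \sum_(1 <= p < y.+1) mangoldt R p / p%:R).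
  rewrite mulr_sumr expR_sum /euler.
  apply: (@le_trans _ _ ((\prod_(1 <= p < y.+1 | prime p) (1 - rnp (1 + a) p)^-1) *
     \prod_(1 <= p < y.+1 | prime p) expR (2 * a * (mangoldt R p / p%:R)))); last first.
    rewrite ler_wpM2l//.
      by apply: prodr_ge0 => p pp; rewrite invr_ge0 subr_ge0 ltW// rnp_prime_lt1// addr_gt0.
    rewrite big_mkcond /=; apply: ler_prod => p _; case: ifP => _; rewrite ?expR_ge0 ?ler01 //=.
    by rewrite -expR0 ler_expR !mulr_ge0 ?mangoldt_ge0 ?(ltW a0)// invr_ge0.
  rewrite -big_split /=; apply: ler_prod => p pp; have p1 := prime_gt1 pp.
  have p0' : (0 : R) < p%:R by rewrite ltr0n ltnW.
  have q2 : p%:R^-1 <= 2^-1 :> R by rewrite lef_pV2 ?posrE// ler_nat.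
  have q0 : 0 < p%:R^-1 :> R by rewrite invr_gt0.
  rewrite invr_ge0 subr_ge0 (le_trans q2) ?invf_le1 ?ler1n//=.
  have r1 : rnp (1 + a) p < 1 by rewrite rnp_prime_lt1// addr_gt0.
  rewrite mulrC ler_pdivlMr ?subr_gt0// mulrC ler_pdivrMr ?subr_gt0; last by lra.
  have := @expR_ge1Dx R (2 * a * (mangoldt R p / p%:R)).
  have -> : mangoldt R p = ln p%:R by rewrite -(mangoldt_prime R pp (leqnn 1)) expn1.
  have := @expR_ge1Dx R (- (a * ln p%:R)); rewrite -mulNr -/(rnp a p).
  have lp : 0 <= a * ln (p%:R : R) by rewrite mulr_ge0 ?ln_nat_ge0 ?ltW.
  have -> : 2 * a * (ln p%:R / p%:R) = 2 * (a * ln p%:R * p%:R^-1) :> R by ring.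
  rewrite mulNr rnpD rnp_nat ?(ltnW p1)// => h1 h2.
  exact: euler_factor_aux h1 h2.
apply: (le_trans key).
have h1 : euler (rnp (1 + a)) y <= 3 * ln y%:R.
  by apply: le_trans (euler_rnp_le _ a0) _; rewrite invrK; lra.
have h2 : 2 * a * \sum_(1 <= p < y.+1) mangoldt R p / p%:R <= 18.
  rewrite -mulrA -(ler_pM2l ly0) mulrCA [ln _ * (a * _)]mulrA /a divff ?lt0r_neq0// mul1r.
  apply: le_trans (ler_wpM2l (ler0n _ 2) (sum_mangoldt_div_le R (ltnW y1))) _; lra.
rewrite [leRHS]mulrAC; apply: ler_pM; rewrite ?expR_ge0// ?ler_expR//.
by rewrite ltW// euler_gt0// => p pp; rewrite rnp_prime_lt1// addr_gt0.
Qed.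

End PowerSums.

(** * The zeta function near the line Re s = 1 *)

Section ZetaBounds.
Variable R : realType.
Implicit Types (s : R[i]) (h e r : R) (M N n : nat).

Lemma Re_realD s h : Re (s + h%:C%C) = Re s + h.
Proof. by case: s. Qed.

Lemma cabs_npow_rnp s n : cabs (npow s n) = rnp (Re s) n.
Proof. exact: cabs_npow. Qed.

Lemma npow_real h n : npow (h%:C%C) n = (rnp h n)%:C%C.
Proof. by rewrite /npow -rmorphN -rmorphM cexpR. Qed.

Lemma one_sub_rnp h n : 0 <= h -> 0 <= 1 - rnp h n <= h * ln n%:R.
Proof.
move=> h0; rewrite subr_ge0 rnp_le1//=.
by have := @expR_ge1Dx R (- h * ln n%:R); rewrite /rnp mulNr; move: (h * _) => u; lra.
Qed.

Definition zrem s M N : R[i] := zsum s N - zsum s M - npow s M / s.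

Lemma zsumE s M N : zsum s N = zsum s M + npow s M / s + zrem s M N.
Proof. by rewrite /zrem; ring. Qed.

Lemma zrem_le s M N : (0 < M <= N)%N -> 0 <= Re s -> s != 0 ->
  cabs (zrem s M N) <= (6 * cabs s + 2) / M%:R + rnp (Re s) N / cabs s.
Proof.
move=> MN s0 sn0.
have -> : zrem s M N = (zsum s N - zsum s M - (npow s M - npow s N) / s) - npow s N / s.
  by rewrite /zrem; ring.
apply: le_trans (cabsB _ _) _; apply: lerD; first exact: zsum_euler.
by rewrite cabsM cabsV cabs_npow_rnp.
Qed.

Lemma sum_inv_lt_le M : (0 < M)%N -> \sum_(1 <= n < M) n%:R^-1 <= 1 + ln (M%:R : R).
Proof.
move=> M0; apply: le_trans (harmonic_ln_le R M0).
by apply: ler_sum_nat_subset => // n; rewrite invr_ge0.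
Qed.

Lemma cabs_npow1D s n : (0 < n)%N -> 0 <= Re s -> cabs (npow (1 + s) n) <= n%:R^-1.
Proof.
by move=> n0 s0; rewrite npowD npow_nat// cabsM cabsV cabs_nat ler_piMr ?invr_ge0// cabs_npow_le1.
Qed.

Lemma head_bound M s (F : nat -> R[i]) (A : R) : (0 < M)%N -> 0 <= Re s -> 0 <= A ->
  (forall n, (0 < n < M)%N -> cabs (F n) <= A) ->
  cabs (\sum_(1 <= n < M) npow (1 + s) n * F n) <= A * (1 + ln M%:R).
Proof.
move=> M0 s0 A0 HF; apply: le_trans (cabs_sum _ _ _) _.
apply: le_trans (ler_wpM2l A0 (sum_inv_lt_le M0)).
rewrite mulr_sumr big_nat [leRHS]big_nat; apply: ler_sum => n /andP[n0 nM].
by rewrite cabsM mulrC ler_pM ?cabs_ge0 ?cabs_npow1D ?HF ?n0.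
Qed.

Lemma zsum_bound s M N r e : (0 < M)%N -> 0 <= Re s -> 0 < r -> r <= cabs s ->
  cabs (zrem s M N) <= e -> cabs (zsum s N) <= 1 + ln M%:R + r^-1 + e.
Proof.
move=> M0 s0 r0 rs He; rewrite (zsumE s M N).
apply: le_trans (cabsD _ _) _; apply: lerD => //.
apply: le_trans (cabsD _ _) _; apply: lerD.
  have h1 n : (0 < n < M)%N -> cabs (1 : R[i]) <= 1 by rewrite cabs1.
  by have := head_bound M0 s0 ler01 h1; under eq_bigr do rewrite mulr1; rewrite mul1r.
rewrite cabsM cabsV; apply: le_trans (ler_piMl _ (cabs_npow_le1 _ s0)) _.
  by rewrite invr_ge0 cabs_ge0.
by rewrite lef_pV2 ?posrE// (lt_le_trans r0).
Qed.

Lemma ln_lt_le n M : (0 < n < M)%N -> ln (n%:R : R) <= ln (M%:R : R).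
Proof.
move=> /andP[n0 nM]; rewrite ler_ln ?posrE ?ltr0n ?(leq_ltn_trans _ nM)//.
by rewrite ler_nat ltnW.
Qed.

Lemma npow_shift s h n : npow (1 + (s + h%:C%C)) n = npow (1 + s) n * (rnp h n)%:C%C.
Proof. by rewrite addrA npowD npow_real. Qed.

Lemma zsum_diff1 s h M N r e : (0 < M)%N -> 0 <= Re s -> 0 <= h -> 0 < r ->
  r <= cabs s -> r <= cabs (s + h%:C%C) ->
  cabs (zrem s M N) <= e -> cabs (zrem (s + h%:C%C) M N) <= e ->
  forall L, L = 1 + ln M%:R ->
  cabs (zsum (s + h%:C%C) N - zsum s N) <= h * L ^+ 2 + h * L / r + h / r ^+ 2 + 2 * e.
Proof.
move=> M0 s0 h0 r0 rs rsh e1 e2 L LE.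
have lM0 : 0 <= ln (M%:R : R) by exact: ln_nat_ge0.
have L1 : ln M%:R <= L by rewrite LE lerDr.
have L0 : 0 <= L by rewrite LE addr_ge0.
have sn0 : s != 0 by rewrite -cabs_gt0 (lt_le_trans r0).
have shn0 : s + h%:C%C != 0 by rewrite -cabs_gt0 (lt_le_trans r0).
set c := rnp h M; have /andP[c0 c1] := one_sub_rnp M h0.
rewrite !(zsumE _ M N).
have -> : npow (s + h%:C%C) M = npow s M * c%:C%C by rewrite npowD npow_real.
have -> : zsum (s + h%:C%C) M + npow s M * c%:C%C / (s + h%:C%C) + zrem (s + h%:C%C) M N -
  (zsum s M + npow s M / s + zrem s M N) =
  (zsum (s + h%:C%C) M - zsum s M) +
  (- (npow s M * ((1 - c)%:C%C / (s + h%:C%C) + h%:C%C / (s * (s + h%:C%C))))) +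
  (zrem (s + h%:C%C) M N - zrem s M N).
  by rewrite rmorphB /= rmorph1; field; rewrite ?sn0 ?shn0.
apply: le_trans (cabsD _ _) _; apply: lerD; last first.
  by apply: le_trans (cabsB _ _) _; lra.
apply: le_trans (cabsD _ _) _; rewrite -addrA; apply: lerD.
  have -> : zsum (s + h%:C%C) M - zsum s M = \sum_(1 <= n < M) npow (1 + s) n * (- (1 - rnp h n)%:C%C).
    rewrite /zsum -sumrB; apply: eq_bigr => n _.
    by rewrite npow_shift rmorphB rmorph1; ring.
  apply: le_trans (head_bound M0 s0 (_ : 0 <= h * L) _) _; first by rewrite mulr_ge0.
    move=> n nM; rewrite cabsN cabsR.
    have /andP[a0 a1] := one_sub_rnp n h0; rewrite ger0_norm//.
    by apply: le_trans a1 _; rewrite ler_wpM2l// (le_trans (ln_lt_le nM)).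
  by rewrite -LE expr2 mulrA.
rewrite cabsN cabsM; apply: le_trans (ler_piMl (cabs_ge0 _) (cabs_npow_le1 _ s0)) _.
apply: le_trans (cabsD _ _) _; rewrite !cabsM !cabsV cabsM !cabsR (ger0_norm c0) (ger0_norm h0).
apply: lerD.
  apply: ler_pM => //; first by rewrite invr_ge0 cabs_ge0.
    by rewrite (le_trans c1)// ler_wpM2l.
  by rewrite lef_pV2 ?posrE// (lt_le_trans r0).
rewrite ler_wpM2l// lef_pV2 ?posrE ?exprn_gt0 ?mulr_gt0 ?(lt_le_trans r0)//.
by rewrite expr2 ler_pM// ltW.
Qed.

Lemma zsum_diff2 s h M N r e : (0 < M)%N -> 0 <= Re s -> 0 <= h -> 0 < r ->
  r <= cabs s -> r <= cabs (s + h%:C%C) -> r <= cabs (s + h%:C%C + h%:C%C) ->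
  cabs (zrem s M N) <= e -> cabs (zrem (s + h%:C%C) M N) <= e ->
  cabs (zrem (s + h%:C%C + h%:C%C) M N) <= e ->
  forall L, L = 1 + ln M%:R ->
  cabs (zsum (s + h%:C%C + h%:C%C) N - 2 * zsum (s + h%:C%C) N + zsum s N) <=
    h ^+ 2 * L ^+ 3 + (h ^+ 2 * L ^+ 2 / r + 2 * h ^+ 2 * L / r ^+ 2 + 2 * h ^+ 2 / r ^+ 3) + 4 * e.
Proof.
move=> M0 s0 h0 r0 rs rsh rshh e1 e2 e3 L LE.
have lM0 : 0 <= ln (M%:R : R) by exact: ln_nat_ge0.
have L1 : ln M%:R <= L by rewrite LE lerDr.
have L0 : 0 <= L by rewrite LE addr_ge0.
have sn0 : s != 0 by rewrite -cabs_gt0 (lt_le_trans r0).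
have shn0 : s + h%:C%C != 0 by rewrite -cabs_gt0 (lt_le_trans r0).
have shhn0 : s + h%:C%C + h%:C%C != 0 by rewrite -cabs_gt0 (lt_le_trans r0).
set c := rnp h M; have /andP[c0 c1] := one_sub_rnp M h0.
have c1L : 1 - c <= h * L by rewrite (le_trans c1)// ler_wpM2l.
rewrite !(zsumE _ M N).
rewrite !(npowD _ (h%:C%C)) !npow_real -/c.
have inv_le z : r <= cabs z -> (cabs z)^-1 <= r^-1.
  by move=> rz; rewrite lef_pV2 ?posrE// (lt_le_trans r0).
set s1 := s + h%:C%C in e2 shn0 rsh *; set s2 := s1 + h%:C%C in e3 shhn0 rshh *.
have -> : zsum s2 M + npow s M * c%:C%C * c%:C%C / s2 + zrem s2 M N -
  2 * (zsum s1 M + npow s M * c%:C%C / s1 + zrem s1 M N) +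
  (zsum s M + npow s M / s + zrem s M N) =
  (zsum s2 M - 2 * zsum s1 M + zsum s M) +
  npow s M * ((1 - c)%:C%C ^+ 2 / s2 + 2 * h%:C%C * (1 - c)%:C%C / (s1 * s2) + 2 * h%:C%C ^+ 2 / (s * s1 * s2)) +
  (zrem s2 M N - 2 * zrem s1 M N + zrem s M N).
  have hE : h%:C%C = s1 - s by rewrite /s1; ring.
  have s2E : s2 = 2 * s1 - s by rewrite /s2 hE; ring.
  rewrite rmorphB /= rmorph1; move: (c%:C%C) => c'.
  by rewrite hE s2E in shhn0 *; field; rewrite ?shn0 ?sn0 ?shhn0.
apply: le_trans (cabsD _ _) _; apply: lerD; last first.
  apply: le_trans (cabsD _ _) _; apply: le_trans (lerD (cabsB _ _) (lexx _)) _.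
  by rewrite cabsM cabs_nat; lra.
apply: le_trans (cabsD _ _) _; apply: lerD.
  have -> : zsum s2 M - 2 * zsum s1 M + zsum s M = \sum_(1 <= n < M) npow (1 + s) n * ((1 - rnp h n)%:C%C ^+ 2).
    rewrite /zsum mulr_sumr -sumrB -big_split; apply: eq_bigr => n _ /=.
    by rewrite /s2 npow_shift /s1 npow_shift rmorphB rmorph1; ring.
  apply: le_trans (head_bound M0 s0 (_ : 0 <= (h * L) ^+ 2) _) _; first by rewrite exprn_ge0// mulr_ge0.
    move=> n nM; rewrite cabsX cabsR.
    have /andP[a0 a1] := one_sub_rnp n h0; rewrite ger0_norm// lerXn2r ?nnegrE ?mulr_ge0//.
    by apply: le_trans a1 _; rewrite ler_wpM2l// (le_trans (ln_lt_le nM)).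
  by rewrite -LE exprMn -mulrA -exprSr.
rewrite cabsM; apply: le_trans (ler_piMl (cabs_ge0 _) (cabs_npow_le1 _ s0)) _.
apply: le_trans (cabsD _ _) _; apply: lerD.
  apply: le_trans (cabsD _ _) _; apply: lerD.
    rewrite cabsM cabsV cabsX cabsR (ger0_norm c0) -exprMn; apply: ler_pM; rewrite ?invr_ge0 ?cabs_ge0 ?exprn_ge0 ?inv_le//.
    by rewrite lerXn2r ?nnegrE ?mulr_ge0.
  rewrite !cabsM cabsV cabsM cabs_nat !cabsR (ger0_norm c0) (ger0_norm h0).
  apply: ler_pM; rewrite ?mulr_ge0 ?invr_ge0 ?mulr_ge0 ?cabs_ge0//.
    by rewrite expr2 -!mulrA ler_wpM2l// ler_wpM2l.
  rewrite lef_pV2 ?posrE ?exprn_gt0 ?mulr_gt0 ?(lt_le_trans r0)//.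
  by rewrite expr2 ler_pM// ltW.
rewrite cabsM cabsV (cabsM 2) cabsX cabsR cabs_nat (ger0_norm h0) (cabsM _ s2) (cabsM s).
rewrite ler_wpM2l ?mulr_ge0 ?exprn_ge0// lef_pV2 ?posrE ?exprn_gt0 ?mulr_gt0 ?(lt_le_trans r0)//.
by rewrite exprSr expr2 !ler_pM// ?mulr_ge0// ltW.
Qed.

End ZetaBounds.

Section ZetaLower.
Variable R : realType.
Implicit Types (s : R[i]) (h e r a b t : R) (M N n p X : nat).

Definition msum s N : R[i] := \sum_(1 <= n < N) (moebius n)%:~R * npow (1 + s) n.

Lemma cabs_moebius n : cabs ((moebius n)%:~R : R[i]) <= 1.
Proof.
have -> : cabs ((moebius n)%:~R : R[i]) = `|moebius n|%:~R.
  rewrite -(rmorph_int (real_complex R)) cabsR -intr_norm //.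
by rewrite -[1 in leRHS]/(1%:~R) ler_int moebius_le1.
Qed.

Lemma cabs_npow1_rnp s n : cabs (npow (1 + s) n) = rnp (1 + Re s) n.
Proof. by rewrite cabs_npow_rnp; case: s. Qed.

Lemma msum_mul_zsum s X : 0 < Re s ->
  cabs (msum s X.+1 * zsum s X.+1 - 1) <=
  rnp (Re s / 2) X.+1 * (1 + (Re s / 2)^-1) ^+ 2 + (X == 0%N)%:R.
Proof.
move=> s0; have [->|X0] := posnP X.
  rewrite /msum big_geq// mul0r sub0r cabsN cabs1 lerDr mulr_ge0 ?exprn_ge0 ?ltW ?rnp_gt0//.
  by rewrite addr_gt0// invr_gt0 divr_gt0.
rewrite addr0; set a := Re s / 2; have a0 : 0 < a by rewrite divr_gt0.
set N := X.+1.
pose F m n : R[i] := (moebius m)%:~R * npow (1 + s) (m * n).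
have -> : msum s N * zsum s N = \sum_(1 <= m < N) \sum_(1 <= n < N) F m n.
  rewrite /msum mulr_suml; apply: eq_big_nat => m /andP[m0 _].
  rewrite /zsum mulr_sumr; apply: eq_big_nat => n /andP[n0 _].
  by rewrite /F npowM// mulrA.
have -> : \sum_(1 <= m < N) \sum_(1 <= n < N) F m n =
   \sum_(1 <= m < N) \sum_(1 <= n < (X %/ m).+1) F m n +
   \sum_(1 <= m < N) \sum_((X %/ m).+1 <= n < N) F m n.
  rewrite -big_split; apply: eq_big_nat => m /andP[m0 _] /=.
  by rewrite -big_cat_nat//= ltnS leq_div.
have -> : \sum_(1 <= m < N) \sum_(1 <= n < (X %/ m).+1) F m n = 1.
  rewrite -(sum_div_pairs X F) big_ltn// [X in _ + X]big_nat_cond [X in _ + X]big1 ?addr0; last first.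
    move=> k; rewrite andbT => /andP[k1 kX]; have k0 : (0 < k)%N by exact: ltnW.
    rewrite sum_divisors_bound ?k0//.
    have -> : \sum_(1 <= d < k.+1 | (d %| k)%N) F d (k %/ d)%N =
       (\sum_(1 <= d < k.+1 | (d %| k)%N) moebius d)%:~R * npow (1 + s) k.
      rewrite rmorph_sum mulr_suml; apply: eq_bigr => d dk.
      by rewrite /F mulnC divnK.
    by rewrite sum_moebius// gtn_eqF// mul0r.
  rewrite sum_divisors_bound ?X0// big_mkcond big_nat1 /= /F divnn/= muln1 npow1 mulr1 //.
rewrite addrC addKr; apply: le_trans (cabs_sum _ _ _) _.
rewrite expr2 mulrA.
apply: (@le_trans _ _ (\sum_(1 <= m < N) rnp (1 + a) m * (rnp a N * (1 + a^-1)))); last first.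
  rewrite -mulr_suml mulrC ler_wpM2l ?sum_rnp_le//.
  by rewrite mulr_ge0 ?ltW ?rnp_gt0// addr_gt0// invr_gt0.
rewrite big_nat [leRHS]big_nat; apply: ler_sum => m /andP[m0 mN].
apply: le_trans (cabs_sum _ _ _) _.
rewrite mulrA; apply: (@le_trans _ _ (\sum_(1 <= n < N) rnp (1 + a) m * rnp a N * rnp (1 + a) n)); last first.
  rewrite -mulr_sumr ler_wpM2l ?sum_rnp_le//.
  by rewrite mulr_ge0 ?ltW ?rnp_gt0.
have mX : ((X %/ m).+1 <= N)%N by rewrite ltnS leq_div.
rewrite [leRHS](@big_cat_nat _ _ _ (X %/ m).+1)//= ler_wpDl//.
  by apply: sumr_ge0 => n _; rewrite !mulr_ge0 ?ltW ?rnp_gt0.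
rewrite big_nat [leRHS]big_nat; apply: ler_sum => n /andP[n1 nN].
have n0 : (0 < n)%N by exact: leq_trans n1.
rewrite /F cabsM; apply: le_trans (ler_piMl (cabs_ge0 _) (cabs_moebius _)) _.
rewrite cabs_npow1_rnp.
have -> : 1 + Re s = (1 + a) + a by rewrite /a; lra.
rewrite (rnpD (1 + a) a) (rnpM (1 + a))// [leRHS]mulrAC ler_wpM2l ?mulr_ge0 ?(ltW (rnp_gt0 _ _))//.
apply: rnp_mono; first exact: ltW.
by rewrite /= mulnC -ltn_divLR.
Qed.

Lemma cmult_npow s : cmult (npow s).
Proof. by split; [exact: npow1|exact: npowM]. Qed.

Lemma euler_sub_zsum s X : 0 < Re s ->
  cabs (euler (npow (1 + s)) X - zsum s X.+1) <=
  rnp (Re s / 2) X.+1 * (1 + (Re s / 2)^-1).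
Proof.
move=> s0; set a := Re s / 2; have a0 : 0 < a by rewrite divr_gt0.
have c := @euler_sub_ssum _ (npow (1 + s)) (fun n => (rnp (- a) n)%:C%C) X X (cmult_npow _).
have := c _ _ _ _ _ _; rewrite ssum_total// -/(zsum s X.+1) => {}c.
have gE n : `|npow (1 + s) n| * (rnp (- a) n)%:C%C = (rnp (1 + a) n)%:C%C.
  have -> : rnp (1 + a) n = rnp (1 + Re s) n * rnp (- a) n.
    have -> : 1 + a = 1 + Re s + - a by rewrite /a; lra.
    exact: rnpD.
  by rewrite rmorphM /= -cabs_norm cabs_npow1_rnp.
have : (cabs (euler (npow (1 + s)) X - zsum s X.+1) * rnp (- a) X.+1)%:C%C <= (euler (rnp (1 + a)) X)%:C%C.
  rewrite rmorphM /= cabs_norm.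
  have -> : (euler (rnp (1 + a)) X)%:C%C = euler (fun n => `|npow (1 + s) n| * (rnp (- a) n)%:C%C) X.
    rewrite /euler rmorph_prod; apply: eq_bigr => p _.
    by rewrite gE fmorphV rmorphB rmorph1.
  apply: c.
  - by move=> n; rewrite ltcR rnp_gt0.
  - by move=> n n0; rewrite lecR rnpN invf_ge1 ?rnp_gt0// rnp_le1// ltW.
  - by rewrite rnp1.
  - by move=> m n mn; rewrite lecR !rnpN lef_pV2 ?posrE ?rnp_gt0// rnp_mono// ltW.
  - by move=> m n m0 n0; rewrite rnpM// rmorphM.
  - by move=> p pp _; rewrite gE ltcR rnp_prime_lt1// addr_gt0.
rewrite lecR rnpN ler_pdivrMr ?rnp_gt0// => /le_trans; apply.
by rewrite mulrC ler_wpM2l ?euler_rnp_le// ltW// rnp_gt0.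
Qed.

Lemma local_341 (r t : R) : 0 <= r ->
  cabs (1 - Complex r 0) ^+ 6 * cabs (1 - Complex (r * cos t) (r * sin t)) ^+ 8 *
  cabs (1 - Complex (r * cos (t *+ 2)) (r * sin (t *+ 2))) ^+ 2 <= expR (8 * r ^+ 2).
Proof.
move=> r0.
have H u : cabs (1 - Complex (r * cos u) (r * sin u)) ^+ 2 <= expR (r ^+ 2 - 2 * r * cos u).
  rewrite cabs_sqr /=; apply: le_trans (expR_ge1Dx _).
  have := cos2Dsin2 u; move: (cos u) (sin u) => c d cd.
  have -> : (1 - r * c) ^+ 2 + (0 - r * d) ^+ 2 = 1 - 2 * r * c + r ^+ 2 * (c ^+ 2 + d ^+ 2) by ring.
  by rewrite cd; move: (r ^+ 2) (2 * r * c) => x y; lra.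
have H0 := H 0; rewrite cos0 sin0 mulr0 !mulr1 in H0.
have -> : 8 * r ^+ 2 = 3%:R * (r ^+ 2 - 2 * r) + 4%:R * (r ^+ 2 - 2 * r * cos t) +
  (r ^+ 2 - 2 * r * cos (t *+ 2)) + (4 * r * (1 + cos t) ^+ 2).
  by rewrite cos_mulr2n; ring.
rewrite 3!expRD !expRM_natl -[leLHS]mulr1.
have e1 : 1 <= expR (4 * r * (1 + cos t) ^+ 2).
  by rewrite -expR0 ler_expR mulr_ge0 ?sqr_ge0// mulr_ge0.
apply: ler_pM => //; first by rewrite !mulr_ge0 ?exprn_ge0 ?cabs_ge0.
apply: ler_pM => //; rewrite ?mulr_ge0 ?exprn_ge0 ?cabs_ge0//.
rewrite -[6%N]/(2 * 3)%N -[8%N]/(2 * 4)%N !exprM.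
apply: ler_pM; rewrite ?exprn_ge0 ?cabs_ge0//.
  by rewrite lerXn2r ?nnegrE ?exprn_ge0 ?cabs_ge0 ?expR_ge0.
by rewrite lerXn2r ?nnegrE ?exprn_ge0 ?cabs_ge0 ?expR_ge0.
Qed.

Lemma npow1_polar a b n : npow (1 + Complex a b) n =
  Complex (rnp (1 + a) n * cos (- b * ln n%:R)) (rnp (1 + a) n * sin (- b * ln n%:R)).
Proof.
rewrite /npow /cexp; simpc => /=.
by rewrite /rnp !mulNr.
Qed.

Lemma euler_341 a b X : 0 < a ->
  expR (- 16) <= cabs (euler (npow (1 + Complex a 0)) X) ^+ 6 *
    cabs (euler (npow (1 + Complex a b)) X) ^+ 8 *
    cabs (euler (npow (1 + Complex a (b *+ 2))) X) ^+ 2.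
Proof.
move=> a0; pose Q s := \prod_(1 <= p < X.+1 | prime p) cabs (1 - npow (1 + s) p).
have EQ s : cabs (euler (npow (1 + s)) X) = (Q s)^-1.
  by rewrite /euler cabs_prod -prodfV; apply: eq_bigr => p _; rewrite cabsV.
have Q0 s : Re s = a -> 0 < Q s.
  move=> sa; apply: prodr_gt0 => p pp; rewrite cabs_gt0 subr_eq0; apply/eqP => e.
  have := cabs_npow1_rnp s p; rewrite -e cabs1 sa => e1.
  by have := rnp_prime_lt1 (addr_gt0 ltr01 a0) pp; rewrite -e1 ltxx.
rewrite !EQ expRN !exprVn -!invfM lef_pV2 ?posrE ?expR_gt0 ?mulr_gt0 ?exprn_gt0 ?Q0//.
rewrite /Q -!prodrXl -!big_split /=.
apply: (@le_trans _ _ (\prod_(1 <= p < X.+1 | prime p) expR (8 * (p%:R ^+ 2)^-1))).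
  apply: ler_prod => p pp; rewrite !mulr_ge0 ?exprn_ge0 ?cabs_ge0//=.
  have p0 := prime_gt0 pp.
  have := local_341 (- b * ln p%:R) (ltW (rnp_gt0 (1 + a) p)).
  have -> : Complex (rnp (1 + a) p) 0 = npow (1 + Complex a 0) p.
    by rewrite npow1_polar oppr0 mul0r cos0 sin0 mulr1 mulr0.
  rewrite -mulrnAl mulNrn -!npow1_polar => /le_trans; apply.
  rewrite ler_expR ler_wpM2l// -exprVn lerXn2r ?nnegrE ?invr_ge0 ?(ltW (rnp_gt0 _ _))//.
  by rewrite rnpD rnp_nat// ler_piMr ?invr_ge0// rnp_le1// ltW.
rewrite -expR_sum ler_expR -mulr_sumr.
have : \sum_(1 <= p < X.+1 | prime p) (p%:R ^+ 2)^-1 <= 2 / 1 :> R.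
  apply: le_trans (@sum_inv_sqr_le R 1 X.+1 isT); rewrite big_mkcond.
  by apply: ler_sum => p _; case: ifP => // _; rewrite invr_ge0 exprn_ge0.
by move: (\sum_(_ <= _ < _ | _) _) => u; lra.
Qed.

End ZetaLower.

Section ZetaInverse.
Variable R : realType.
Implicit Types s : R[i].

Lemma complex_shift (a : R) s : Complex a (Im s) = s + (a - Re s)%:C%C.
Proof. by case: s => c d; apply/eqP; rewrite eq_complex /= addr0 addrC subrK !eqxx. Qed.

(* All scales are powers of [u]: the sums of [mu(n)/n] are studied at
   [ln X ~ u^12], hence the exponent [k = 2 u^-12]; [zeta(1 + s)] is needed for
   [|s| <= 3 u^120], hence [M >= u^150] in its Euler-Maclaurin approximation. *)
Variables (K u : R) (M N : nat).
Let x := u^-1.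
Let k := 2 * x ^+ 12.
Let L : R := 1 + ln M%:R.
Hypothesis hyps : [/\ u ^+ 150 <= M%:R, (M <= N)%N, expR (u ^+ 36) <= N%:R, 100 <= K &
  (10 ^+ 4) ^+ 8 * (27 * 15) ^+ 2 * expR 16 <= K ^+ 2 /\ K ^+ 9 * L ^+ 25 <= u].

Lemma zi_M_ge : u ^+ 150 <= M%:R. Proof. by case: hyps. Qed.
Lemma zi_leMN : (M <= N)%N. Proof. by case: hyps. Qed.
Lemma zi_N_ge : expR (u ^+ 36) <= N%:R. Proof. by case: hyps. Qed.
Lemma zi_K_ge : 100 <= K. Proof. by case: hyps. Qed.
Lemma zi_K2_ge : (10 ^+ 4) ^+ 8 * (27 * 15) ^+ 2 * expR 16 <= K ^+ 2.
Proof. by case: hyps => _ _ _ _ []. Qed.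
Lemma zi_u_ge : K ^+ 9 * L ^+ 25 <= u. Proof. by case: hyps => _ _ _ _ []. Qed.

Lemma zi_L1 : 1 <= L. Proof. by rewrite lerDl ln_nat_ge0. Qed.

Lemma zi_K1 : 1 <= K. Proof. by apply: le_trans zi_K_ge; rewrite ler1n. Qed.

Lemma zi_u1000 : 100 <= u.
Proof.
have h : 1 <= L ^+ 25 by rewrite exprn_ege1// zi_L1.
have h1 : K <= K ^+ 9 by rewrite ler_eXnr// zi_K1.
apply: le_trans zi_u_ge; apply: le_trans zi_K_ge _; apply: le_trans h1 _.
by rewrite ler_peMr// exprn_ge0// (le_trans _ zi_K1).
Qed.

Let u0 : 0 < u. Proof. by apply: lt_le_trans zi_u1000; lra. Qed.
Let x0 : 0 < x. Proof. by rewrite invr_gt0 u0. Qed.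
Let xs : x <= 100^-1. Proof. by rewrite lef_pV2 ?posrE ?u0// zi_u1000. Qed.
Let x1 : x <= 1. Proof. by apply: le_trans xs _; lra. Qed.
Let ux : u * x = 1. Proof. by rewrite divff// gt_eqF// u0. Qed.
Let k0 : 0 < k. Proof. by rewrite mulr_gt0 ?exprn_gt0. Qed.

Lemma zi_pow (c : R) (m n : nat) : (m < n)%N -> 0 <= c -> c <= 100 -> c * x ^+ n <= x ^+ m.
Proof.
move=> mn c0 c1; rewrite -(subnKC mn) exprD exprSr -mulrA mulrCA.
rewrite -[leRHS]mulr1 ler_pM2l ?exprn_gt0// mulrA mulrC.
have h1 : x ^+ (n - m.+1) <= 1 by rewrite exprn_ile1 ?(ltW x0)// x1.
rewrite -[leRHS]mulr1 ler_pM ?exprn_ge0 ?(ltW x0) ?mulr_ge0 ?(ltW x0)//.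
apply: le_trans (ler_pM c0 (ltW x0) c1 xs) _; lra.
Qed.

Lemma zi_uX (m n : nat) : (m <= n)%N -> u ^+ m * x ^+ n = x ^+ (n - m).
Proof. by move=> mn; rewrite -{1}(subnKC mn) exprD mulrA -exprMn ux expr1n mul1r. Qed.

Let M0 : (0 < M)%N.
Proof. by rewrite -(ltr0n R); apply: lt_le_trans zi_M_ge; rewrite exprn_gt0. Qed.

Lemma zi_tiny : rnp (k / 2) N * (1 + (k / 2)^-1) ^+ 2 <= x ^+ 29.
Proof.
have -> : k / 2 = x ^+ 12 by rewrite /k; field.
have -> : (x ^+ 12)^-1 = u ^+ 12 by rewrite -exprVn invrK.
have N0 : (0 : R) < N%:R by apply: lt_le_trans zi_N_ge; exact: expR_gt0.
have lN : u ^+ 36 <= ln N%:R by rewrite -[leLHS]expRK ler_ln ?posrE ?expR_gt0// zi_N_ge.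
have h1 : rnp (x ^+ 12) N <= (u ^+ 96 / 24)^-1.
  have h2 : u ^+ 24 <= x ^+ 12 * ln N%:R.
    have -> : u ^+ 24 = x ^+ 12 * u ^+ 36 by rewrite -[36%N]/(12 + 24)%N exprD mulrA -exprMn [x * u]mulrC ux expr1n mul1r.
    by rewrite ler_wpM2l// exprn_ge0// ltW.
  rewrite /rnp mulNr expRN lef_pV2 ?posrE ?expR_gt0 ?divr_gt0 ?exprn_gt0//.
  have := @expR_ge1Dxn R (u ^+ 24) 3 (exprn_ge0 _ (ltW u0)).
  rewrite -exprM -[(24 * 4)%N]/96%N -[(4`!)%:R]/(24%:R : R).
  have : expR (u ^+ 24) <= expR (x ^+ 12 * ln N%:R) by rewrite ler_expR.
  by move: (expR _) (expR _) (_ / 24) => a b c; lra.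
have h3 : 1 + u ^+ 12 <= 2 * u ^+ 12.
  have : 1 <= u ^+ 12 by rewrite exprn_ege1//; have := zi_u1000; lra.
  lra.
apply: le_trans (ler_pM (ltW (rnp_gt0 _ _)) (exprn_ge0 _ _) h1 (lerXn2r _ _ _ h3)) _; rewrite ?nnegrE ?addr_ge0 ?mulr_ge0 ?exprn_ge0 ?(ltW u0)//.
rewrite invf_div -exprVn exprMn -exprM -[(12 * 2)%N]/24%N.
have -> : 24 * x ^+ 96 * (2 ^+ 2 * u ^+ 24) = 96 * (u ^+ 24 * x ^+ 96) :> R by ring.
by rewrite zi_uX//; apply: zi_pow => //; lra.
Qed.

Lemma zi_tiny_mono a : k <= a -> rnp (a / 2) N * (1 + (a / 2)^-1) ^+ 2 <= x ^+ 29.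
Proof.
move=> ka; apply: le_trans zi_tiny; have a0 : 0 < a by exact: lt_le_trans ka.
have h : (a / 2)^-1 <= (k / 2)^-1 by rewrite lef_pV2 ?posrE ?divr_gt0// ler_pM2r// invr_gt0.
apply: ler_pM; rewrite ?(ltW (rnp_gt0 _ _)) ?exprn_ge0 ?addr_ge0 ?invr_ge0 ?divr_ge0 ?(ltW a0)//.
  by rewrite ler_expR !mulNr lerN2 ler_wpM2r ?ln_nat_ge0// ler_pM2r// invr_gt0.
by rewrite lerXn2r ?nnegrE ?addr_ge0 ?invr_ge0 ?divr_ge0 ?(ltW a0) ?(ltW k0)// lerD2l.
Qed.

Lemma zi_tail a (c : R) : k <= a -> a <= c -> rnp a N / c <= x ^+ 29.
Proof.
move=> ka ac; apply: le_trans (zi_tiny_mono ka).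
have a0 : 0 < a by exact: lt_le_trans ka.
have h2 : (a / 2)^-1 = 2 * a^-1 by field; rewrite gt_eqF.
apply: ler_pM; rewrite ?(ltW (rnp_gt0 _ _)) ?invr_ge0 ?(ltW (lt_le_trans a0 ac))//.
  rewrite ler_expR !mulNr lerN2 ler_wpM2r ?ln_nat_ge0//; lra.
apply: (@le_trans _ _ a^-1); first by rewrite lef_pV2 ?posrE ?(lt_le_trans a0).
have : 0 < a^-1 by rewrite invr_gt0.
rewrite h2; move: (a^-1) => b b0; rewrite expr2 mulrDl mul1r; have := sqr_ge0 b; rewrite expr2 => h; nra.
Qed.

Lemma zi_zrem s : k <= Re s -> cabs s <= 3 * u ^+ 120 -> cabs (zrem s M N) <= x ^+ 28.
Proof.
move=> ks sB; have s0 : 0 < Re s by exact: lt_le_trans ks.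
have rs : Re s <= cabs s by apply: le_trans (cabs_Re s); exact: ler_norm.
have sn0 : s != 0 by rewrite -cabs_gt0 (lt_le_trans s0).
apply: le_trans (zrem_le _ (ltW s0) sn0) _; first by rewrite M0 zi_leMN.
have h1 := zi_tail ks rs.
have h2 : (6 * cabs s + 2) / M%:R <= 20 * x ^+ 30.
  apply: (@le_trans _ _ ((20 * u ^+ 120) * x ^+ 150)).
    apply: ler_pM; rewrite ?addr_ge0 ?mulr_ge0 ?cabs_ge0 ?invr_ge0//.
      have : 1 <= u ^+ 120 by rewrite exprn_ege1//; have := zi_u1000; lra.
      lra.
    by rewrite -[x]/(u^-1) exprVn lef_pV2 ?posrE ?exprn_gt0 ?ltr0n// zi_M_ge.
  by rewrite -mulrA zi_uX.
have h3 := @zi_pow 40 28 30 isT _ _; have h4 := @zi_pow 2 28 29 isT _ _.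
have {}h3 : 40 * x ^+ 30 <= x ^+ 28 by apply: h3; lra.
have {}h4 : 2 * x ^+ 29 <= x ^+ 28 by apply: h4; lra.
lra.
Qed.

Lemma zi_small s : k <= Re s -> cabs s <= 12^-1 -> cabs (zsum s N - s^-1) <= 3.
Proof.
move=> ks sB; have s0 : 0 < Re s by exact: lt_le_trans ks.
have rs : Re s <= cabs s by apply: le_trans (cabs_Re s); exact: ler_norm.
have sn0 : s != 0 by rewrite -cabs_gt0 (lt_le_trans s0).
have N0 : (0 < 1 <= N)%N by rewrite /= (leq_trans M0 zi_leMN).
have := zrem_le N0 (ltW s0) sn0; rewrite /zrem {2}/zsum big_geq// subr0 npow1 mul1r.
move/le_trans; apply; have h1 := zi_tail ks rs.
have : x ^+ 29 <= 2^-1.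
  by have := @zi_pow 2 0 29 isT _ _; rewrite expr0 => h; have := h (ler0n _ _) (_ : _ <= _); move=> h'; have := h' ltac:(lra); lra.
rewrite divr1; lra.
Qed.

Lemma zi_small_lower s : k <= Re s -> cabs s <= 12^-1 ->
  zsum s N != 0 /\ (cabs (zsum s N))^-1 <= 2 * cabs s.
Proof.
move=> ks sB; have s0 : 0 < Re s by exact: lt_le_trans ks.
have rs : Re s <= cabs s by apply: le_trans (cabs_Re s); exact: ler_norm.
have cs0 : 0 < cabs s by exact: lt_le_trans rs.
have := zi_small ks sB; rewrite cabs_distC => h; have h2 := cabs_sub (s^-1) (zsum s N).
rewrite cabsV in h2.
have h3 : 12 <= (cabs s)^-1 by rewrite -[leLHS]invrK lef_pV2 ?posrE ?invr_gt0.
have h4 : (2 * cabs s)^-1 <= cabs (zsum s N) by rewrite invfM; lra.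
have z0 : 0 < cabs (zsum s N) by apply: lt_le_trans h4; rewrite invr_gt0 mulr_gt0.
split; first by rewrite -cabs_gt0.
by rewrite -[leRHS]invrK lef_pV2 ?posrE ?invr_gt0 ?mulr_gt0.
Qed.

Lemma zi_small_inv s : k <= Re s -> cabs s <= 12^-1 ->
  cabs ((zsum s N)^-1 - s) <= 6 * cabs s ^+ 2.
Proof.
move=> ks sB; have s0 : 0 < Re s by exact: lt_le_trans ks.
have rs : Re s <= cabs s by apply: le_trans (cabs_Re s); exact: ler_norm.
have sn0 : s != 0 by rewrite -cabs_gt0 (lt_le_trans s0).
have [z0 zi] := zi_small_lower ks sB.
have -> : (zsum s N)^-1 - s = s * (s^-1 - zsum s N) / zsum s N by field; rewrite ?sn0 ?z0.
rewrite !cabsM cabsV.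
have -> : 6 * cabs s ^+ 2 = cabs s * 3 * (2 * cabs s) by ring.
apply: ler_pM => //; rewrite ?mulr_ge0 ?cabs_ge0 ?invr_ge0 ?cabs_ge0//.
by rewrite ler_wpM2l ?cabs_ge0// cabs_distC zi_small.
Qed.


Lemma zi_KL (i j : nat) : (i <= 9)%N -> (j <= 25)%N -> K ^+ i * L ^+ j <= u.
Proof.
move=> i9 j25; apply: le_trans zi_u_ge; apply: ler_pM.
- by rewrite exprn_ge0// (le_trans _ zi_K1).
- by rewrite exprn_ge0// (le_trans _ zi_L1).
- by rewrite ler_weXn2l// zi_K1.
- by rewrite ler_weXn2l// zi_L1.
Qed.

Lemma zi_euler s : k <= Re s -> cabs (euler (npow (1 + s)) N.-1 - zsum s N) <= x ^+ 29.
Proof.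
move=> ks; have s0 : 0 < Re s by exact: lt_le_trans ks.
have N0 : (0 < N)%N by rewrite (leq_trans M0 zi_leMN).
have := euler_sub_zsum N.-1 s0; rewrite prednK// => /le_trans; apply.
apply: le_trans (zi_tiny_mono ks); rewrite ler_wpM2l ?(ltW (rnp_gt0 _ _))//.
by rewrite expr2 ler_peMl// ?lerDl ?addr_ge0// invr_ge0 divr_ge0// ltW.
Qed.

Lemma zi_zsum_real (a : R) : 0 < a -> cabs (zsum (Complex a 0) N) <= 1 + a^-1.
Proof.
move=> a0; apply: le_trans (cabs_sum _ _ _) _; apply: le_trans (sum_rnp_le N a0).
by apply: ler_sum => n _; rewrite cabs_npow1_rnp.
Qed.

Let L0 : 0 < L. Proof. by apply: lt_le_trans zi_L1. Qed.
Let K0 : 0 < K. Proof. by apply: lt_le_trans zi_K1. Qed.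

Lemma zi_euler_lower (a b : R) : k <= a -> a = (K * L ^+ 9)^-1 ->
  24^-1 <= `|b| -> `|b| <= u ^+ 120 ->
  10 ^+ 4 * (a * L ^+ 2) <= cabs (euler (npow (1 + Complex a b)) N.-1).
Proof.
move=> ka aE b1 b2; have a0 : 0 < a by exact: lt_le_trans ka.
have a1 : a <= 1.
  rewrite aE invf_le1 ?mulr_gt0 ?exprn_gt0//.
  by rewrite -[leLHS]mulr1 ler_pM// ?zi_K1// exprn_ege1// zi_L1.
have ai1 : 1 <= a^-1 by rewrite invf_ge1.
have x28 : x ^+ 28 <= 1 by rewrite exprn_ile1 ?(ltW x0)// x1.
have x29 : x ^+ 29 <= 1 by rewrite exprn_ile1 ?(ltW x0)// x1.
have u1 : 1 <= u ^+ 120 by rewrite exprn_ege1//; have := zi_u1000; lra.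
set E1 := cabs _; rewrite leNgt; apply/negP => lt.
have E0le : cabs (euler (npow (1 + Complex a 0)) N.-1) <= 3 * a^-1.
  have := @zi_euler (Complex a 0) ka; have := zi_zsum_real a0.
  have := cabs_sub (euler (npow (1 + Complex a 0)) N.-1) (zsum (Complex a 0) N).
  move: (cabs _) (cabs _) (cabs _) => p q r; lra.
have E2le : cabs (euler (npow (1 + Complex a (b *+ 2))) N.-1) <= 15 * L.
  have B1 : 12^-1 <= cabs (Complex a (b *+ 2)).
    apply: le_trans (cabs_Im _) => /=; rewrite normrMn; lra.
  have B2 : cabs (Complex a (b *+ 2)) <= 3 * u ^+ 120.
    apply: le_trans (cabs_le _) _ => /=; rewrite normrMn (gtr0_norm a0); lra.
  have h1 := @zi_zrem (Complex a (b *+ 2)) ka B2.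
  have r0 : (0 : R) < 12^-1 by lra.
  have := zsum_bound M0 (_ : 0 <= Re (Complex a (b *+ 2))) r0 B1 h1.
  rewrite invrK => /(_ (ltW a0)); rewrite -/L => h2.
  have := @zi_euler (Complex a (b *+ 2)) ka.
  have := cabs_sub (euler (npow (1 + Complex a (b *+ 2))) N.-1) (zsum (Complex a (b *+ 2)) N).
  move: h2; have := zi_L1; move: (cabs _) (cabs _) (cabs _) L => p q r l; lra.
have := euler_341 b N.-1 a0; rewrite -/E1; apply/negP; rewrite -ltNge.
have B0 : 0 < 10 ^+ 4 * (a * L ^+ 2) by rewrite !mulr_gt0 ?exprn_gt0.
apply: (@lt_le_trans _ _ ((3 * a^-1) ^+ 6 * (10 ^+ 4 * (a * L ^+ 2)) ^+ 8 * (15 * L) ^+ 2)).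
  have p1 : 0 < (3 * a^-1) ^+ 6 by rewrite exprn_gt0// mulr_gt0// invr_gt0.
  have p2 : 0 < (15 * L) ^+ 2 by rewrite exprn_gt0// mulr_gt0.
  apply: (@le_lt_trans _ _ ((3 * a^-1) ^+ 6 * E1 ^+ 8 * (15 * L) ^+ 2)).
    apply: ler_pM; rewrite ?mulr_ge0 ?exprn_ge0 ?cabs_ge0//.
      by rewrite ler_wpM2r ?exprn_ge0 ?cabs_ge0// lerXn2r ?nnegrE ?cabs_ge0 ?mulr_ge0 ?invr_ge0 ?(ltW a0).
    by rewrite lerXn2r ?nnegrE ?cabs_ge0 ?mulr_ge0 ?(ltW L0).
  by rewrite ltr_pM2r// ltr_pM2l// ltrXn2r// ?cabs_ge0.
have -> : (3 * a^-1) ^+ 6 * (10 ^+ 4 * (a * L ^+ 2)) ^+ 8 * (15 * L) ^+ 2 =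
  (10 ^+ 4) ^+ 8 * (27 * 15) ^+ 2 * (a * L ^+ 9) ^+ 2.
  move: (10 ^+ 4) => t; field; exact: lt0r_neq0.
have -> : a * L ^+ 9 = K^-1 by rewrite aE invfM -mulrA mulVf ?mulr1// expf_neq0// gt_eqF.
by rewrite expRN exprVn -[leRHS]mul1r ler_pdivlMr ?expR_gt0// mulrAC ler_pdivrMr ?exprn_gt0// mul1r zi_K2_ge.
Qed.

Lemma zi_large_lower s : k <= Re s -> Re s <= 3 * k -> 24^-1 <= `|Im s| -> `|Im s| <= u ^+ 120 ->
  (K * L ^+ 7)^-1 <= cabs (zsum s N).
Proof.
move=> ks sk b1 b2; set a := (K * L ^+ 9)^-1.
have x11 : 6 * x ^+ 12 <= x ^+ 11 by apply: zi_pow => //; lra.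
have ka : 3 * k <= a.
  apply: (@le_trans _ _ x); last first.
    rewrite lef_pV2 ?posrE ?mulr_gt0 ?exprn_gt0// -[K]expr1; exact: zi_KL.
  apply: (@le_trans _ _ (x ^+ 11)); first by rewrite /k; lra.
  by rewrite exprS ler_piMr ?(ltW x0)// exprn_ile1 ?(ltW x0)// x1.
have ka' : k <= a by have := k0; lra.
have E := zi_euler_lower ka' erefl b1 b2.
have a0 : 0 < a by exact: lt_le_trans ka'.
set b := Im s in E b1 b2 *; set z := Complex a b in E *.
have zE : z = s + (a - Re s)%:C%C by exact: complex_shift.
have h0 : 0 <= a - Re s by lra.
have u1 : 1 <= u ^+ 120 by rewrite exprn_ege1//; have := zi_u1000; lra.
have a1 : a <= 1.
  rewrite invf_le1 ?mulr_gt0 ?exprn_gt0//.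
  by rewrite -[leLHS]mulr1 ler_pM// ?zi_K1// exprn_ege1// zi_L1.
have s0 : 0 < Re s by exact: lt_le_trans ks.
have B1 : 24^-1 <= cabs s by apply: le_trans (cabs_Im _).
have B2 : 24^-1 <= cabs z by apply: le_trans (cabs_Im _).
have B3 : cabs s <= 3 * u ^+ 120.
  apply: le_trans (cabs_le _) _; rewrite -/b (gtr0_norm s0); lra.
have B4 : cabs z <= 3 * u ^+ 120.
  apply: le_trans (cabs_le _) _ => /=; rewrite (gtr0_norm a0); lra.
have e1 := zi_zrem ks B3; have e2 := @zi_zrem z ka' B4.
have r0 : (0 : R) < 24^-1 by lra.
rewrite zE in B2 e2.
have := zsum_diff1 M0 (ltW s0) h0 r0 B1 B2 e1 e2 (erefl L); rewrite -zE.
have := zi_euler (_ : k <= Re z); rewrite /= => /(_ ka').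
have := cabs_sub (euler (npow (1 + z)) N.-1) (zsum z N).
have := cabs_sub (zsum z N) (zsum s N).
have -> : (K * L ^+ 7)^-1 = a * L ^+ 2.
  by rewrite /a; field; rewrite !gt_eqF.
have -> : (24^-1)^-1 = 24 :> R by rewrite invrK.
have -> : ((24^-1) ^+ 2)^-1 = 576 :> R by rewrite exprVn invrK -natrX.
have hL : (a - Re s) * L ^+ 2 <= a * L ^+ 2 by rewrite ler_wpM2r ?exprn_ge0 ?(ltW L0)//; lra.
have L2 : 1 <= L ^+ 2 by rewrite exprn_ege1// zi_L1.
have LL : L <= L ^+ 2 by rewrite ler_eXnr// zi_L1.
have hL1 : (a - Re s) * L <= (a - Re s) * L ^+ 2 by rewrite ler_wpM2l.
have hL2 : (a - Re s) * 1 <= (a - Re s) * L ^+ 2 by rewrite ler_wpM2l.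
have aL : a <= a * L ^+ 2 by rewrite ler_peMr// ltW.
have x28 : x ^+ 28 <= x ^+ 12 by rewrite ler_wiXn2l ?(ltW x0)// x1.
have x29 : x ^+ 29 <= x ^+ 12 by rewrite ler_wiXn2l ?(ltW x0)// x1.
have kx : 6 * x ^+ 12 <= a by move: ka; rewrite /k; lra.
move: E; have -> : (10 : R) ^+ 4 = 10 * 10 * 10 * 10 by ring.
rewrite mulr1 in hL2.
move: (cabs _) (cabs _) (cabs _) (cabs _) (cabs _) a0 hL hL1 hL2 aL x28 x29 kx.
move: ((a - Re s) * L ^+ 2) ((a - Re s) * L) (a * L ^+ 2) (a - Re s) (x ^+ 28) (x ^+ 29) (x ^+ 12).
clear; intros; lra.
Qed.


Lemma zi_msum s : k <= Re s -> zsum s N != 0 ->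
  cabs (msum s N - (zsum s N)^-1) <= x ^+ 29 * (cabs (zsum s N))^-1.
Proof.
move=> ks z0; have s0 : 0 < Re s by exact: lt_le_trans ks.
have N0 : (0 < N)%N by rewrite (leq_trans M0 zi_leMN).
have -> : msum s N - (zsum s N)^-1 = (msum s N * zsum s N - 1) * (zsum s N)^-1 by field.
rewrite cabsM cabsV ler_wpM2r ?invr_ge0 ?cabs_ge0//.
have := msum_mul_zsum N.-1 s0; rewrite prednK//.
have M1 : (1 < M)%N.
  rewrite -(ltr_nat R); apply: lt_le_trans zi_M_ge.
  by rewrite exprn_egt1//; apply: lt_le_trans zi_u1000; lra.
have -> : (N.-1 == 0)%N = false by apply/negbTE; move: M1 zi_leMN; clear; lia.
by rewrite addr0 => /le_trans; apply; exact: zi_tiny_mono.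
Qed.

Lemma zi_mono (r : R) (i j i' j' : nat) : 1 <= r -> (i <= i')%N -> (j <= j')%N ->
  L ^+ i * r ^+ j <= L ^+ i' * r ^+ j'.
Proof.
move=> r1 ii jj; apply: ler_pM; rewrite ?exprn_ge0 ?(ltW L0) ?(le_trans ler01 r1)//.
  by rewrite ler_weXn2l ?zi_L1.
by rewrite ler_weXn2l.
Qed.

Let kC := (k%:C)%C : R[i].

(* A second difference in [s] with step [k]: about [k^2] where [zeta(1 + s)] is
   regular, and small also near its pole, as [1 / zeta(1 + s) ~ s] there. *)
Definition zi_second s : R[i] := msum s N - 2 * msum (s + kC) N + msum (s + kC + kC) N.

Lemma zi_second_main s (r : R) : k <= Re s -> x ^+ 8 <= r -> r <= 1 ->
  (forall z, z \in [:: s; s + kC; s + kC + kC] ->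
     [/\ r <= cabs z, cabs z <= 3 * u ^+ 120, zsum z N != 0 &
        (cabs (zsum z N))^-1 <= K ^+ 2 * L ^+ 7 * r]) ->
  cabs (zi_second s) <= x ^+ 15.
Proof.
move=> ks r8 r1 H.
have r0 : 0 < r by apply: lt_le_trans r8; rewrite exprn_gt0.
have ks1 : k <= Re (s + kC) by rewrite Re_realD; have := k0; lra.
have ks2 : k <= Re (s + kC + kC) by rewrite Re_realD; have := k0; lra.
have [a1 b1 c1 d1] := H s (mem_head _ _).
have [a2 b2 c2 d2] : [/\ r <= cabs (s + kC), cabs (s + kC) <= 3 * u ^+ 120, zsum (s + kC) N != 0 &
        (cabs (zsum (s + kC) N))^-1 <= K ^+ 2 * L ^+ 7 * r].
  by apply: H; rewrite !inE eqxx orbT.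
have [a3 b3 c3 d3] : [/\ r <= cabs (s + kC + kC), cabs (s + kC + kC) <= 3 * u ^+ 120, zsum (s + kC + kC) N != 0 &
        (cabs (zsum (s + kC + kC) N))^-1 <= K ^+ 2 * L ^+ 7 * r].
  by apply: H; rewrite !inE eqxx !orbT.
have e1 := zi_zrem ks b1; have e2 := zi_zrem ks1 b2; have e3 := zi_zrem ks2 b3.
have s0 : 0 <= Re s by apply: le_trans ks; exact: ltW.
have m1 := zi_msum ks c1; have m2 := zi_msum ks1 c2; have m3 := zi_msum ks2 c3.
have Z0 := zsum_bound M0 s0 r0 a1 e1.
have D1 := zsum_diff1 M0 s0 (ltW k0) r0 a1 a2 e1 e2 (erefl L).
have D2 := zsum_diff2 M0 s0 (ltW k0) r0 a1 a2 a3 e1 e2 e3 (erefl L).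
clear H ks ks1 ks2 s0 a1 a2 a3 b1 b2 b3 e1 e2 e3.
set z0 := zsum s N in c1 d1 m1 Z0 D1 D2 *.
rewrite -/kC in D1 D2.
set z1 := zsum (s + kC) N in c2 d2 m2 D1 D2 *.
set z2 := zsum (s + kC + kC) N in c3 d3 m3 D2 *.
set W := K ^+ 2 * L ^+ 7 * r in d1 d2 d3.
set q := r^-1; have q1 : 1 <= q by rewrite invf_ge1.
have q0 : 0 < q by rewrite invr_gt0.
rewrite -/L -/q in Z0; rewrite -/q -!exprVn -/q in D1 D2.
have x28 : x ^+ 28 <= x ^+ 24 by rewrite ler_wiXn2l ?(ltW x0)// x1.
have x24 : x ^+ 24 <= x ^+ 12 by rewrite ler_wiXn2l ?(ltW x0)// x1.
have x12 : x ^+ 28 <= 1 by rewrite exprn_ile1 ?(ltW x0)// x1.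
have k2 : k ^+ 2 = 4 * x ^+ 24 by rewrite /k exprMn -exprM; ring.
have M10 := @zi_mono q 1 0 1 1 q1 isT isT.
have M01 := @zi_mono q 0 1 1 1 q1 isT isT.
have M00 := @zi_mono q 0 0 1 1 q1 isT isT.
rewrite !expr0 !expr1 !mulr1 !mul1r in M10 M01 M00.
have Z0' : cabs z0 <= 3 * (L * q) by move: Z0 M10 M01 M00 x12; lra.
have D1' : cabs (z1 - z0) <= 4 * k * (L ^+ 2 * q ^+ 2).
  have t1 := @zi_mono q 2 0 2 2 q1 isT isT; have t2 := @zi_mono q 1 1 2 2 q1 isT isT.
  have t3 := @zi_mono q 0 2 2 2 q1 isT isT; have t4 := @zi_mono q 0 0 2 2 q1 isT isT.
  rewrite !expr0 !expr1 ?mulr1 ?mul1r in t1 t2 t3 t4.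
  have {}t1 := ler_wpM2l (ltW k0) t1; have {}t2 := ler_wpM2l (ltW k0) t2.
  have {}t3 := ler_wpM2l (ltW k0) t3; have {}t4 := ler_wpM2l (ltW k0) t4.
  have kx : 2 * x ^+ 28 <= k by rewrite /k; move: x28 x24 (exprn_ge0 12 (ltW x0)); lra.
  rewrite mulr1 in t4; rewrite mulrA in t2; move: D1 t1 t2 t3 t4 kx; lra.
have D2' : cabs (z2 - 2 * z1 + z0) <= 7 * k ^+ 2 * (L ^+ 3 * q ^+ 3).
  have t1 := @zi_mono q 3 0 3 3 q1 isT isT; have t2 := @zi_mono q 2 1 3 3 q1 isT isT.
  have t3 := @zi_mono q 1 2 3 3 q1 isT isT; have t4 := @zi_mono q 0 3 3 3 q1 isT isT.
  have t5 := @zi_mono q 0 0 3 3 q1 isT isT.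
  rewrite !expr0 !expr1 ?mulr1 ?mul1r in t1 t2 t3 t4 t5.
  have kk : 0 <= k ^+ 2 by rewrite exprn_ge0// ltW.
  have x4 : 4 * x ^+ 28 <= k ^+ 2 by rewrite k2; move: x28 (exprn_ge0 24 (ltW x0)); lra.
  have {}t5 : k ^+ 2 <= k ^+ 2 * (L ^+ 3 * q ^+ 3) by rewrite ler_peMr.
  have t6 : L ^+ 3 + L ^+ 2 * q + 2 * (L * q ^+ 2) + 2 * q ^+ 3 <= 6 * (L ^+ 3 * q ^+ 3).
    by move: t1 t2 t3 t4; lra.
  have {}t6 := ler_wpM2l kk t6.
  apply: le_trans D2 _.
  have -> : k ^+ 2 * L ^+ 3 + (k ^+ 2 * L ^+ 2 * q + 2 * k ^+ 2 * L * q ^+ 2 + 2 * k ^+ 2 * q ^+ 3) + 4 * x ^+ 28 =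
    k ^+ 2 * (L ^+ 3 + L ^+ 2 * q + 2 * (L * q ^+ 2) + 2 * q ^+ 3) + 4 * x ^+ 28 by ring.
  have -> : 7 * k ^+ 2 * (L ^+ 3 * q ^+ 3) = k ^+ 2 * (6 * (L ^+ 3 * q ^+ 3)) + k ^+ 2 * (L ^+ 3 * q ^+ 3) by ring.
  by move: t5 t6 x4; lra.
have W0 : 0 < W by rewrite !mulr_gt0 ?exprn_gt0.
pose d1' := z1 - z0; pose d2' := z2 - 2 * z1 + z0.
have E : z0^-1 - 2 * z1^-1 + z2^-1 = (2 * d1' ^+ 2 + d1' * d2' - z0 * d2') * (z0^-1 * z1^-1 * z2^-1).
  by rewrite /d1' /d2'; field; rewrite c1 c2 c3.
have kLq : k * (L * q) <= 4^-1.
  have : L * q <= u ^+ 9.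
    rewrite exprS; apply: ler_pM => //; rewrite ?(ltW L0) ?(ltW q0)//.
      by have := @zi_KL 0 1 isT isT; rewrite expr0 mul1r expr1.
    by rewrite /q -[u]invrK exprVn lef_pV2 ?posrE ?exprn_gt0.
  move/(ler_wpM2l (ltW k0))/le_trans; apply.
  have -> : k * u ^+ 9 = 2 * (u ^+ 9 * x ^+ 12) by rewrite /k; ring.
  rewrite zi_uX//; have : 100 * x ^+ 3 <= x ^+ 0 by apply: zi_pow => //; lra.
  by rewrite expr0 -[(12 - 9)%N]/3%N; lra.
have num : cabs (2 * d1' ^+ 2 + d1' * d2' - z0 * d2') <= 60 * k ^+ 2 * (L ^+ 4 * q ^+ 4).
  apply: le_trans (cabsB _ _) _; apply: le_trans (lerD (cabsD _ _) (lexx _)) _.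
  rewrite (cabsM 2) cabsX cabs_nat !(cabsM _ d2') -/d1' -/d2' in D1' D2' *.
  have n1 : cabs d1' ^+ 2 <= 16 * k ^+ 2 * (L ^+ 4 * q ^+ 4).
    have -> : 16 * k ^+ 2 * (L ^+ 4 * q ^+ 4) = (4 * k * (L ^+ 2 * q ^+ 2)) ^+ 2 by ring.
    by rewrite lerXn2r ?nnegrE ?cabs_ge0// (le_trans (cabs_ge0 _) D1').
  have n2 : cabs z0 * cabs d2' <= 21 * k ^+ 2 * (L ^+ 4 * q ^+ 4).
    have -> : 21 * k ^+ 2 * (L ^+ 4 * q ^+ 4) = 3 * (L * q) * (7 * k ^+ 2 * (L ^+ 3 * q ^+ 3)) by ring.
    by rewrite ler_pM ?cabs_ge0.
  have n3 : cabs d1' * cabs d2' <= 7 * k ^+ 2 * (L ^+ 4 * q ^+ 4).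
    apply: le_trans (ler_pM (cabs_ge0 _) (cabs_ge0 _) D1' D2') _.
    have -> : 4 * k * (L ^+ 2 * q ^+ 2) * (7 * k ^+ 2 * (L ^+ 3 * q ^+ 3)) =
       28 * k ^+ 2 * (L ^+ 4 * q ^+ 4) * (k * (L * q)) by ring.
    have T0 : 0 <= 28 * k ^+ 2 * (L ^+ 4 * q ^+ 4) by rewrite k2 !mulr_ge0 ?exprn_ge0 ?(ltW L0) ?(ltW q0) ?(ltW x0).
    apply: le_trans (ler_wpM2l T0 kLq) _.
    by rewrite le_eqVlt; apply/orP; left; apply/eqP; field.
  lra.
have main : cabs (z0^-1 - 2 * z1^-1 + z2^-1) <= 2^-1 * x ^+ 15.
  rewrite E cabsM; have invs : cabs (z0^-1 * z1^-1 * z2^-1) <= W ^+ 3.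
    rewrite !cabsM !cabsV -[W ^+ 3]/(W * (W * W)) mulrA !ler_pM ?mulr_ge0 ?invr_ge0 ?cabs_ge0//.
  apply: le_trans (ler_pM (cabs_ge0 _) (cabs_ge0 _) num invs) _.
  have -> : 60 * k ^+ 2 * (L ^+ 4 * q ^+ 4) * W ^+ 3 = 240 * (x ^+ 24 * q) * (K ^+ 6 * L ^+ 25).
    by rewrite k2 /W /q; field; rewrite gt_eqF.
  have h1 : x ^+ 24 * q <= x ^+ 16.
    rewrite -[24%N]/(16 + 8)%N exprD -mulrA ler_piMr ?exprn_ge0 ?(ltW x0)//.
    by rewrite /q ler_pdivrMr// mul1r.
  have h2 : 1000 * (K ^+ 6 * L ^+ 25) <= u.
    apply: le_trans (@zi_KL 8 25 isT isT); rewrite mulrA ler_wpM2r ?exprn_ge0 ?(ltW L0)//.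
    rewrite -[8%N]/(6 + 2)%N exprD mulrC ler_wpM2l ?exprn_ge0 ?(ltW K0)//.
    apply: (@le_trans _ _ (100 * 100)); first by lra.
    by rewrite expr2 ler_pM// zi_K_ge.
  have h3 : x ^+ 16 * u = x ^+ 15 by rewrite mulrC -[16%N]/(1 + 15)%N exprD expr1 mulrA ux mul1r.
  have T0 : 0 <= K ^+ 6 * L ^+ 25 by rewrite mulr_ge0 ?exprn_ge0 ?(ltW L0) ?(ltW K0).
  have := ler_wpM2r T0 h1; have := ler_wpM2l (exprn_ge0 16 (ltW x0)) h2.
  rewrite h3 => w1 w2; have x15 := exprn_ge0 15 (ltW x0).
  by move: w1 w2 x15; lra.
have -> : zi_second s = (msum s N - z0^-1) - 2 * (msum (s + kC) N - z1^-1) + (msum (s + kC + kC) N - z2^-1) + (z0^-1 - 2 * z1^-1 + z2^-1).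
  by rewrite /zi_second; ring.
apply: le_trans (cabsD _ _) _; apply: le_trans (lerD (cabsD _ _) (lexx _)) _.
apply: le_trans (lerD (lerD (cabsB _ _) (lexx _)) (lexx _)) _; rewrite (cabsM 2) cabs_nat.
have Wu : W <= u.
  apply: le_trans (@zi_KL 2 7 isT isT); rewrite /W ler_piMr// mulr_ge0// exprn_ge0// ltW//.
have wx v : v <= W -> x ^+ 29 * v <= x ^+ 28.
  move=> vW; apply: le_trans (ler_wpM2l (exprn_ge0 29 (ltW x0)) (le_trans vW Wu)) _.
  by rewrite mulrC -[29%N]/(1 + 28)%N exprD expr1 mulrA ux mul1r.
have := wx _ d1; have := wx _ d2; have := wx _ d3.
have : 8 * x ^+ 28 <= x ^+ 15 by apply: zi_pow => //; lra.
move: m1 m2 m3 main; lra.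
Qed.

Lemma zi_second_le (t : R) : `|t| <= u ^+ 119 -> cabs (zi_second (Complex k t)) <= x ^+ 15.
Proof.
move=> tu; have ku : 3 * k <= x ^+ 11.
  have : 6 * x ^+ 12 <= x ^+ 11 by apply: zi_pow => //; lra.
  by rewrite /k; lra.
have c1 : Complex k t + kC = Complex (2 * k) t.
  by apply/eqP; rewrite eq_complex /= addr0 eqxx andbT; apply/eqP; ring.
have c2 : Complex k t + kC + kC = Complex (3 * k) t.
  by rewrite c1; apply/eqP; rewrite eq_complex /= addr0 eqxx andbT; apply/eqP; ring.
have kp := k0.
have abs_le (c : R) : 0 <= c -> c <= 3 * k -> cabs (Complex c t) <= 3 * k + `|t|.
  by move=> c0 ck; apply: le_trans (cabs_le _) _ => /=; rewrite ger0_norm// lerD2r.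
have abs_ge (c : R) : `|t| <= cabs (Complex c t) by have := cabs_Im (Complex c t).
have x811 : 2 * x ^+ 11 <= x ^+ 8 by apply: zi_pow => //; lra.
have u1 : 1 <= u ^+ 120 by rewrite exprn_ege1//; have := zi_u1000; lra.
have tu2 : `|t| <= u ^+ 120.
  by apply: le_trans tu _; rewrite ler_weXn2l//; have := zi_u1000; lra.
have x11 : x ^+ 11 <= 100^-1.
  have := @zi_pow 100 0 11 isT (ler0n _ 100) (lexx _); rewrite expr0; lra.
have x8 : x ^+ 8 <= 100^-1.
  have := @zi_pow 100 0 8 isT (ler0n _ 100) (lexx _); rewrite expr0; lra.
have [tx|tx] := leP `|t| (x ^+ 8).
  have key (c : R) : k <= c -> c <= 3 * k ->
     cabs (msum (Complex c t) N - Complex c t) <= 25 * x ^+ 16.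
    move=> kc ck; have c0 : 0 <= c by lra.
    have cb := abs_le c c0 ck.
    have cb2 : cabs (Complex c t) <= 2 * x ^+ 8 by lra.
    have cb3 : cabs (Complex c t) <= 12^-1 by lra.
    have [z0 zi] := @zi_small_lower (Complex c t) kc cb3.
    have h1 := @zi_small_inv (Complex c t) kc cb3.
    have h2 := @zi_msum (Complex c t) kc z0.
    have -> : msum (Complex c t) N - Complex c t = (msum (Complex c t) N - (zsum (Complex c t) N)^-1) +
      ((zsum (Complex c t) N)^-1 - Complex c t) by ring.
    apply: le_trans (cabsD _ _) _; apply: le_trans (lerD h2 h1) _.
    have h3 : cabs (Complex c t) ^+ 2 <= 4 * x ^+ 16.
      have -> : 4 * x ^+ 16 = (2 * x ^+ 8) ^+ 2 by rewrite exprMn -exprM; ring.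
      by rewrite lerXn2r ?nnegrE ?cabs_ge0 ?mulr_ge0 ?exprn_ge0 ?(ltW x0).
    have h4 : x ^+ 29 * (cabs (zsum (Complex c t) N))^-1 <= x ^+ 29 * 1.
      by rewrite ler_wpM2l ?exprn_ge0 ?(ltW x0)//; lra.
    have h5 : x ^+ 29 <= x ^+ 16 by rewrite ler_wiXn2l ?(ltW x0)// x1.
    lra.
  have K1 := key k (lexx _) (_ : k <= 3 * k); have K2 := key (2 * k) (_ : k <= 2 * k) (_ : 2 * k <= 3 * k).
  have K3 := key (3 * k) (_ : k <= 3 * k) (lexx _).
  have {}K1 := K1 ltac:(lra); have {}K2 := K2 ltac:(lra) ltac:(lra); have {}K3 := K3 ltac:(lra).
  rewrite /zi_second c2 c1.
  have -> : msum (Complex k t) N - 2 * msum (Complex (2 * k) t) N + msum (Complex (3 * k) t) N =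
    (msum (Complex k t) N - Complex k t) - 2 * (msum (Complex (2 * k) t) N - Complex (2 * k) t) +
    (msum (Complex (3 * k) t) N - Complex (3 * k) t).
    by rewrite -c2 -c1; ring.
  apply: le_trans (cabsD _ _) _; apply: le_trans (lerD (cabsB _ _) (lexx _)) _.
  rewrite (cabsM 2) cabs_nat.
  have : 100 * x ^+ 16 <= x ^+ 15 by apply: zi_pow => //; lra.
  lra.
have KL0 : 0 < K * L ^+ 7 by rewrite mulr_gt0// exprn_gt0.
have KL1 : 1 <= K * L ^+ 7 by rewrite -[leLHS]mulr1 ler_pM ?zi_K1// exprn_ege1// zi_L1.
have K2E : K ^+ 2 * L ^+ 7 = K * (K * L ^+ 7) by ring.
have [t1|t1] := leP `|t| 24^-1.
  apply: (@zi_second_main _ `|t|) => //; [exact: ltW|lra|].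
  move=> z; rewrite c2 c1 => zin.
  have [c [kc ck ->]] : exists c, [/\ k <= c, c <= 3 * k & z = Complex c t].
    by move: zin; rewrite !inE => /or3P[]/eqP ->; [exists k|exists (2 * k)|exists (3 * k)]; split => //; lra.
  have c0 : 0 <= c by lra.
  have cb := abs_le c c0 ck.
  have cb3 : cabs (Complex c t) <= 12^-1 by lra.
  have [z0 zi] := @zi_small_lower (Complex c t) kc cb3.
  split => //; first lra.
  apply: (@le_trans _ _ (4 * `|t|)); first lra.
  rewrite ler_wpM2r// K2E; apply: (@le_trans _ _ (K * 1)); first by rewrite mulr1; apply: le_trans zi_K_ge; lra.
  by rewrite ler_wpM2l ?(ltW K0).
apply: (@zi_second_main _ 24^-1) => //; [lra|lra|].
move=> z; rewrite c2 c1 => zin.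
have [c [kc ck ->]] : exists c, [/\ k <= c, c <= 3 * k & z = Complex c t].
  by move: zin; rewrite !inE => /or3P[]/eqP ->; [exists k|exists (2 * k)|exists (3 * k)]; split => //; lra.
have c0 : 0 <= c by lra.
have cb := abs_le c c0 ck.
have low := @zi_large_lower (Complex c t) kc ck (ltW t1) tu2.
have zp : 0 < cabs (zsum (Complex c t) N) by apply: lt_le_trans low; rewrite invr_gt0.
split.
- by apply: le_trans (abs_ge c); exact: ltW.
- lra.
- by rewrite -cabs_gt0.
- apply: (@le_trans _ _ (K * L ^+ 7)); first by rewrite -[leRHS]invrK lef_pV2 ?posrE ?invr_gt0.
  rewrite K2E; apply: (@le_trans _ _ (24 * (K * L ^+ 7) * 24^-1)); first lra.
  rewrite ler_wpM2r// ler_wpM2r ?(ltW KL0)//; apply: le_trans zi_K_ge; lra.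
Qed.

End ZetaInverse.

(** * Trigonometric approximation of a step function *)

Section FejerKernel.
Variable R : realType.
Implicit Types (x y t : R) (i j m n J Q : nat).

Lemma sin_lower t : 0 <= t <= pi / 2 -> t / 8 <= sin t.
Proof.
move=> /andP[t0 t1]; have ph := @pihalf_lt2 R.
have small (s : R) : 0 <= s -> s <= 2^-1 -> s / 2 <= sin s.
  move=> s0 s1; have := abs_sin_sub_le s; rewrite distrC => /(le_trans (ler_norm _)).
  have : s * s <= s / 2 by rewrite ler_wpM2l.
  by rewrite expr2; move: (s * s) => q; lra.
have [ts|ts] := leP t 2^-1; first by have := small _ t0 ts; lra.
apply: (@le_trans _ _ (sin 2^-1)).
  by have := small 2^-1 ltac:(lra) (lexx _); lra.
have h1 : (2^-1 : R) \in `[ (- (pi / 2)), (pi / 2)] by rewrite in_itv /=; have := @pihalf_ge1 R; lra.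
have h2 : t \in `[ (- (pi / 2)), (pi / 2)] by rewrite in_itv /=; have := @pihalf_ge1 R; lra.
by rewrite leNgt ltr_sin// -leNgt ltW.
Qed.

Lemma inv_sin_le t : 0 < t < pi -> 0 < sin t /\ (sin t)^-1 <= 8 / t + 8 / (pi - t).
Proof.
move=> /andP[t0 t1]; have s0 : 0 < sin t by rewrite sin_gt0_pi// t0.
split=> //; have [tp|tp] := leP t (pi / 2).
  have := @sin_lower t; rewrite ltW// => /(_ tp) h.
  apply: (@le_trans _ _ (8 / t)); last by rewrite lerDl divr_ge0// subr_ge0 ltW.
  by rewrite -[leRHS]invrK lef_pV2 ?posrE ?invr_gt0 ?divr_gt0// invf_div.
have h : (pi - t) / 8 <= sin t.
  have -> : sin t = sin (pi - t) by rewrite sinB cospi sinpi mul0r sub0r mulN1r opprK.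
  by apply: sin_lower; lra.
apply: (@le_trans _ _ (8 / (pi - t))); last by rewrite lerDr divr_ge0// ltW.
by rewrite -[leRHS]invrK lef_pV2 ?posrE ?invr_gt0 ?divr_gt0 ?subr_gt0// invf_div.
Qed.

Definition cis x : R[i] := Complex (cos x) (sin x).

Lemma cis0 : cis 0 = 1. Proof. by rewrite /cis cos0 sin0. Qed.
Lemma cisD x y : cis (x + y) = cis x * cis y.
Proof. by rewrite /cis cosD sinD; simpc; congr Complex; ring. Qed.
Lemma cabs_cis x : cabs (cis x) = 1.
Proof. by rewrite cabsE cos2Dsin2 sqrtr1. Qed.
Lemma cis_natM n x : cis (n%:R * x) = cis x ^+ n.
Proof.
elim: n => [|n IH]; first by rewrite mul0r cis0 expr0.
by rewrite -natr1 mulrDl mul1r cisD IH exprSr.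
Qed.
Lemma cabs_1Bcis x : cabs (1 - cis x) = 2 * `|sin (x / 2)|.
Proof.
apply/eqP; rewrite -(@eqrXn2 _ 2)// ?cabs_ge0 ?mulr_ge0// cabs_sqr /= exprMn sqr_norm sub0r sqrrN.
apply/eqP; have := cos2Dsin2 x; rewrite (cos_half x).
move: (sin x ^+ 2) (sin (x / 2)) => a b h.
have -> : a = 1 - (1 - 2 * b ^+ 2) ^+ 2 by lra.
ring.
Qed.

Lemma cis_neq1 x : sin (x / 2) != 0 -> 1 - cis x != 0.
Proof. by move=> s; rewrite -cabs_gt0 cabs_1Bcis mulr_gt0// normr_gt0. Qed.

Lemma cabs_sum_cis x n : sin (x / 2) != 0 ->
  cabs (\sum_(0 <= j < n) cis (j%:R * x)) <= `|sin (x / 2)|^-1.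
Proof.
move=> s; under eq_bigr do rewrite cis_natM.
have z1 := cis_neq1 s.
have -> : \sum_(0 <= j < n) cis x ^+ j = (1 - cis x ^+ n) / (1 - cis x).
  apply: (mulIf z1); rewrite divfK// big_mkord.
  by rewrite -[RHS]opprB subrX1 -mulNr opprB mulrC.
rewrite cabsM cabsV cabs_1Bcis invfM mulrA ler_piMl ?invr_ge0//.
rewrite ler_pdivrMr// mul1r; apply: le_trans (cabsB _ _) _.
by rewrite cabs1 cabsX cabs_cis expr1n.
Qed.

Definition fejer J x : R := cabs (\sum_(0 <= j < J) cis (j%:R * x)) ^+ 2 / J%:R.

Lemma fejer_ge0 J x : 0 <= fejer J x.
Proof. by rewrite divr_ge0// exprn_ge0// cabs_ge0. Qed.

Lemma fejerE J x : ((fejer J x)%:C)%C =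
  (\sum_(0 <= i < J) \sum_(0 <= j < J) cis ((i%:R - j%:R) * x)) / J%:R.
Proof.
rewrite /fejer rmorphM /= complex_nat_inv rmorphXn /= cabs_norm sqr_normc; congr (_ / _).
rewrite mulr_suml; apply: eq_bigr => i _.
rewrite raddf_sum mulr_sumr; apply: eq_bigr => j _ /=.
transitivity (cis (i%:R * x) * cis (- (j%:R * x))); first by rewrite /cis cosN sinN.
by rewrite -cisD; congr cis; ring.
Qed.

Lemma fejer_le J x : sin (x / 2) != 0 -> fejer J x <= (J%:R * sin (x / 2) ^+ 2)^-1.
Proof.
move=> s; rewrite /fejer invfM mulrC ler_wpM2l ?invr_ge0//.
rewrite -(sqr_norm (sin _)) -exprVn lerXn2r ?nnegrE ?cabs_ge0 ?invr_ge0//; exact: cabs_sum_cis.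
Qed.

Definition grid J n : R := 2 * pi * n%:R / J%:R.

(* Averaging Fejer kernels centred at the grid points of [[0, pi)] gives a
   nonnegative trigonometric polynomial close to the indicator of [[0, pi)]. *)
Definition bump Q x : R := (\sum_(0 <= k < Q) fejer (4 * Q) (x - grid (4 * Q) k)) / (4 * Q)%:R.

Lemma sin_grid J i j : (i < J)%N -> (j < J)%N -> i != j ->
  let m := (maxn i j - minn i j)%N in
  0 < `|sin ((i%:R - j%:R) * (2 * pi / J%:R) / 2) : R| /\
  `|sin ((i%:R - j%:R) * (2 * pi / J%:R) / 2) : R|^-1 <= 4 * J%:R * (m%:R^-1 + (J - m)%:R^-1).
Proof.
move=> iJ jJ ij m.
have m0 : (0 < m)%N by move: ij; rewrite /m; clear; lia.
have mJ : (m < J)%N by move: iJ jJ; rewrite /m; clear; lia.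
have J0 : (0 : R) < J%:R by rewrite ltr0n (leq_ltn_trans _ iJ).
have -> : `|sin ((i%:R - j%:R) * (2 * pi / J%:R) / 2)| = `|sin (m%:R * pi / J%:R)| :> R.
  have [h|h] := leqP j i.
    have -> : (i%:R - j%:R) = m%:R :> R by rewrite /m (maxn_idPl h) (minn_idPr h) natrB.
    by congr `|sin _|; field; rewrite gt_eqF.
  have h' := ltnW h.
  have -> : (i%:R - j%:R) = - m%:R :> R by rewrite /m (maxn_idPr h') (minn_idPl h') natrB// opprB.
  by rewrite -[RHS]normrN -sinN; congr `|sin _|; field; rewrite gt_eqF.
have pi0 := pi_gt0 R; have pi2 := pi_ge2 R.
have t0 : 0 < m%:R * pi / J%:R :> R by rewrite divr_gt0// mulr_gt0// ltr0n.
have tpi : m%:R * pi / J%:R < pi :> R.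
  by rewrite ltr_pdivrMr// mulrC ltr_pM2l// ltr_nat.
have [|s0 sle] := @inv_sin_le (m%:R * pi / J%:R); first by rewrite t0.
rewrite (gtr0_norm s0); split=> //; apply: le_trans sle _.
have -> : pi - m%:R * pi / J%:R = (J - m)%:R * pi / J%:R :> R.
  have -> : (J - m)%:R = J%:R - m%:R :> R by exact: natrB (ltnW mJ).
  by field; rewrite gt_eqF.
have key (a : nat) : (0 < a)%N -> 8 / (a%:R * pi / J%:R) <= 4 * J%:R * a%:R^-1 :> R.
  move=> a0; have a0' : (0 : R) < a%:R by rewrite ltr0n.
  have -> : 8 / (a%:R * pi / J%:R) = 4 * J%:R * a%:R^-1 * (2 / pi) :> R.
    by move: (a%:R) a0' (J%:R) J0 (pi) pi0 => b b0 c c0 p p0; field; rewrite (gt_eqF b0) (gt_eqF c0) (gt_eqF p0).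
  by rewrite ler_piMr ?mulr_ge0 ?invr_ge0 ?(ltW a0') ?(ltW J0)// ler_pdivrMr// mul1r.
by rewrite [leRHS]mulrDr lerD// key// subn_gt0.
Qed.

Lemma sum_dist_le J (h : nat -> R) : (forall m, 0 <= h m) ->
  \sum_(0 <= i < J) \sum_(0 <= j < J | i != j) h (maxn i j - minn i j)%N <=
  2 * J%:R * \sum_(1 <= m < J) h m.
Proof.
move=> h0; apply: (@le_trans _ _ (\sum_(0 <= i < J) (2 * \sum_(1 <= m < J) h m))); last first.
  by rewrite sumr_const_nat subn0 -[X in X <= _]mulr_natr mulrAC.
rewrite big_nat [leRHS]big_nat; apply: ler_sum => i /andP[_ iJ].
rewrite (@big_cat_nat _ _ _ i)//=; last exact: ltnW.
rewrite mulr_natl mulr2n; apply: lerD.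
  have -> : \sum_(0 <= j < i | i != j) h (maxn i j - minn i j)%N = \sum_(1 <= m < i.+1) h m.
    rewrite big_nat_rev big_add1 /= big_mkcond; apply: eq_big_nat => j /andP[_ ji].
    rewrite add0n ifT; last by move: ji; clear; lia.
    by congr h; move: ji; clear; lia.
  exact: ler_sum_nat_subset.
have -> : \sum_(i <= j < J | i != j) h (maxn i j - minn i j)%N = \sum_(1 <= m < J - i) h m.
  have -> : \sum_(i <= j < J | i != j) h (maxn i j - minn i j)%N =
     \sum_(0 + i <= j < J | i != j) h (maxn i j - minn i j)%N by rewrite add0n.
  rewrite big_addn big_ltn_cond ?subn_gt0// add0n eqxx /=.
  rewrite big_mkcond; apply: eq_big_nat => j /andP[j1 jJ].
  rewrite ifT; last by move: j1; clear; lia.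
  by congr h; move: j1; clear; lia.
exact: ler_sum_nat_subset (leq_subr _ _) h0.
Qed.

Lemma sum_rev_inv J : \sum_(1 <= m < J) (J - m)%:R^-1 = \sum_(1 <= m < J) m%:R^-1 :> R.
Proof.
rewrite big_nat_rev; apply: eq_big_nat => m /andP[m1 mJ].
by congr (_%:R^-1); move: m1 mJ; clear; lia.
Qed.

Lemma bump_sum_le Q (N : nat) (c : nat -> R[i]) (th : nat -> R) (B : R) : (0 < Q)%N ->
  (forall i j, (i < 4 * Q)%N -> (j < 4 * Q)%N ->
     cabs (\sum_(1 <= n < N) c n * cis ((i%:R - j%:R) * th n)) <= B) ->
  cabs (\sum_(1 <= n < N) c n * (bump Q (th n))%:C%C) <= B * (17 + 16 * ln (4 * Q)%:R).
Proof.
move=> Q0 H; set J := (4 * Q)%N in H *.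
have J0 : (0 < J)%N by rewrite muln_gt0.
have J0' : (0 : R) < J%:R by rewrite ltr0n.
have B0 : 0 <= B by apply: le_trans (cabs_ge0 _) (H _ _ J0 J0).
pose G i j := \sum_(0 <= k < Q) cis (k%:R * - ((i%:R - j%:R) * (2 * pi / J%:R))).
have bE x : (bump Q x)%:C%C = (\sum_(0 <= i < J) \sum_(0 <= j < J) G i j * cis ((i%:R - j%:R) * x)) / J%:R ^+ 2.
  rewrite /bump -/J rmorphM /= complex_nat_inv rmorph_sum /= expr2 invfM mulrA; congr (_ / _).
  under eq_bigr do rewrite fejerE.
  rewrite -mulr_suml; congr (_ / _).
  rewrite exchange_big_nat /=; apply: eq_bigr => i _.
  rewrite exchange_big_nat /=; apply: eq_bigr => j _.
  rewrite /G mulr_suml; apply: eq_bigr => k _; rewrite -cisD; congr cis.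
  by rewrite /grid; field; rewrite gt_eqF.
have -> : \sum_(1 <= n < N) c n * (bump Q (th n))%:C%C =
  (\sum_(0 <= i < J) \sum_(0 <= j < J) G i j * \sum_(1 <= n < N) c n * cis ((i%:R - j%:R) * th n)) / J%:R ^+ 2.
  under eq_bigr do rewrite bE mulrA.
  rewrite -mulr_suml; congr (_ / _).
  under eq_bigr do rewrite mulr_sumr.
  rewrite exchange_big_nat /=; apply: eq_bigr => i _.
  under eq_bigr do rewrite mulr_sumr.
  rewrite exchange_big_nat /=; apply: eq_bigr => j _.
  by rewrite mulr_sumr; apply: eq_bigr => n _; ring.
rewrite cabsM cabsV cabsX cabs_nat ler_pdivrMr ?exprn_gt0//.
apply: le_trans (cabs_sum _ _ _) _.
pose h m : R := 4 * J%:R * (m%:R^-1 + (J - m)%:R^-1).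
have h0 m : 0 <= h m by rewrite mulr_ge0 ?mulr_ge0 ?(ltW J0')// addr_ge0 ?invr_ge0.
have Gle i j : (i < J)%N -> (j < J)%N -> cabs (G i j) <= (if i != j then h (maxn i j - minn i j)%N else J%:R).
  move=> iJ jJ; case: eqVneq => [->|ij] /=.
    apply: le_trans (cabs_sum _ _ _) _; under eq_bigr do rewrite cabs_cis.
    rewrite sumr_const_nat subn0 ler_nat /J; by rewrite leq_pmull.
  have [s0 sle] := sin_grid iJ jJ ij.
  have es y : `|sin (- y / 2)| = `|sin (y / 2)| :> R by rewrite mulNr sinN normrN.
  apply: le_trans sle; rewrite -es in s0 *.
  by apply: cabs_sum_cis; move: s0; rewrite normr_gt0.
apply: (@le_trans _ _ (B * (\sum_(0 <= i < J) (\sum_(0 <= j < J | i != j) h (maxn i j - minn i j)%N + J%:R)))).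
  rewrite mulr_sumr big_nat [leRHS]big_nat; apply: ler_sum => i /andP[_ iJ].
  apply: le_trans (cabs_sum _ _ _) _.
  apply: (@le_trans _ _ (\sum_(0 <= j < J) B * (if i != j then h (maxn i j - minn i j)%N else J%:R))).
    rewrite big_nat [leRHS]big_nat; apply: ler_sum => j /andP[_ jJ].
    by rewrite cabsM mulrC ler_pM ?cabs_ge0 ?H ?Gle.
  rewrite -mulr_sumr ler_wpM2l// (bigID (fun j => i != j)) /=; apply: lerD.
    by rewrite le_eqVlt; apply/orP; left; apply/eqP; apply: eq_bigr => j ->.
  have -> : \sum_(0 <= j < J | ~~ (i != j)) (if i != j then h (maxn i j - minn i j)%N else J%:R) =
            \sum_(0 <= j < J | j == i) (J%:R : R).
    by apply: eq_big => [j|j]; rewrite negbK eq_sym// => /eqP ->; rewrite eqxx.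
  by rewrite big_nat1_eq /= iJ.
rewrite -mulrA ler_wpM2l// big_split /= sumr_const_nat subn0 -[X in _ + X <= _]mulr_natr.
apply: le_trans (lerD (sum_dist_le J h0) (lexx _)) _.
have hs : \sum_(1 <= m < J) h m <= 8 * J%:R * (1 + ln J%:R).
  rewrite -mulr_sumr big_split /= sum_rev_inv.
  have -> : 8 * J%:R * (1 + ln J%:R) = 4 * J%:R * ((1 + ln J%:R) + (1 + ln J%:R)) :> R by ring.
  by rewrite ler_wpM2l ?mulr_ge0// lerD// sum_inv_lt_le.
have := ler_wpM2l (mulr_ge0 (ler0n R 2) (ltW J0')) hs.
move=> h1; apply: le_trans (lerD h1 (lexx _)) _.
by rewrite le_eqVlt; apply/orP; left; apply/eqP; ring.
Qed.

End FejerKernel.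

Section BumpApprox.
Variable R : realType.
Implicit Types (x y t : R) (i j m n J Q : nat).

Lemma cis2pi n : cis (2 * pi * n%:R : R) = 1.
Proof.
rewrite mulrC cis_natM; have -> : cis (2 * pi) = 1 :> R[i].
  by rewrite mulr_natl /cis cos2pi sin2pi.
by rewrite expr1n.
Qed.

Lemma sum_cis_roots J i j : (i < J)%N -> (j < J)%N ->
  \sum_(0 <= k < J) cis (k%:R * - ((i%:R - j%:R) * (2 * pi / J%:R)) : R) = (if i == j then J%:R else 0).
Proof.
move=> iJ jJ; have J0 : (0 : R) < J%:R by rewrite ltr0n (leq_ltn_trans _ iJ).
case: eqVneq => [->|ij].
  under eq_bigr do rewrite subrr mul0r oppr0 mulr0 cis0.
  by rewrite sumr_const_nat subn0.
set y := - _; have [s0 _] := sin_grid R iJ jJ ij.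
have s1 : sin (y / 2) != 0 by rewrite /y mulNr sinN oppr_eq0 -normr_gt0.
have z1 := cis_neq1 s1.
under eq_bigr do rewrite cis_natM.
apply: (mulIf z1); rewrite mul0r big_mkord.
have e : (\sum_(k < J) cis y ^+ k) * (1 - cis y) = 1 - cis y ^+ J.
  by rewrite -[RHS]opprB subrX1 -mulNr opprB mulrC.
rewrite e -cis_natM.
have -> : J%:R * y = 2 * pi * j%:R - 2 * pi * i%:R by rewrite /y; field; rewrite gt_eqF.
have -> : cis (2 * pi * j%:R - 2 * pi * i%:R : R) = 1.
  have h := cis2pi i; rewrite cisD cis2pi mul1r -[RHS](cis0 R) -[in RHS](subrr (2 * pi * i%:R)).
  by rewrite cisD h mul1r.
by rewrite subrr.
Qed.

Lemma fejer_partition J x : (0 < J)%N -> \sum_(0 <= k < J) fejer J (x - grid R J k) = J%:R.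
Proof.
move=> J0; have J0' : (0 : R) < J%:R by rewrite ltr0n.
apply: (@complexI R); rewrite rmorph_sum rmorph_nat /=.
under eq_bigr do rewrite fejerE.
rewrite -mulr_suml exchange_big_nat /=.
have -> : \sum_(0 <= i < J) \sum_(0 <= k < J) \sum_(0 <= j < J) cis ((i%:R - j%:R) * (x - grid R J k)) =
  \sum_(0 <= i < J) (J%:R : R[i]).
  apply: eq_big_nat => i /andP[_ iJ].
  rewrite exchange_big_nat /=.
  have -> : \sum_(0 <= j < J) \sum_(0 <= k < J) cis ((i%:R - j%:R) * (x - grid R J k)) =
    \sum_(0 <= j < J) cis ((i%:R - j%:R) * x) * (if i == j then J%:R else 0).
    apply: eq_big_nat => j /andP[_ jJ]; rewrite -sum_cis_roots// mulr_sumr.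
    apply: eq_bigr => k _; rewrite -cisD; congr cis.
    by rewrite /grid; field; rewrite gt_eqF.
  rewrite (bigD1_seq i) ?mem_index_iota ?iota_uniq//= eqxx subrr mul0r cis0 mul1r.
  by rewrite big1 ?addr0// => j ji; rewrite eq_sym (negbTE ji) mulr0.
rewrite sumr_const_nat subn0 -[LHS]/((J%:R *+ J) / J%:R) -mulr_natr mulfK//.
by rewrite pnatr_eq0 -lt0n.
Qed.

Lemma bump_ge0 Q x : 0 <= bump Q x.
Proof. by rewrite divr_ge0// sumr_ge0// => k _; exact: fejer_ge0. Qed.

Lemma bump_compl Q x : (0 < Q)%N ->
  1 - bump Q x = (\sum_(Q <= k < 4 * Q) fejer (4 * Q) (x - grid R (4 * Q) k)) / (4 * Q)%:R.
Proof.
move=> Q0; have J0 : (0 < 4 * Q)%N by rewrite muln_gt0.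
have J1 : (4 * Q)%:R != 0 :> R by rewrite pnatr_eq0 -lt0n.
rewrite /bump -[X in X - _](divff J1) -mulrBl; congr (_ / _).
rewrite -(fejer_partition x J0) (@big_cat_nat _ _ _ Q)//= ?leq_pmull//.
by rewrite addrAC subrr add0r.
Qed.

Lemma bump_le1 Q x : (0 < Q)%N -> bump Q x <= 1.
Proof.
by move=> Q0; rewrite -subr_ge0 bump_compl// divr_ge0// sumr_ge0// => k _; exact: fejer_ge0.
Qed.

Lemma fejer_far J x y : (0 < J)%N -> 0 < x -> x / 16 <= `|sin (y / 2)| ->
  fejer J y <= 256 / (J%:R * x ^+ 2).
Proof.
move=> J0 x0 h; have J0' : (0 : R) < J%:R by rewrite ltr0n.
have s0 : 0 < `|sin (y / 2)| by apply: lt_le_trans h; rewrite divr_gt0.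
apply: le_trans (fejer_le _ _) _; first by rewrite -normr_gt0.
have -> : 256 / (J%:R * x ^+ 2) = (J%:R * (x / 16) ^+ 2)^-1 by field; rewrite !gt_eqF.
have S : 0 < sin (y / 2) ^+ 2 by rewrite -sqr_norm exprn_gt0.
have h2 : (x / 16) ^+ 2 <= sin (y / 2) ^+ 2.
  by rewrite -(sqr_norm (sin _)) lerXn2r ?nnegrE// divr_ge0// ltW.
by rewrite lef_pV2 ?posrE ?(mulr_gt0 J0')// ?exprn_gt0 ?divr_gt0// ler_pM2l.
Qed.

Lemma bump_neg Q x : (0 < Q)%N -> 0 < x <= pi / 4 ->
  bump Q (- x) <= 64 / ((4 * Q)%:R * x ^+ 2).
Proof.
move=> Q0 /andP[x0 xpi]; have J0 : (0 < 4 * Q)%N by rewrite muln_gt0.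
have J0' : (0 : R) < (4 * Q)%:R by rewrite ltr0n.
have pi0 := pi_gt0 R.
rewrite /bump ler_pdivrMr//.
apply: (@le_trans _ _ (\sum_(0 <= k < Q) 256 / ((4 * Q)%:R * x ^+ 2))); last first.
  rewrite sumr_const_nat subn0 -[_ *+ Q]mulr_natr natrM.
  by rewrite le_eqVlt; apply/orP; left; apply/eqP; field; rewrite pnatr_eq0 -lt0n Q0 gt_eqF.
rewrite big_nat [leRHS]big_nat; apply: ler_sum => k /andP[_ kQ].
apply: fejer_far => //.
have g0 : 0 <= grid R (4 * Q) k by rewrite /grid divr_ge0 ?mulr_ge0 ?(ltW pi0).
have g1 : grid R (4 * Q) k <= pi / 2.
  rewrite /grid ler_pdivrMr// natrM.
  have -> : pi / 2 * (4 * Q%:R) = 2 * pi * Q%:R :> R by field.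
  by rewrite ler_pM2l ?mulr_gt0// ler_nat ltnW.
have -> : `|sin ((- x - grid R (4 * Q) k) / 2)| = `|sin ((x + grid R (4 * Q) k) / 2)|.
  by rewrite -[RHS]normrN -sinN; congr `|sin _|; field.
apply: le_trans (ler_norm _); apply: le_trans (sin_lower _); lra.
Qed.

Lemma bump_pos Q x : (0 < Q)%N -> 0 < x <= pi / 4 ->
  1 - bump Q x <= 192 / ((4 * Q)%:R * x ^+ 2).
Proof.
move=> Q0 /andP[x0 xpi]; have J0 : (0 < 4 * Q)%N by rewrite muln_gt0.
have J0' : (0 : R) < (4 * Q)%:R by rewrite ltr0n.
have pi0 := pi_gt0 R.
rewrite bump_compl// ler_pdivrMr//.
apply: (@le_trans _ _ (\sum_(Q <= k < 4 * Q) 256 / ((4 * Q)%:R * x ^+ 2))); last first.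
  rewrite sumr_const_nat (_ : (4 * Q - Q = 3 * Q)%N); last by lia.
  rewrite -[_ *+ (3 * Q)]mulr_natr !natrM.
  by rewrite le_eqVlt; apply/orP; left; apply/eqP; field; rewrite pnatr_eq0 -lt0n Q0 gt_eqF.
rewrite big_nat [leRHS]big_nat; apply: ler_sum => k /andP[kQ kJ].
apply: fejer_far => //.
have g0 : pi / 2 <= grid R (4 * Q) k.
  rewrite /grid ler_pdivlMr// natrM.
  have -> : pi / 2 * (4 * Q%:R) = 2 * pi * Q%:R :> R by field.
  by rewrite ler_pM2l ?mulr_gt0// ler_nat.
have g1 : grid R (4 * Q) k <= 2 * pi.
  by rewrite /grid ler_pdivrMr// ler_pM2l ?mulr_gt0// ler_nat ltnW.
have -> : `|sin ((x - grid R (4 * Q) k) / 2)| = `|sin ((grid R (4 * Q) k - x) / 2)|.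
  by rewrite -[RHS]normrN -sinN; congr `|sin _|; field.
apply: le_trans (ler_norm _).
have [h|h] := leP ((grid R (4 * Q) k - x) / 2) (pi / 2).
  apply: le_trans (sin_lower _); lra.
have -> : sin ((grid R (4 * Q) k - x) / 2) = sin (pi - (grid R (4 * Q) k - x) / 2).
  by rewrite [RHS]sinB cospi sinpi mul0r sub0r mulN1r opprK.
apply: le_trans (sin_lower _); lra.
Qed.

Lemma bump_step Q x : (0 < Q)%N -> x != 0 -> `|x| <= pi / 4 ->
  `|(0 <= x)%R%:R - bump Q x| <= 192 / ((4 * Q)%:R * x ^+ 2).
Proof.
move=> Q0 xn0 xpi; have J0' : (0 : R) < (4 * Q)%:R by rewrite ltr0n muln_gt0.
have [x0|x0] := leP 0 x.
  have x0' : 0 < x by rewrite lt_neqAle eq_sym xn0.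
  rewrite ger0_norm ?subr_ge0 ?bump_le1//; apply: bump_pos => //.
  by rewrite x0' -(gtr0_norm x0').
rewrite sub0r normrN ger0_norm ?bump_ge0//.
have := @bump_neg Q (- x) Q0; rewrite opprK oppr_gt0 x0 -(ltr0_norm x0) xpi sqr_norm => /(_ isT)/le_trans; apply.
rewrite ler_pM2r ?ler_nat// invr_gt0 mulr_gt0//.
by rewrite lt_neqAle sqr_ge0 andbT eq_sym expf_neq0.
Qed.

End BumpApprox.

(** * Partial sums of mu(n)/n *)

Section MoebiusWindow.
Variable R : realType.
Implicit Types (u w t : R) (n m N X Q : nat).

Lemma ln_pow_le (A : R) n : 0 <= A -> exists2 u0 : R, 1 <= u0 & forall u, u0 <= u -> A * (1 + ln u) ^+ n <= u.
Proof.
move=> A0; have n0 : (0 : R) < n.+1%:R by rewrite ltr0n.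
exists (expR (A * n.+1%:R ^+ n.+1)).
  by rewrite -[leLHS]expR0 ler_expR mulr_ge0// exprn_ge0.
move=> u hu; have u0 : 0 < u by apply: lt_le_trans hu; exact: expR_gt0.
have v1 : A * n.+1%:R ^+ n.+1 <= ln u by rewrite -[leLHS]expRK ler_ln// posrE expR_gt0.
have v0 : 0 <= ln u by apply: le_trans v1; rewrite mulr_ge0// exprn_ge0// ltW.
have h : ((1 + ln u) / n.+1%:R) ^+ n.+1 <= u.
  rewrite -[leRHS](lnK u0).
  have -> : ln u = n.+1%:R * (ln u / n.+1%:R) by field; rewrite gt_eqF.
  rewrite expRM_natl lerXn2r ?nnegrE ?expR_ge0// ?divr_ge0 ?addr_ge0 ?mulr_ge0 ?invr_ge0 ?(ltW n0)//.
  have -> : n.+1%:R * (ln u / n.+1%:R) = ln u by field; rewrite gt_eqF.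
  apply: le_trans (expR_ge1Dx _).
  by rewrite mulrDl lerD2r mul1r invf_le1// ler1n.
apply: le_trans h; rewrite expr_div_n ler_pdivlMr ?exprn_gt0// mulrAC [leRHS]exprS.
by rewrite ler_wpM2r ?exprn_ge0 ?addr_ge0//; move: v1; lra.
Qed.

Lemma truncn_bounds (a : R) : 1 <= a -> a <= (Num.truncn a).+1%:R <= 2 * a.
Proof.
move=> a1; have a0 : 0 <= a by lra.
have /andP[h1 h2] := truncn_itv a0; rewrite (ltW h2)/= -natr1; lra.
Qed.

Definition moeb n : R := (moebius n)%:~R.
(* [n^(-k) (1 - n^(-k))^2]: inserting it in the sum of [mu(n)/n * n^(-s)] amounts to
   taking a second difference of step [k]. *)
Definition wgt (k : R) n : R := rnp k n * (1 - rnp k n) ^+ 2.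

Lemma wgt_ge0 (k : R) n : 0 <= wgt k n.
Proof. by rewrite mulr_ge0 ?(ltW (rnp_gt0 _ _))// sqr_ge0. Qed.

Lemma wgt_le1 (k : R) n : 0 <= k -> wgt k n <= 1.
Proof.
move=> k0; have h := rnp_gt0 k n; have h1 := rnp_le1 n k0.
by rewrite -[leRHS]mulr1 ler_pM// ?(ltW h) ?sqr_ge0// exprn_ile1// ?subr_ge0 ?gerBl// ltW.
Qed.

Lemma moeb_le1 n : `|moeb n| <= 1.
Proof. by have := @cabs_moebius R n; rewrite -[_%:~R](rmorph_int (real_complex R)) cabsR. Qed.

Lemma zi_second_params : exists2 u0 : R, 100 <= u0 & forall u, u0 <= u ->
  exists N : nat, [/\ expR (u ^+ 36) <= N%:R, N%:R <= 2 * expR (u ^+ 36) &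
    forall t, `|t| <= u ^+ 119 ->
    cabs (zi_second u N (Complex (2 * u^-1 ^+ 12) t)) <= u^-1 ^+ 15].
Proof.
have [c [c0 cE]] : exists c : R, 0 <= c /\ (10 ^+ 4) ^+ 8 * (27 * 15) ^+ 2 * expR 16 = c.
  by eexists; split; last reflexivity; rewrite mulr_ge0 ?expR_ge0 ?mulr_ge0 ?exprn_ge0.
set K : R := 100 + c.
have K0 : 0 <= K by rewrite addr_ge0.
have [u0 u01 Hu] := @ln_pow_le (K ^+ 9 * 152 ^+ 25) 25 (mulr_ge0 (exprn_ge0 _ K0) (exprn_ge0 _ (ler0n _ _))).
exists (100 + u0) => [|u uu]; first by lra.
have u1 : 1 <= u by lra.
have up n : 1 <= u ^+ n by rewrite exprn_ege1.
have e1 : 1 <= expR (u ^+ 36) by rewrite -[leLHS]expR0 ler_expR (le_trans _ (up _)).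
have /andP[M1 M2] := truncn_bounds (up 150%N).
have /andP[N1 N2] := truncn_bounds e1.
exists (Num.truncn (expR (u ^+ 36))).+1; split=> // t tu.
apply: (@zi_second_le R K u (Num.truncn (u ^+ 150)).+1) => //; split=> //.
- rewrite -(ler_nat R); apply: le_trans M2 (le_trans _ N1).
  have u36 : 0 <= u ^+ 36 by rewrite (le_trans _ (up _)).
  apply: (@le_trans _ _ (1 + (u ^+ 36) ^+ 5 / 5`!%:R)); last exact: expR_ge1Dxn.
  have -> : (5`!)%:R = 120 :> R by [].
  have -> : (u ^+ 36) ^+ 5 = u * u * u ^+ 28 * u ^+ 150 by rewrite -exprM -[u * u]/(u ^+ 2) -!exprD.
  have u100 : 100 <= u by lra.
  have h : 100 * 100 * 1 <= u * u * u ^+ 28 by rewrite ler_pM// ler_pM.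
  have := ler_wpM2r (le_trans ler01 (up 150%N)) h; have := up 150%N; lra.
- by rewrite /K; lra.
split.
  rewrite cE /K; have : 0 <= c * c by rewrite mulr_ge0.
  by rewrite expr2; lra.
apply: le_trans (Hu u _); last lra.
rewrite -mulrA -exprMn ler_wpM2l ?exprn_ge0// lerXn2r ?nnegrE.
  + by [].
  + by rewrite addr_ge0 ?ln_nat_ge0.
  + by apply: mulr_ge0 => //; apply: addr_ge0 => //; exact: ln_ge0.
  have : ln (Num.truncn (u ^+ 150)).+1%:R <= ln (2 * u ^+ 150).
    by rewrite ler_ln ?posrE ?ltr0n// mulr_gt0// exprn_gt0//; lra.
  rewrite lnM ?posrE ?exprn_gt0 ?lnXn; try lra.
  have : ln 2 <= 1 :> R by rewrite -[leRHS]expRK ler_ln ?posrE ?expR_gt0//; have := @expR_ge1Dx R 1; lra.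
  have := ln_ge0 u1; rewrite -mulr_natl; move: (ln u) (ln _) (ln _) => a b d; lra.
Qed.

Lemma zi_second_twist u N t (k := 2 * u^-1 ^+ 12) : zi_second u N (Complex k t) =
  \sum_(1 <= n < N) (moeb n / n%:R * wgt k n)%:C%C * cis (- t * ln n%:R).
Proof.
rewrite /zi_second /msum mulr_sumr -sumrB -big_split /=.
apply: eq_big_nat => n /andP[n0 _]; rewrite !npow_shift npow1_polar.
have -> : Complex (rnp (1 + k) n * cos (- t * ln n%:R)) (rnp (1 + k) n * sin (- t * ln n%:R)) =
  (n%:R^-1)%:C%C * (rnp k n)%:C%C * cis (- t * ln n%:R).
  by rewrite -rmorphM -rnp_nat// -rnpD /cis; simpc.
have -> : (moeb n / n%:R * wgt k n)%:C%C = (moebius n)%:~R * (n%:R^-1)%:C%C * ((rnp k n)%:C%C * (1 - (rnp k n)%:C%C) ^+ 2).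
  by rewrite /wgt !rmorphM -/(moeb n) rmorph_int rmorphB rmorph1.
rewrite -/k; move: (rnp k n)%:C%C (n%:R^-1)%:C%C (cis _) => a b c; ring.
Qed.

Lemma count_window N (P : pred nat) (a b : nat) :
  (forall n, P n -> (a <= n < b)%N) -> \sum_(1 <= n < N | P n) (1 : R) <= (b - a)%:R.
Proof.
move=> H; apply: (@le_trans _ _ (minn N b - a)%:R); last by rewrite ler_nat leq_sub2r// geq_minr.
elim: N => [|N IH]; first by rewrite big_geq.
case: N IH => [|N] IH; first by rewrite big_geq.
rewrite big_mkcond big_nat_recr//= -big_mkcond /=; case: ifP => PN.
  have /andP[h1 h2] := H _ PN; apply: le_trans (lerD IH (lexx _)) _.
  rewrite -[X in _ + X <= _]/(1%:R) -natrD ler_nat; move: h1 h2; clear; lia.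
by rewrite addr0; apply: le_trans IH _; rewrite ler_nat; clear; lia.
Qed.

Lemma sum_near_le X N (e : R) : (0 < X)%N -> 0 < e -> e <= 4^-1 ->
  \sum_(1 <= n < N | `|ln X%:R - ln n%:R| < e) n%:R^-1 <= 4 * e + 4 / X%:R.
Proof.
move=> X0 e0 e1; have X0' : (0 : R) < X%:R by rewrite ltr0n.
set a := X%:R * expR (- e); set b := X%:R * expR e.
have a0 : 0 < a by rewrite mulr_gt0 ?expR_gt0.
have b0 : 0 < b by rewrite mulr_gt0 ?expR_gt0.
have H n : (0 < n)%N -> `|ln X%:R - ln n%:R| < e -> a <= n%:R < b.
  move=> n0; have n0' : (0 : R) < n%:R by rewrite ltr0n.
  rewrite ltr_norml => /andP[h1 h2].
  rewrite -{1 2}(lnK n0') /a /b -(lnK X0') -!expRD ler_expR ltr_expR; apply/andP; split; lra.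
apply: (@le_trans _ _ (\sum_(1 <= n < N | (a <= n%:R) && (n%:R < b)) a^-1)).
  rewrite big_mkcond big_nat [leRHS]big_mkcond [leRHS]big_nat /=.
  apply: ler_sum => n /andP[n0 nN].
  case: ifP => [h|_]; last by case: ifP => // _; rewrite invr_ge0 ltW.
  have /andP[h1 h2] := H n n0 h; rewrite h1 h2 lef_pV2 ?posrE ?ltr0n//.
have -> : \sum_(1 <= n < N | (a <= n%:R) && (n%:R < b)) a^-1 = a^-1 * \sum_(1 <= n < N | (a <= n%:R) && (n%:R < b)) 1.
  by rewrite mulr_sumr; apply: eq_bigr => n _; rewrite mulr1.
have ab : a <= b by rewrite ler_pM2l// ler_expR; lra.
have C : \sum_(1 <= n < N | (a <= n%:R) && (n%:R < b)) (1 : R) <= b - a + 2.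
  have ta := truncnS_gt a; have tb := truncn_itv (ltW b0).
  have [tab|tab] := leqP (Num.truncn a) (Num.truncn b).+1; last first.
    have h : ((Num.truncn b).+2%:R : R) <= (Num.truncn a)%:R by rewrite ler_nat.
    have /andP[h1 h2] := truncn_itv (ltW a0); have /andP[h3 h4] := tb.
    move: h h4; rewrite -natr1; lra.
  apply: le_trans (@count_window N _ (Num.truncn a) (Num.truncn b).+1 _) _.
    move=> n /andP[h1 h2]; apply/andP; split.
      rewrite -(ler_nat R); apply: le_trans h1; by have /andP[] := truncn_itv (ltW a0).
    rewrite ltnS truncn_ge_nat ?(ltW b0)//; exact: ltW.
  rewrite natrB// -natr1; have /andP[h1 _] := tb; rewrite -natr1 in ta; lra.
apply: le_trans (ler_wpM2l _ C) _; first by rewrite invr_ge0 ltW.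
have ee : expR e * expR (- e) = 1 by rewrite -expRD subrr expR0.
have en : 1 - e <= expR (- e) by exact: expR_ge1Dx.
have e2 : expR e <= 2.
  have := ler_wpM2l (expR_ge0 e) en; rewrite ee; have := expR_ge0 e => h0 h1.
  have : expR e * (1 - 4^-1) <= expR e * (1 - e) by rewrite ler_wpM2l//; lra.
  lra.
have -> : a^-1 * (b - a + 2) = expR e ^+ 2 - 1 + 2 * expR e / X%:R.
  have -> : a^-1 = expR e / X%:R by rewrite /a invfM -expRN opprK mulrC.
  rewrite mulrDr mulrBr; congr (_ - _ + _); rewrite /a /b.
  - by field; rewrite gt_eqF.
  - by rewrite mulrA divfK ?gt_eqF.
  - by rewrite mulrAC [expR e * 2]mulrC.
apply: lerD; last by rewrite ler_pM2r ?invr_gt0//; lra.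
have -> : expR e ^+ 2 = expR (2 * e) by rewrite -expRM_natl.
have h1 := @expR_ge1Dx R (- (2 * e)).
have := ler_wpM2l (expR_ge0 (2 * e)) h1; rewrite expRN divff ?gt_eqF ?expR_gt0//.
set z := expR _ => hz.
have hz0 : 0 <= z by exact: expR_ge0.
have : z * ((1 + - (2 * e)) * (1 + 4 * e)) <= 1 + 4 * e.
  by rewrite mulrA; apply: le_trans (ler_wpM2r _ hz) _; lra.
have : 1 <= (1 + - (2 * e)) * (1 + 4 * e).
  have : 0 <= e * (4^-1 - e) by rewrite mulr_ge0; lra.
  have -> : (1 + - (2 * e)) * (1 + 4 * e) = 1 + 8 * (e * (4^-1 - e)) by field.
  lra.
move=> h3 h4; have := ler_wpM2l hz0 h3; lra.
Qed.

Lemma ler_div_pM (q a b c d : R) : 0 <= q -> 0 < a -> a <= b -> 0 < c -> c <= d ->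
  q / (b * d) <= q / (a * c).
Proof.
move=> q0 a0 ab c0 cd; rewrite ler_wpM2l// lef_pV2 ?posrE ?mulr_gt0 ?(lt_le_trans a0 ab) ?(lt_le_trans c0 cd)//.
by rewrite ler_pM// ltW.
Qed.

Lemma window_pre : exists2 u0 : R, 100 <= u0 & forall u X, u0 <= u ->
  u ^+ 12 <= ln X%:R -> ln X%:R <= 2 * u ^+ 12 ->
  `|\sum_(1 <= n < X.+1) moeb n / n%:R * wgt (2 * u^-1 ^+ 12) n| <= u^-1 ^+ 13.
Proof.
have [u1 u11 H1] := zi_second_params.
have [u2 u22 H2] := @ln_pow_le (50 * 50) 1 ltac:(by []).
exists (u1 + u2) => [|u X uu w1 w2]; first lra.
have hu1 : u1 <= u by lra.
have hu2 : u2 <= u by lra.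
have u100 : 100 <= u by lra.
have u0 : 0 < u by lra.
have up n : 1 <= u ^+ n by rewrite exprn_ege1//; lra.
have [N [N1 N2 Hz]] := H1 u hu1.
set x := u^-1 in Hz *; set k := 2 * x ^+ 12 in Hz *; set w := ln X%:R in w1 w2.
have x0 : 0 < x by rewrite invr_gt0.
have k0 : 0 <= k by rewrite mulr_ge0 ?exprn_ge0// ltW.
have ux : u * x = 1 by rewrite divff// gt_eqF.
have uxn n : u ^+ n * x ^+ n = 1 by rewrite -exprMn ux expr1n.
have uX m n : (m <= n)%N -> u ^+ m * x ^+ n = x ^+ (n - m).
  by move=> mn; rewrite -{1}(subnKC mn) exprD mulrA -exprMn ux expr1n mul1r.
have xs : x <= 100^-1 by rewrite lef_pV2 ?posrE.
have X0 : (0 < X)%N.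
  rewrite lt0n; apply/eqP => e; move: w1; rewrite /w e ln0//; have := up 12%N; lra.
have X0' : (0 : R) < X%:R by rewrite ltr0n.
have N0' : (0 : R) < N%:R by apply: lt_le_trans N1; exact: expR_gt0.
have up0 n : 0 <= u ^+ n by rewrite exprn_ge0// ltW.
have u24 : 2 * u ^+ 12 + 1 <= u ^+ 24.
  have : 100 * u ^+ 12 <= u ^+ 12 * u ^+ 12.
    rewrite ler_wpM2r ?up0//; apply: le_trans u100 _; by rewrite ler_eXnr//; lra.
  by rewrite -exprD; have := up 12%N; rewrite /= => a b; move: a b; clear; lra.
have u2436 : u ^+ 24 <= u ^+ 36 by rewrite ler_weXn2l//; lra.
have XN : (X.+1 <= N)%N.
  rewrite -(ltr_nat R) -(lnK X0'); apply: lt_le_trans N1; rewrite ltr_expR -/w; move: w2 u24 u2436; clear; lra.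
have lN : ln N%:R <= 1 + u ^+ 36.
  have : ln N%:R <= ln (2 * expR (u ^+ 36)) by rewrite ler_ln ?posrE ?mulr_gt0 ?expR_gt0.
  rewrite lnM ?posrE ?expR_gt0// expRK.
  have : ln 2 <= 1 :> R by rewrite -[leRHS]expRK ler_ln ?posrE ?expR_gt0//; have := @expR_ge1Dx R 1; clear; lra.
  clear; lra.
have /andP[Q1 Q2] := truncn_bounds (up 155%N).
set Q := (Num.truncn (u ^+ 155)).+1 in Q1 Q2.
have Q0 : (0 < Q)%N by []; clearbody Q.
pose th n : R := x ^+ 37 * (w - ln n%:R).
pose r n : R := moeb n / n%:R * wgt k n.
have rle n : `|r n| <= n%:R^-1.
  rewrite /r normrM [`|_ / _|]normrM (ger0_norm (wgt_ge0 k n)) [`|_^-1|]ger0_norm ?invr_ge0//.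
  rewrite -[leRHS]mulr1; apply: ler_pM (mulr_ge0 _ _) (wgt_ge0 _ _) _ (wgt_le1 n k0); rewrite ?invr_ge0//.
  by rewrite -[leRHS]mul1r ler_wpM2r// moeb_le1.
have main : `|\sum_(1 <= n < N) r n * bump Q (th n)| <= x ^+ 14.
  rewrite -cabsR rmorph_sum; under eq_bigr do rewrite rmorphM.
  apply: le_trans (@bump_sum_le R Q N (fun n => (r n)%:C%C) th (x ^+ 15) _ _) _ => //.
    move=> i j iQ jQ.
    have -> : \sum_(1 <= n < N) (r n)%:C%C * cis ((i%:R - j%:R) * th n) =
      cis ((i%:R - j%:R) * x ^+ 37 * w) * zi_second u N (Complex k ((i%:R - j%:R) * x ^+ 37)).
      rewrite /k /x zi_second_twist -/x -/k mulr_sumr; apply: eq_bigr => n _.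
      rewrite [RHS]mulrCA -cisD; congr (_ * cis _); rewrite /th; ring.
    rewrite cabsM cabs_cis mul1r; apply: Hz.
    rewrite normrM (ger0_norm (exprn_ge0 _ (ltW x0))).
    have ij : `|i%:R - j%:R| <= 8 * u ^+ 155 :> R.
      apply: (@le_trans _ _ (4 * Q)%:R); last by rewrite natrM; move: Q2; clear; lra.
      have [hi hj] : (i%:R <= (4 * Q)%:R :> R) /\ (j%:R <= (4 * Q)%:R :> R) by split; rewrite ler_nat; exact: ltnW.
      have : 0 <= i%:R :> R by []. 
      have : 0 <= j%:R :> R by [].
      by rewrite ler_norml => a b; apply/andP; split; move: hi hj a b; clear; lra.
    apply: le_trans (ler_wpM2r (exprn_ge0 _ (ltW x0)) ij) _.
    have -> : u ^+ 155 = u ^+ 118 * u ^+ 37 by rewrite -exprD.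
    rewrite -mulrA -[_ * u ^+ 37 * _]mulrA uxn mulr1 (exprS u 118).
    rewrite ler_wpM2r ?up0//; move: u100; clear; lra.
  have -> : x ^+ 14 = x ^+ 15 * u by rewrite (exprSr x 14) -(mulrA (x ^+ 14)) (mulrC x) ux mulr1.
  rewrite ler_wpM2l ?exprn_ge0 ?(ltW x0)//; apply: le_trans (H2 u hu2); rewrite expr1.
  have : ln (4 * Q)%:R <= ln (8 * u ^+ 155).
    have q0 : (0 : R) < (4 * Q)%:R by rewrite ltr0n muln_gt0.
    by rewrite ler_ln ?posrE ?mulr_gt0 ?exprn_gt0// natrM; move: Q2; clear; lra.
  rewrite lnM ?posrE ?exprn_gt0 ?lnXn//.
  have : ln 8 <= 7 :> R by have := @le_ln1Dx R 7; rewrite (_ : 1 + 7 = 8 :> R); [apply; clear; lra|clear; lra].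
  have := @ln_ge0 R u (up 1%N); rewrite -[_ *+ 155]mulr_natl; clear; lra.
have pt n : (1 <= n < N)%N -> `|(0 <= th n)%R%:R - bump Q (th n)| <= 48 * x ^+ 51 + (`|w - ln n%:R| < x ^+ 15)%R%:R.
  move=> /andP[n0 nN]; have xx : 0 <= 48 * x ^+ 51 by rewrite mulr_ge0// exprn_ge0// ltW.
  have [near|far] := ltP `|w - ln n%:R| (x ^+ 15).
    have := bump_ge0 Q (th n); have := @bump_le1 R Q (th n) Q0 => b1 b0.
    rewrite /= ler_norml; case: (0 <= th n) => /=; apply/andP; split; move: b0 b1 xx; clear; lra.
  rewrite addr0; have th52 : x ^+ 52 <= `|th n|.
    rewrite /th normrM (ger0_norm (exprn_ge0 _ (ltW x0))) (_ : 52 = 37 + 15)%N// exprD.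
    by rewrite ler_wpM2l// exprn_ge0// ltW.
  have thn0 : th n != 0 by rewrite -normr_gt0; apply: lt_le_trans th52; rewrite exprn_gt0.
  apply: le_trans (bump_step _ thn0 _) _ => //.
    rewrite /th normrM (ger0_norm (exprn_ge0 _ (ltW x0))).
    have ln0 := @ln_nat_ge0 R n; have lnN : ln n%:R <= 1 + u ^+ 36.
      by apply: le_trans (@ln_lt_le R n N _) lN; rewrite n0.
    have h : `|w - ln n%:R| <= 2 * u ^+ 36.
      have := up 36%N; have := up 12%N; rewrite ler_norml => a b; apply/andP.
      by split; move: ln0 lnN w1 w2 u24 u2436 a b; clear; lra.
    apply: le_trans (ler_wpM2l (exprn_ge0 _ (ltW x0)) h) _.
    rewrite mulrCA [x ^+ 37 * _]mulrC uX// expr1; have := pi_ge2 R; move: xs; clear; lra.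
  have -> : 48 * x ^+ 51 = 192 / (4 * u ^+ 155 * (x ^+ 52) ^+ 2).
    have e155 : u ^+ 155 = u ^+ 51 * (u ^+ 52 * u ^+ 52) by rewrite -!exprD.
    rewrite e155; have a0 : u ^+ 51 != 0 by rewrite gt_eqF// exprn_gt0.
    move: (u ^+ 51) (u ^+ 52) (x ^+ 51) (x ^+ 52) a0 (uxn 51%N) (uxn 52%N) => a b c f a0 ac bf.
    have -> : 4 * (a * (b * b)) * f ^+ 2 = 4 * a * (b * f) ^+ 2 by ring.
    have -> : c = a^-1 by apply: (mulfI a0); rewrite ac divff.
    by rewrite bf; field.
  apply: ler_div_pM => //; first by rewrite mulr_gt0// exprn_gt0.
  - by rewrite natrM ler_wpM2l.
  - by rewrite exprn_gt0// exprn_gt0.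
  by rewrite -(sqr_norm (th n)) lerXn2r ?nnegrE// exprn_ge0// ltW.
have -> : \sum_(1 <= n < X.+1) moeb n / n%:R * wgt k n =
  \sum_(1 <= n < N) r n * bump Q (th n) + \sum_(1 <= n < N) r n * ((0 <= th n)%R%:R - bump Q (th n)).
  rewrite -big_split /= (big_nat_widen _ _ _ _ _ XN) big_mkcond; apply: eq_big_nat => n /andP[n0 nN].
  rewrite -mulrDr addrC subrK /th pmulr_rge0 ?exprn_gt0// subr_ge0 /w ler_ln ?posrE ?ltr0n// ler_nat ltnS.
  by rewrite andTb; case: ifP => _; rewrite ?mulr1 ?mulr0.
apply: le_trans (ler_normD _ _) _.
have err : `|\sum_(1 <= n < N) r n * ((0 <= th n)%R%:R - bump Q (th n))| <=
  48 * x ^+ 51 * (2 + u ^+ 36) + (4 * x ^+ 15 + 4 / X%:R).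
  apply: le_trans (ler_norm_sum _ _ _) _.
  apply: (@le_trans _ _ (\sum_(1 <= n < N) (48 * x ^+ 51 * n%:R^-1 + (if `|w - ln n%:R| < x ^+ 15 then n%:R^-1 else 0)))).
    rewrite big_nat [leRHS]big_nat; apply: ler_sum => n nN; rewrite normrM.
    apply: le_trans (ler_pM (normr_ge0 _) (normr_ge0 _) (rle n) (pt n nN)) _.
    by rewrite mulrDr mulrC lerD2l; case: ifP => _; rewrite ?mulr1 ?mulr0.
  rewrite big_split /= -mulr_sumr -big_mkcond /=; apply: lerD.
    have sN : \sum_(1 <= n < N) n%:R^-1 <= 2 + u ^+ 36.
      apply: le_trans (sum_inv_lt_le _ _) _; last by move: lN; clear; lra.
      by rewrite -(ltr0n R).
    exact: ler_wpM2l (mulr_ge0 (ler0n _ 48) (exprn_ge0 51 (ltW x0))) _ _ sN.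
  apply: sum_near_le; rewrite ?exprn_gt0//.
  apply: (@le_trans _ _ x); last by move: xs; clear; lra.
  by rewrite -[leRHS]expr1 ler_wiXn2l ?(ltW x0)//; move: xs; clear; lra.
apply: le_trans (lerD main err) _.
have Xinv : 4 / X%:R <= 8 * x ^+ 15.
  have XX : u ^+ 24 / 2 <= X%:R.
    rewrite -(lnK X0') -/w; apply: (@le_trans _ _ (expR (u ^+ 12))); last by rewrite ler_expR.
    have h12 : 0 <= u ^+ 12 by apply: le_trans (up _).
    by have := @expR_ge1Dxn R (u ^+ 12) 1 h12; rewrite -exprM (_ : 2`!%:R = 2 :> R)//=; clear; lra.
  have -> : 8 * x ^+ 15 = 4 / (u ^+ 15 / 2) by rewrite /x exprVn; field; rewrite gt_eqF.
  rewrite ler_pM2l// lef_pV2 ?posrE ?divr_gt0 ?exprn_gt0//; apply: le_trans XX.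
  by rewrite ler_pM2r// ler_weXn2l//; move: u100; clear; lra.
have e51 : x ^+ 51 * u ^+ 36 = x ^+ 15 by rewrite mulrC uX.
have x5115 : x ^+ 51 <= x ^+ 15 by rewrite ler_wiXn2l ?(ltW x0)//; move: xs; clear; lra.
have x15 : x ^+ 15 = x * (x * x ^+ 13) by rewrite -!exprS.
have x14 : x ^+ 14 = x * x ^+ 13 by rewrite -!exprS.
have x13 : 0 <= x ^+ 13 by rewrite exprn_ge0// ltW.
have y14 : x ^+ 14 <= 100^-1 * x ^+ 13 by rewrite x14 ler_wpM2r.
have y15 : x ^+ 15 <= 100^-1 * (100^-1 * x ^+ 13).
  rewrite x15; apply: (ler_pM (ltW x0) (mulr_ge0 (ltW x0) x13) xs).
  exact: ler_wpM2r x13 _ _ xs.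
have E (a b : R) : 48 * a * (2 + b) = 96 * a + 48 * (a * b) by ring.
by rewrite E e51; move: y14 y15 x5115 Xinv x13; clear; lra.
Qed.

End MoebiusWindow.

Section MoebiusSum.
Variable R : realType.
Implicit Types (u t : R) (n m A X Y : nat).

Lemma abel_identity (r V : nat -> R) A d (S := fun m => \sum_(A <= n < m) r n) :
  \sum_(A <= n < (A + d).+1) r n * V n =
  S (A + d).+1 * V (A + d)%N - \sum_(A <= n < A + d) S n.+1 * (V n.+1 - V n).
Proof.
elim: d => [|d IH]; first by rewrite addn0 /S !big_nat1 [X in _ - X]big_geq// subr0.
rewrite addnS big_nat_recr ?leqW ?leq_addr//= IH.
rewrite [in RHS]big_nat_recr ?leq_addr//= -[(A + d).+1 in RHS]/((A + d).+1).
have -> : S (A + d).+2 = S (A + d).+1 + r (A + d).+1 by rewrite /S big_nat_recr ?leqW ?leq_addr.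
ring.
Qed.

Lemma abel_le (r V : nat -> R) (e : R) A X : (A <= X)%N ->
  (forall m, (A < m <= X.+1)%N -> `|\sum_(A <= n < m) r n| <= e) ->
  (forall n, (A <= n < X)%N -> V n <= V n.+1) -> 0 <= V A ->
  `|\sum_(A <= n < X.+1) r n * V n| <= 2 * e * V X.
Proof.
move=> AX; rewrite -(subnKC AX); move: (X - A)%N => d He HV V0.
have e0 : 0 <= e by apply: le_trans (normr_ge0 _) (He A.+1 _); rewrite ltnSn ltnS leq_addr.
have VT : \sum_(A <= n < A + d) (V n.+1 - V n) = V (A + d)%N - V A by rewrite telescope_sumr// leq_addr.
have VX : 0 <= V (A + d)%N.
  rewrite -[V _](subrK (V A)) addr_ge0// -VT big_nat sumr_ge0// => n h; rewrite subr_ge0; exact: HV.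
rewrite abel_identity; apply: le_trans (ler_normB _ _) _.
have h1 : `|(\sum_(A <= n < (A + d).+1) r n) * V (A + d)%N| <= e * V (A + d)%N.
  by rewrite normrM (ger0_norm VX) ler_wpM2r// He// ltnS leq_addr leqnn.
have h2 : `|\sum_(A <= n < A + d) (\sum_(A <= i < n.+1) r i) * (V n.+1 - V n)| <= e * (V (A + d)%N - V A).
  apply: le_trans (ler_norm_sum _ _ _) _; rewrite -VT mulr_sumr big_nat [leRHS]big_nat.
  apply: ler_sum => n /andP[n1 n2]; have h : 0 <= V n.+1 - V n by rewrite subr_ge0 HV// n1.
  by rewrite normrM (ger0_norm h) ler_wpM2r// He// ltnS n1 ltnS ltnW.
apply: le_trans (lerD h1 h2) _; rewrite mulrBr; have : 0 <= e * V A by rewrite mulr_ge0.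
lra.
Qed.

Definition mobs X : R := \sum_(1 <= n < X.+1) moeb R n / n%:R.

Lemma cubic_mono (p q : R) : 0 <= q -> q <= p -> p <= 3^-1 -> q * (1 - q) ^+ 2 <= p * (1 - p) ^+ 2.
Proof.
move=> q0 qp p3; rewrite -subr_ge0.
have -> : p * (1 - p) ^+ 2 - q * (1 - q) ^+ 2 = (p - q) * ((1 - p - q) ^+ 2 - p * q) by ring.
rewrite mulr_ge0 ?subr_ge0// expr2.
have : 3^-1 * 3^-1 <= (1 - p - q) * (1 - p - q) by rewrite ler_pM//; lra.
have : p * q <= 3^-1 * 3^-1 by rewrite ler_pM//; lra.
lra.
Qed.

Lemma mobs_window : exists2 u0 : R, 100 <= u0 & forall u A X, u0 <= u ->
  u ^+ 12 = ln A%:R -> (A <= X)%N -> ln X%:R <= 2 * u ^+ 12 ->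
  `|mobs X - mobs A| <= 16 * expR 4 * u^-1 ^+ 13.
Proof.
have [u0 u01 H] := window_pre R; exists u0 => // u A X uu uA AX uX.
have up : 1 <= u ^+ 12 by rewrite exprn_ege1//; lra.
have u0' : 0 < u by lra.
have A0 : (0 < A)%N.
  by rewrite lt0n; apply/eqP => e; move: up; rewrite uA e ln0//; lra.
have C0 : 0 <= 16 * expR 4 * u^-1 ^+ 13 by rewrite !mulr_ge0 ?expR_ge0 ?exprn_ge0 ?invr_ge0 ?(ltW u0').
move: AX; rewrite leq_eqVlt => /orP[/eqP ->|AX]; first by rewrite subrr normr0.
set k := 2 * u^-1 ^+ 12; have k0 : 0 <= k by rewrite mulr_ge0 ?exprn_ge0 ?invr_ge0 ?(ltW u0').
have k2 : k * u ^+ 12 = 2 by rewrite /k -mulrA -exprMn mulVf ?gt_eqF// expr1n mulr1.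
have e2 : expR (- 2) <= 3^-1 :> R.
  by rewrite expRN lef_pV2 ?posrE ?expR_gt0//; have := @expR_ge1Dx R 2; lra.
have lnm n : (A <= n <= X)%N -> u ^+ 12 <= ln (n%:R : R) <= 2 * u ^+ 12.
  move=> /andP[h1 h2]; have n0 : (0 < n)%N by apply: leq_trans h1.
  rewrite uA ler_ln ?posrE ?ltr0n// ler_nat h1/= -uA; apply: le_trans uX.
  by rewrite ler_ln ?posrE ?ltr0n ?ler_nat// (leq_trans n0).
have rho n : (A <= n <= X)%N -> expR (- 4) <= rnp k n <= 3^-1.
  move=> /lnm/andP[h1 h2]; rewrite /rnp mulNr.
  have a1 : 2 <= k * ln n%:R by rewrite -k2 ler_wpM2l.
  have a2 : k * ln n%:R <= 4.
    by have := ler_wpM2l k0 h2; rewrite mulrCA k2; lra.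
  rewrite ler_expR lerN2 a2 /=; apply: le_trans e2; rewrite ler_expR; lra.
have wlow n : (A <= n <= X)%N -> expR (- 4) / 4 <= wgt k n.
  move=> /rho/andP[h1 h2]; rewrite /wgt; have e4 := @expR_gt0 R (- 4).
  rewrite ler_pM ?(ltW e4)// expr2; have : 2^-1 * 2^-1 <= (1 - rnp k n) * (1 - rnp k n).
    by rewrite ler_pM//; lra.
  lra.
have wpos n : (A <= n <= X)%N -> 0 < wgt k n.
  by move/wlow; apply: lt_le_trans; rewrite divr_gt0 ?expR_gt0.
have -> : mobs X - mobs A = \sum_(A.+1 <= n < X.+1) (moeb R n / n%:R * wgt k n) * (wgt k n)^-1.
  rewrite /mobs (@big_cat_nat _ _ _ A.+1 1 X.+1)//=; last exact: ltnW.
  rewrite addrAC subrr add0r; apply: eq_big_nat => n /andP[h1 h2].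
  by apply: esym; rewrite mulfK// gt_eqF// wpos// (ltnW h1) -ltnS.
apply: le_trans (@abel_le _ (fun n => (wgt k n)^-1) (2 * u^-1 ^+ 13) A.+1 X AX _ _ _) _.
- move=> m /andP[h1 h2].
  have -> : \sum_(A.+1 <= n < m) moeb R n / n%:R * wgt k n =
    \sum_(1 <= n < m.-1.+1) moeb R n / n%:R * wgt k n - \sum_(1 <= n < A.+1) moeb R n / n%:R * wgt k n.
    rewrite (ltn_predK h1) (@big_cat_nat _ _ _ A.+1 1 m)//=; last exact: ltnW.
    by rewrite addrAC subrr add0r.
  have mm : (A <= m.-1 <= X)%N by move: h1 h2; clear; lia.
  have /andP[b1 b2] := lnm _ mm.
  have /andP[c1 c2] : u ^+ 12 <= ln A%:R <= 2 * u ^+ 12 by apply: lnm; rewrite leqnn ltnW.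
  apply: le_trans (ler_normB _ _) _.
  have := H u _ uu b1 b2; have := H u _ uu c1 c2; rewrite -/k; lra.
- move=> n /andP[h1 h2].
  have n1 : (A <= n <= X)%N by move: h1 h2; clear; lia.
  have n2 : (A <= n.+1 <= X)%N by move: h1 h2; clear; lia.
  rewrite lef_pV2 ?posrE ?wpos//; apply: cubic_mono; first exact: ltW (rnp_gt0 _ _).
    by apply: rnp_mono => //; move: h1 A0; clear; lia.
  by have /andP[] := rho n n1.
- by rewrite invr_ge0 ltW// wpos// leqnSn.
have X1 : (A <= X <= X)%N by rewrite leqnn ltnW.
have : (wgt k X)^-1 <= 4 * expR 4.
  rewrite -[leRHS]invrK lef_pV2 ?posrE ?wpos// ?invr_gt0 ?mulr_gt0 ?expR_gt0//.
  by rewrite invfM -expRN mulrC wlow.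
have x13 : 0 <= 2 * (2 * u^-1 ^+ 13) by rewrite !mulr_ge0 ?exprn_ge0 ?invr_ge0 ?(ltW u0').
move=> h; have := ler_wpM2l x13 h; move: (u^-1 ^+ 13) => a; lra.
Qed.

Definition llpow n : R := expR (- (13 / 12) * ln (ln n%:R)).

Lemma mobs_double : exists C, exists2 A0 : nat, (0 < C :> R) /\ (2 < A0)%N & forall A X, (A0 <= A)%N ->
  (A <= X)%N -> (X <= A ^ 2)%N -> `|mobs X - mobs A| <= C * llpow A.
Proof.
have [u0 u01 H] := mobs_window.
exists (16 * expR 4); exists (Num.truncn (expR (u0 ^+ 12))).+3; first by rewrite mulr_gt0 ?expR_gt0.
move=> A X hA AX XA.
have up : 1 <= u0 ^+ 12 by rewrite exprn_ege1//; lra.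
have A1 : (0 < A)%N by apply: leq_trans hA.
have A1' : (0 : R) < A%:R by rewrite ltr0n.
have lA : u0 ^+ 12 <= ln A%:R.
  rewrite -[leLHS]expRK ler_ln ?posrE ?expR_gt0//; apply: ltW; apply: lt_le_trans (truncnS_gt _) _.
  by rewrite ler_nat; apply: leq_trans hA; rewrite ltnS leqW// leqW.
have lA0 : 0 < ln (A%:R : R) by lra.
pose u : R := expR (ln (ln A%:R) / 12).
have u12 : u ^+ 12 = ln A%:R by rewrite /u -expRM_natl mulrC divfK ?lnK.
have uu : u0 <= u.
  by rewrite -(@ler_pXn2r _ 12)// ?nnegrE ?expR_ge0 ?u12//; lra.
have lX : ln X%:R <= 2 * u ^+ 12.
  rewrite u12 mulr_natl -lnXn// ler_ln ?posrE ?exprn_gt0 ?ltr0n ?(leq_trans A1)//.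
  by rewrite -natrX ler_nat.
have -> : llpow A = u^-1 ^+ 13 by rewrite /u -expRN -expRM_natl /llpow; congr expR; field.
exact: H.
Qed.

Lemma llpow_sqr A : (2 < A)%N -> llpow (A ^ 2) = expR (- (13 / 12) * ln 2) * llpow A.
Proof.
move=> A2; have A0 : (0 : R) < A%:R by rewrite ltr0n; apply: leq_trans A2.
have lA : 0 < ln (A%:R : R) by rewrite ln_gt0// ltr1n; apply: leq_trans A2.
by rewrite /llpow natrX lnXn// -[_ *+ 2]mulr_natl lnM ?posrE// mulrDr expRD.
Qed.

Lemma mobs_conv : exists C, exists2 A0 : nat, (0 < C :> R) /\ (2 < A0)%N & forall A X, (A0 <= A)%N ->
  (A <= X)%N -> `|mobs X - mobs A| <= C * llpow A.
Proof.
have [C [A0 [C0 A2] H]] := mobs_double.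
set q : R := expR (- (13 / 12) * ln 2).
have q1 : q < 1.
  by rewrite -expR0 ltr_expR mulNr oppr_lt0 mulr_gt0// ln_gt0// ltr1n.
have q1' : 0 < 1 - q by rewrite subr_gt0.
exists (C / (1 - q)); exists A0; first by split; rewrite ?divr_gt0.
have key j : forall A X, (A0 <= A)%N -> (A <= X)%N -> (X <= A ^ (2 ^ j))%N ->
   `|mobs X - mobs A| <= C / (1 - q) * llpow A.
  elim: j => [|j IH] A X hA AX XA.
    have -> : X = A by apply/eqP; rewrite eqn_leq AX andbT; move: XA; rewrite expn0 expn1.
    by rewrite subrr normr0 mulr_ge0 ?expR_ge0// divr_ge0// ltW.
  have Cq : C <= C / (1 - q).
    by rewrite ler_pdivlMr// ler_piMr ?(ltW C0)// lerBlDr lerDl expR_ge0.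
  have [h|h] := leqP X (A ^ 2).
    by apply: le_trans (H A X hA AX h) _; rewrite ler_wpM2r ?expR_ge0.
  have AA : (A <= A ^ 2)%N by rewrite -{1}(expn1 A) leq_pexp2l//; apply: leq_trans hA; apply: leq_trans A2.
  have h1 := IH (A ^ 2)%N X (leq_trans hA AA) (ltnW h); rewrite -expnM -expnS in h1.
  have h2 := H A (A ^ 2)%N hA AA (leqnn _).
  have -> : mobs X - mobs A = (mobs X - mobs (A ^ 2)%N) + (mobs (A ^ 2)%N - mobs A) by ring.
  apply: le_trans (ler_normD _ _) _; apply: le_trans (lerD (h1 XA) h2) _.
  rewrite llpow_sqr ?(leq_trans A2)// -/q mulrA -mulrDl ler_wpM2r ?expR_ge0//.
  by rewrite le_eqVlt; apply/orP; left; apply/eqP; field; rewrite gt_eqF.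
move=> A X hA AX; apply: (key X) => //.
have A1 : (1 < A)%N by apply: leq_trans hA; apply: leq_trans A2.
apply: leq_trans (ltnW (ltn_expl X A1)) _; rewrite leq_pexp2l ?(ltnW A1)//.
exact: ltnW (ltn_expl _ _).
Qed.

Lemma sum_mobs_div X : (0 < X)%N -> \sum_(1 <= e < X.+1) mobs (X %/ e) / e%:R = 1.
Proof.
move=> X0.
have -> : \sum_(1 <= e < X.+1) mobs (X %/ e) / e%:R =
   \sum_(1 <= e < X.+1) \sum_(1 <= d < (X %/ e).+1) (moeb R d / d%:R / e%:R).
  by apply: eq_bigr => e _; rewrite mulr_suml.
rewrite -(sum_pairs_sym X (fun d e => moeb R d / d%:R / e%:R)) -(sum_div_pairs X (fun d e => moeb R d / d%:R / e%:R)).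
have -> : \sum_(1 <= k < X.+1) \sum_(1 <= d < X.+1 | (d %| k)%N) moeb R d / d%:R / (k %/ d)%:R =
  \sum_(1 <= k < X.+1) (k == 1%N)%:R.
  apply: eq_big_nat => k /andP[k0 kX].
  have -> : \sum_(1 <= d < X.+1 | (d %| k)%N) moeb R d / d%:R / (k %/ d)%:R =
    (\sum_(1 <= d < k.+1 | (d %| k)%N) moeb R d) / k%:R.
    rewrite -(@sum_divisors_bound _ X) ?k0// mulr_suml big_nat_cond [RHS]big_nat_cond.
    apply: eq_bigr => d /andP[/andP[d0 _] dk].
    by rewrite -mulrA -invfM -natrM mulnC divnK.
  rewrite /moeb -rmorph_sum /= sum_moebius//.
  by case: eqP => [->|_]; rewrite ?mul0r// invr1 mulr1.
rewrite big_ltn// eqxx big_nat big1 ?addr0// => k /andP[k1 _].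
by rewrite gtn_eqF.
Qed.

Lemma abs_mobs_le X : (0 < X)%N -> `|mobs X| <= 1 + ln (X%:R : R).
Proof.
move=> X0; apply: le_trans (ler_norm_sum _ _ _) _; apply: le_trans (harmonic_ln_le _ X0).
apply: ler_sum => n _; rewrite normrM (@ger0_norm _ (n%:R^-1)) ?invr_ge0//.
by rewrite -[leRHS]mul1r ler_wpM2r ?invr_ge0 ?moeb_le1.
Qed.

Lemma ln_le_harmonic n : ln n.+1%:R <= \sum_(1 <= k < n.+1) (k%:R^-1 : R).
Proof.
elim: n => [|n IH]; first by rewrite ln1 big_geq.
rewrite big_nat_recr//=; apply: le_trans (lerD IH (lexx _)).
have n1 : (0 : R) < n.+1%:R by rewrite ltr0n.
have -> : n.+2%:R = n.+1%:R * (1 + n.+1%:R^-1) :> R by rewrite mulrDr mulr1 divff ?gt_eqF// natr1.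
rewrite lnM ?posrE ?addr_gt0 ?invr_gt0// lerD2l le_ln1Dx// (lt_trans (ltrN10 _))// invr_gt0//.
Qed.

Lemma mobs_no_const (s e : R) A : 0 < e -> `|s| = 1 -> (0 < A)%N ->
  (forall X, (A <= X)%N -> e <= s * mobs X) -> False.
Proof.
move=> e0 s1 A0 H.
have bd Y : e * ln (Y.+1%:R : R) <= 1 + A%:R * (1 + ln A%:R).
  case: Y => [|Y]; first by rewrite ln1 mulr0 addr_ge0// mulr_ge0// addr_ge0 ?ln_nat_ge0.
  have XE := @sum_mobs_div (A * Y.+1) _; have {XE} := XE ltac:(by rewrite muln_gt0 A0).
  move/(congr1 (fun z => s * z)); rewrite mulr1 (@big_cat_nat _ _ _ Y.+2)//=; last first.
    by rewrite ltnS leq_pmull.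
  rewrite mulrDr => E.
  have h1 : e * ln (Y.+2%:R : R) <= s * \sum_(1 <= i < Y.+2) mobs (A * Y.+1 %/ i) / i%:R.
    apply: le_trans (ler_wpM2l (ltW e0) (ln_le_harmonic _)) _.
    rewrite !mulr_sumr big_nat [leRHS]big_nat; apply: ler_sum => i /andP[i0 iY].
    rewrite mulrA ler_wpM2r ?invr_ge0// H// leq_divRL// leq_mul2l.
    by rewrite -ltnS iY orbT.
  have h2 : `|s * \sum_(Y.+2 <= i < (A * Y.+1).+1) mobs (A * Y.+1 %/ i) / i%:R| <= A%:R * (1 + ln A%:R).
    rewrite normrM s1 mul1r; apply: le_trans (ler_norm_sum _ _ _) _.
    have Y0 : (0 : R) < Y.+1%:R by rewrite ltr0n.
    apply: (@le_trans _ _ (\sum_(Y.+2 <= i < (A * Y.+1).+1) ((1 + ln A%:R) / Y.+1%:R))).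
      rewrite big_nat [leRHS]big_nat; apply: ler_sum => i /andP[iY iA].
      have i0 : (0 < i)%N by apply: leq_trans iY.
      rewrite normrM (@ger0_norm _ (i%:R^-1)) ?invr_ge0// ler_pM ?invr_ge0//; last first.
        by rewrite lef_pV2 ?posrE ?ltr0n// ler_nat ltnW.
      have d0 : (0 < A * Y.+1 %/ i)%N by rewrite divn_gt0// -ltnS.
      apply: le_trans (abs_mobs_le d0) _; rewrite lerD2l ler_ln ?posrE ?ltr0n// ler_nat.
      by rewrite -ltnS ltn_divLR// (leq_trans (_ : _ < A.+1 * Y.+1)%N) ?ltn_mul2r ?ltnSn// leq_mul2l ltnW ?orbT.
    rewrite sumr_const_nat -[X in X <= _]mulr_natr mulrAC -mulrA [_ * (_ / _)]mulrC ler_wpM2r ?addr_ge0 ?ln_nat_ge0//.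
    rewrite ler_pdivrMr// -natrM ler_nat; clear; lia.
  have : s <= 1 by rewrite -s1 ler_norm.
  move: h1 h2 E; rewrite ler_norml => h1 /andP[h2 _] E; lra.
have := bd (Num.truncn (expR ((2 + A%:R * (1 + ln A%:R)) / e))).
set a := _ / e => h.
have : a <= ln ((Num.truncn (expR a)).+1%:R).
  by rewrite -[leLHS]expRK ler_ln ?posrE ?expR_gt0 ?ltr0n// ltW// truncnS_gt.
move/(ler_wpM2l (ltW e0)) => h'; have := le_trans h' h.
by rewrite /a mulrC divfK ?gt_eqF//; lra.
Qed.

Lemma mobs_small : exists C, exists2 A0 : nat, (0 < C :> R) /\ (2 < A0)%N & forall A, (A0 <= A)%N ->
  `|mobs A| <= C * llpow A.
Proof.
have [C [A0 [C0 A2] H]] := mobs_conv; exists C; exists A0 => // A hA.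
have A1 : (0 < A)%N by apply: leq_trans hA; apply: leq_trans A2.
rewrite leNgt; apply/negP => h.
have [s [s1 sE]] : exists s : R, `|s| = 1 /\ s * mobs A = `|mobs A|.
  have [p|p] := leP 0 (mobs A); first by exists 1; rewrite normr1 mul1r ger0_norm.
  by exists (-1); rewrite normrN normr1 mulN1r ltr0_norm.
apply: (@mobs_no_const s (`|mobs A| - C * llpow A) A) => //; first by rewrite subr_gt0.
move=> X AX; have := H A X hA AX.
have -> : `|mobs X - mobs A| = `|s * mobs X - s * mobs A| by rewrite -mulrBr normrM s1 mul1r.
rewrite sE ler_norml => /andP[]; lra.
Qed.

Lemma mobs_le : exists2 C : R, 0 < C & forall X j, (0 < X)%N -> (2 ^ j <= X)%N ->
  `|mobs X| <= C * rnp (1 + 12^-1) j.+1.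
Proof.
have [C [A0 [C0 A2] H]] := mobs_small.
have A0' : (0 < A0)%N by apply: leq_trans A2.
set a : R := 1 + 12^-1; have a0 : 0 <= a by rewrite /a; lra.
set D : R := (1 + ln A0%:R) * rnp (- a) A0.
have D0 : 0 <= D by rewrite mulr_ge0 ?addr_ge0 ?ln_nat_ge0 ?(ltW (rnp_gt0 _ _)).
exists (C * rnp (- a) 4 + D); first by rewrite ltr_wpDr// mulr_gt0 ?rnp_gt0.
move=> X j X0 jX; rewrite mulrDl; have r0 := rnp_gt0 a j.+1.
have [hA|hA] := leqP A0 X.
  apply: le_trans (H X hA) _; rewrite -[leLHS]addr0 lerD ?(mulr_ge0 D0 (ltW r0))//.
  rewrite -mulrA ler_wpM2l ?(ltW C0)// rnpN -[X in _ <= X]mulrC ler_pdivlMr ?rnp_gt0//.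
  rewrite /llpow /rnp -expRD ler_expR -/a.
  have -> : 13 / 12 = a :> R by rewrite /a; field.
  rewrite -mulrDr -lnM ?posrE ?ltr0n//; last first.
    by rewrite ln_gt0// ltr1n; apply: leq_trans hA; apply: leq_trans A2.
  rewrite !mulNr lerN2 ler_wpM2l// ler_ln ?posrE ?ltr0n//; last first.
    by rewrite mulr_gt0// ln_gt0// ltr1n; apply: leq_trans hA; apply: leq_trans A2.
  have X3 : (3 <= X)%N by apply: leq_trans hA.
  have h1 : j%:R * ln 2 <= ln (X%:R : R).
    rewrite mulr_natl -lnXn// ler_ln ?posrE ?exprn_gt0 ?ltr0n//.
    by rewrite -natrX ler_nat.
  have h2 : ln (2 : R) <= ln X%:R by rewrite ler_ln ?posrE ?ltr0n// ler_nat ltnW.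
  have l2 := @ln2_ge R; rewrite -natr1.
  have : j%:R * 2^-1 <= j%:R * ln 2 :> R by rewrite ler_wpM2l.
  lra.
have h0 : 0 <= C * rnp (- a) 4 * rnp a j.+1.
  by apply: mulr_ge0 (ltW r0); apply: mulr_ge0 (ltW C0) (ltW (rnp_gt0 _ _)).
rewrite -[leLHS]add0r lerD//.
apply: le_trans (abs_mobs_le X0) _; rewrite /D -mulrA rnpN.
have l1 : 1 + ln (X%:R : R) <= 1 + ln A0%:R by rewrite lerD2l ler_ln ?posrE ?ltr0n// ler_nat ltnW.
apply: le_trans l1 _; rewrite ler_peMr ?addr_ge0 ?ln_nat_ge0// mulrC ler_pdivlMr ?rnp_gt0// mul1r.
apply: rnp_mono => //=; apply: leq_trans hA; rewrite ltnS; apply: leq_trans jX.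
exact: ltnW (ltn_expl _ _).
Qed.

End MoebiusSum.

(** * Sums over smooth numbers: the upper bound *)

Section OneConv.
Variable R : realType.
Variable g : nat -> R.
Hypothesis gM : cmult g.
Hypothesis g1 : forall n, `|g n| <= 1.
Implicit Types (n m p q Z X : nat).

Definition dh n : R := \sum_(1 <= d < n.+1 | (d %| n)%N) g d.

Lemma dh1 : dh 1 = 1.
Proof. by rewrite /dh big_mkcond big_nat1 /= gM.1. Qed.

Fixpoint geo (r : R) j : R := if j is j'.+1 then 1 + r * geo r j' else 1.

Lemma dh_prime_pow p j n : prime p -> (0 < n)%N -> ~~ (p %| n)%N -> dh (p ^ j * n) = geo (g p) j * dh n.
Proof.
move=> pp n0 pn; have p0 := prime_gt0 pp.
elim: j => [|j IH]; first by rewrite expn0 !mul1n mul1r.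
set m := (p ^ j * n)%N in IH *.
have m0 : (0 < m)%N by rewrite muln_gt0 expn_gt0 p0.
rewrite /= mulrDl mul1r -mulrA -IH expnS -mulnA -/m /dh (bigID (fun d => (p %| d)%N)) /= addrC.
congr (_ + _).
  have nm : (n <= p * m)%N by rewrite /m mulnA leq_pmull// muln_gt0 p0 expn_gt0 p0.
  have E := @sum_divisors_bound _ (p * m) n g; rewrite n0 nm in E; rewrite -(E isT).
  apply: eq_bigl => d; apply/andP/idP => [[dm pd]|dn].
    move: dm; rewrite /m mulnA -expnS Gauss_dvdr// coprime_sym coprimeXl//.
    by rewrite prime_coprime.
  split; first by rewrite /m mulnA dvdn_mull.
  by apply: contra pn => pd; apply: dvdn_trans dn.
have -> : \sum_(1 <= i < (p * m).+1 | (i %| p * m)%N && (p %| i)%N) g i =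
   \sum_(1 <= i < (p * m).+1 | (p %| i)%N) (if (i %| p * m)%N then g i else 0).
  by rewrite [RHS]big_mkcond [LHS]big_mkcond; apply: eq_bigr => i _; case: (i %| _)%N; case: (p %| i)%N.
rewrite sum_multiples// mulKn// [in RHS]big_mkcond mulr_sumr.
apply: eq_big_nat => d /andP[d0 _]; rewrite dvdn_pmul2l//.
by case: ifP => _; rewrite ?mulr0// gM.2.
Qed.

Lemma geo_ge0 (r : R) j : `|r| <= 1 -> 0 <= geo r j.
Proof.
rewrite ler_norml => /andP[r1 r2]; have [r0|r0] := leP 0 r.
  by elim: j => [|j IH] //=; rewrite addr_ge0// mulr_ge0.
suff : 0 <= geo r j <= 1 by case/andP.
elim: j => [|j /andP[h1 h2]] /=; first by rewrite ler01 lexx.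
have := @ler_pM R (- r) 1 (geo r j) 1; rewrite oppr_ge0 (ltW r0) h1 h2 lerNl r1 => /(_ isT isT isT isT).
have : 0 <= - r * geo r j by rewrite mulr_ge0// oppr_ge0 ltW.
by rewrite mulNr mulr1 => a b; apply/andP; split; lra.
Qed.

Lemma split_prime_power n : (1 < n)%N -> exists p j m, [/\ prime p, (0 < m)%N, ~~ (p %| m)%N, (m < n)%N & n = (p ^ j * m)%N].
Proof.
move=> n1; have n0 : (0 < n)%N by exact: ltnW.
have pp := pdiv_prime n1; have [m pm nE] := pfactor_coprime pp n0.
have m0 : (0 < m)%N by move: n0; rewrite nE muln_gt0 => /andP[].
exists (pdiv n), (logn (pdiv n) n), m; split => //.
- by rewrite -prime_coprime.
- rewrite [X in (_ < X)%N]nE ltn_Pmulr// -[X in (X < _)%N](expn0 (pdiv n)) ltn_exp2l ?prime_gt1//.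
  by rewrite logn_gt0 pi_pdiv.
- by rewrite mulnC.
Qed.

Lemma dh_ge0 n : 0 <= dh n.
Proof.
elim/ltn_ind: n => n IH; have [n1|n1] := leqP n 1.
  case: n n1 IH => [|[|//]] _ _; first by rewrite /dh big_geq.
  by rewrite dh1.
have [p [j [m [pp m0 pm mn ->]]]] := split_prime_power n1.
by rewrite dh_prime_pow// mulr_ge0 ?geo_ge0// IH.
Qed.

Lemma invn_prime_lt1 p : prime p -> (p%:R^-1 : R) < 1.
Proof. by move=> pp; rewrite invf_lt1 ?ltr0n ?prime_gt0// ltr1n prime_gt1. Qed.

Lemma gn_prime_lt1 p : prime p -> g p / p%:R < 1.
Proof.
move=> pp; apply: le_lt_trans (invn_prime_lt1 pp).
by rewrite -[leRHS]mul1r ler_wpM2r ?invr_ge0//; have := g1 p; rewrite ler_norml => /andP[].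
Qed.

Definition hs q Z : R := ssum (fun n => dh n / n%:R) q Z.

Lemma hs_ge0 q Z : 0 <= hs q Z.
Proof. by apply: ssum_ge0 => n; rewrite divr_ge0// dh_ge0. Qed.

Lemma hs_mono q X Z : (X <= Z)%N -> hs q X <= hs q Z.
Proof.
move=> XZ; rewrite /hs /ssum big_mkcond [leRHS]big_mkcond; apply: ler_sum_nat_subset => // i.
by case: ifP => // _; rewrite divr_ge0// dh_ge0.
Qed.

Lemma hs_step q Z : prime q.+1 ->
  hs q.+1 Z <= hs q Z * ((1 - q.+1%:R^-1)^-1 * (1 - g q.+1 / q.+1%:R)^-1).
Proof.
set p := q.+1 => pp; have p0 : (0 < p)%N by [].
set u : R := p%:R^-1; set r := g p; have rE : r / p%:R = r * u by [].
have u1 : 0 < 1 - u by rewrite subr_gt0 invn_prime_lt1.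
have v1 : 0 < 1 - r * u by rewrite subr_gt0 -rE gn_prime_lt1.
have u0 : 0 <= u by rewrite invr_ge0.
pose a := (1 - r * u)^-1; pose G j := a * geo r j + u * a / (1 - u).
have a0 : 0 <= a by rewrite invr_ge0 ltW.
have G0 j : 0 <= G j 
  by apply: addr_ge0; [exact: mulr_ge0 (geo_ge0 _ (g1 _))|rewrite divr_ge0 ?mulr_ge0// ltW].
have GE j : G j = geo r j + u * G j.+1.
  by rewrite /G /a /=; move: (geo r j) => s; field; rewrite !gt_eqF.
have main : forall X j, (X <= Z)%N -> \sum_(1 <= n < X.+1 | smooth p n) dh (p ^ j * n) / n%:R <= hs q X * G j.
  elim/ltn_ind => X IH j XZ; have [X0|X0] := posnP X.
    by rewrite X0 big_geq// mulr_ge0 ?hs_ge0.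
  rewrite (bigID (fun n => (p %| n)%N)) /= addrC GE mulrDr; apply: lerD.
    rewrite /hs /ssum mulr_suml le_eqVlt; apply/orP; left; apply/eqP.
    rewrite big_mkcond [RHS]big_mkcond; apply: eq_big_nat => n /andP[n0 _].
    have sE : smooth p n && ~~ (p %| n)%N = smooth q n by rewrite (smoothS q n0) -/p pp.
    rewrite sE; case: ifP => // sn; rewrite dh_prime_pow//; first by rewrite -mulrA mulrC.
    by move: sn; rewrite -sE => /andP[].
  have -> : \sum_(1 <= n < X.+1 | smooth p n && (p %| n)%N) dh (p ^ j * n) / n%:R =
    u * \sum_(1 <= n < (X %/ p).+1 | smooth p n) dh (p ^ j.+1 * n) / n%:R.
    under eq_bigl do rewrite andbC.
    rewrite big_mkcondr sum_multiples// mulr_sumr [RHS]big_mkcond.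
    apply: eq_big_nat => e /andP[e0 _]; rewrite smoothM// smooth_prime// leqnn /=.
    by case: ifP => // _; rewrite expnSr -mulnA natrM invfM mulrCA.
  rewrite [leRHS]mulrCA ler_wpM2l//.
  apply: le_trans (IH _ _ j.+1 _) _; [by rewrite ltn_Pdiv// prime_gt1| |].
    by apply: leq_trans XZ; exact: leq_div.
  by rewrite ler_wpM2r// hs_mono// leq_div.
have := main Z 0%N (leqnn _); rewrite expn0.
under eq_bigr do rewrite mul1n.
move/le_trans; apply; rewrite /G /= mulr1 ler_wpM2l ?hs_ge0//.
by rewrite le_eqVlt; apply/orP; left; apply/eqP; rewrite /a; field; rewrite !gt_eqF.
Qed.

Lemma hs_le_euler q Z : hs q Z <= euler (fun n => n%:R^-1) q * euler (fun n => g n / n%:R) q.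
Proof.
elim: q Z => [|q IH] Z.
  by rewrite /hs ssum_base /euler !big_geq// mulr1 dh1 invr1 mulr1; case: ifP.
have [pp|pp] := boolP (prime q.+1); last by rewrite /hs ssum_nonprime// !euler_nonprime.
apply: le_trans (hs_step _ pp) _; rewrite !euler_prime// mulrACA ler_wpM2r//.
by rewrite mulr_ge0 ?invr_ge0 ?subr_ge0 ?(ltW (invn_prime_lt1 pp)) ?(ltW (gn_prime_lt1 pp)).
Qed.

Definition dhsum Z : R := \sum_(1 <= b < Z.+1) dh b.

Lemma dhsumE Z : dhsum Z = \sum_(1 <= d < Z.+1) g d * (Z %/ d)%:R.
Proof.
transitivity (\sum_(1 <= k < Z.+1) \sum_(1 <= d < Z.+1 | (d %| k)%N) g d).
  by apply: eq_big_nat => k /andP[k0 kZ]; rewrite sum_divisors_bound ?k0.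
rewrite (sum_div_pairs Z (fun d _ => g d)).
by apply: eq_bigr => d _; rewrite sumr_const_nat subn1 /= mulr_natr.
Qed.

Lemma sum_dh_ln Z : \sum_(1 <= b < Z.+1) dh b * ln b%:R =
  \sum_(1 <= q < Z.+1) mangoldt R q * (1 + g q) * dhsum (Z %/ q).
Proof.
transitivity (\sum_(1 <= d < Z.+1) \sum_(1 <= e < (Z %/ d).+1) g d * (ln d%:R + ln e%:R)).
  rewrite -(sum_div_pairs Z (fun d e => g d * (ln d%:R + ln e%:R))).
  apply: eq_big_nat => k /andP[k0 kZ]; rewrite /dh -(@sum_divisors_bound _ Z) ?k0// mulr_suml.
  rewrite big_nat_cond [RHS]big_nat_cond; apply: eq_bigr => d /andP[/andP[d0 _] dk].
  have kd : (0 < k %/ d)%N by rewrite divn_gt0// dvdn_leq.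
  by rewrite -lnM ?posrE ?ltr0n// -natrM [(d * _)%N]mulnC divnK.
under eq_bigr do under eq_bigr do rewrite mulrDr.
under eq_bigr do rewrite big_split /=.
rewrite big_split /= addrC.
have -> : \sum_(1 <= q < Z.+1) mangoldt R q * (1 + g q) * dhsum (Z %/ q) =
  \sum_(1 <= q < Z.+1) mangoldt R q * dhsum (Z %/ q) + \sum_(1 <= q < Z.+1) mangoldt R q * g q * dhsum (Z %/ q).
  by rewrite -big_split /=; apply: eq_bigr => q _; rewrite mulrDr mulr1 mulrDl.
congr (_ + _).
  transitivity (\sum_(1 <= d < Z.+1) \sum_(1 <= q < (Z %/ d).+1) g d * (mangoldt R q * (Z %/ d %/ q)%:R)).
    apply: eq_bigr => d _; rewrite -!mulr_sumr; congr (_ * _); rewrite -ln_fact.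
    elim: (Z %/ d)%N => [|n IH]; first by rewrite big_geq// ln1.
    by rewrite big_nat_recr//= IH factS natrM lnM ?posrE ?ltr0n ?fact_gt0// addrC.
  rewrite (sum_pairs_sym Z (fun d q => g d * (mangoldt R q * (Z %/ d %/ q)%:R))).
  apply: eq_bigr => q _; rewrite dhsumE mulr_sumr; apply: eq_bigr => d _.
  by rewrite divnAC; ring.
transitivity (\sum_(1 <= d < Z.+1) \sum_(1 <= q < Z.+1 | (q %| d)%N) mangoldt R q * g q * (g (d %/ q)%N * (Z %/ (q * (d %/ q)))%:R)).
  apply: eq_big_nat => d /andP[d0 dZ]; rewrite sumr_const_nat subn1 /= -[_ *+ (Z %/ d)]mulr_natr.
  rewrite -(sum_mangoldt R d0) -(@sum_divisors_bound _ Z) ?d0// mulr_sumr mulr_suml.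
  rewrite big_mkcond [RHS]big_mkcond; apply: eq_big_nat => q /andP[q0 _]; case: ifP => // qd.
  have dq : (0 < d %/ q)%N by rewrite divn_gt0// dvdn_leq.
  rewrite -{1}(divnK qd) gM.2// [(q * _)%N]mulnC divnK//; ring.
rewrite (sum_div_pairs Z (fun q e => mangoldt R q * g q * (g e * (Z %/ (q * e))%:R))).
apply: eq_bigr => q _; rewrite dhsumE mulr_sumr; apply: eq_bigr => e _.
by rewrite divnMA.
Qed.

Lemma dhsum_ge0 Z : 0 <= dhsum Z.
Proof. by apply: sumr_ge0 => b _; exact: dh_ge0. Qed.

Lemma dhsum_ln_le Z : (0 < Z)%N -> dhsum Z * ln Z%:R <= 9 * Z%:R * hs Z Z.
Proof.
move=> Z0; have Z0' : (0 : R) < Z%:R by rewrite ltr0n.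
rewrite /hs ssum_total//.
have h1 : \sum_(1 <= b < Z.+1) dh b * ln b%:R <= 8 * Z%:R * \sum_(1 <= b < Z.+1) dh b / b%:R.
  rewrite sum_dh_ln.
  apply: (@le_trans _ _ (\sum_(1 <= q < Z.+1) 2 * mangoldt R q * dhsum (Z %/ q))).
    apply: ler_sum => q _; rewrite ler_wpM2r ?dhsum_ge0// mulrC ler_wpM2r ?mangoldt_ge0//.
    by have := g1 q; rewrite ler_norml => /andP[]; lra.
  have -> : \sum_(1 <= q < Z.+1) 2 * mangoldt R q * dhsum (Z %/ q) =
    2 * \sum_(1 <= b < Z.+1) dh b * psi R (Z %/ b).
    rewrite mulr_sumr.
    transitivity (\sum_(1 <= q < Z.+1) \sum_(1 <= b < (Z %/ q).+1) 2 * (mangoldt R q * dh b)).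
      by apply: eq_bigr => q _; rewrite /dhsum -mulrA !mulr_sumr.
    rewrite (sum_pairs_sym Z (fun q b => 2 * (mangoldt R q * dh b))); apply: eq_bigr => b _.
    by rewrite /psi !mulr_sumr; apply: eq_bigr => q _; rewrite [dh b * _]mulrC.
  have -> : 8 * Z%:R * \sum_(1 <= b < Z.+1) dh b / b%:R = 2 * \sum_(1 <= b < Z.+1) dh b * (4 * (Z%:R / b%:R)).
    by rewrite !mulr_sumr; apply: eq_bigr => b _; ring.
  rewrite ler_wpM2l// big_nat [leRHS]big_nat; apply: ler_sum => b /andP[b0 _]; rewrite ler_wpM2l ?dh_ge0//.
  apply: le_trans (psi_le _ _) _; rewrite ler_wpM2l// ler_pdivlMr ?ltr0n// -natrM ler_nat.
  exact: leq_trunc_div.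
have h2 : \sum_(1 <= b < Z.+1) dh b * (ln Z%:R - ln b%:R) <= Z%:R * \sum_(1 <= b < Z.+1) dh b / b%:R.
  rewrite mulr_sumr big_nat [leRHS]big_nat; apply: ler_sum => b /andP[b0 _].
  rewrite mulrCA ler_wpM2l ?dh_ge0// -ln_div ?posrE ?ltr0n//.
  have q0 : 0 < Z%:R / b%:R :> R by rewrite divr_gt0// ltr0n.
  have -> : Z%:R / b%:R = 1 + (Z%:R / b%:R - 1) :> R by ring.
  by apply: le_trans (le_ln1Dx _) _; lra.
have -> : dhsum Z * ln Z%:R = \sum_(1 <= b < Z.+1) dh b * ln b%:R + \sum_(1 <= b < Z.+1) dh b * (ln Z%:R - ln b%:R).
  by rewrite -big_split mulr_suml /=; apply: eq_bigr => b _; ring.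
by apply: le_trans (lerD h1 h2) _; rewrite -mulrDl; lra.
Qed.

Definition gsum X : R := \sum_(1 <= n < X.+1) g n / n%:R.

Lemma gsum_dh_mobs X : gsum X = \sum_(1 <= b < X.+1) dh b / b%:R * mobs R (X %/ b).
Proof.
have E Y : \sum_(1 <= b < Y.+1) dh b / b%:R = \sum_(1 <= e < Y.+1) e%:R^-1 * gsum (Y %/ e).
  transitivity (\sum_(1 <= b < Y.+1) \sum_(1 <= d < Y.+1 | (d %| b)%N) (g d / d%:R / (b %/ d)%:R)).
    apply: eq_big_nat => b /andP[b0 bY]; rewrite /dh -(@sum_divisors_bound _ Y) ?b0// mulr_suml.
    rewrite big_nat_cond [RHS]big_nat_cond; apply: eq_bigr => d /andP[/andP[d0 _] dk].
    by rewrite -mulrA -invfM -natrM mulnC divnK.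
  rewrite (sum_div_pairs Y (fun d e => g d / d%:R / e%:R)) (sum_pairs_sym Y (fun d e => g d / d%:R / e%:R)).
  by apply: eq_bigr => e _; rewrite mulrC /gsum mulr_suml.
transitivity (\sum_(1 <= k < X.+1) (k == 1%N)%:R / k%:R * gsum (X %/ k)).
  case: X => [|X]; first by rewrite big_geq// /gsum big_geq.
  rewrite big_ltn// eqxx invr1 mulr1 mul1r divn1 big_nat big1 ?addr0//.
  by move=> k /andP[k1 _]; rewrite gtn_eqF// !mul0r.
transitivity (\sum_(1 <= k < X.+1) \sum_(1 <= d < X.+1 | (d %| k)%N) moeb R d / d%:R / (k %/ d)%:R * gsum (X %/ (d * (k %/ d)))).
  apply: eq_big_nat => k /andP[k0 kX].
  have -> : (k == 1%N)%:R = \sum_(1 <= d < X.+1 | (d %| k)%N) moeb R d :> R.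
    rewrite (@sum_divisors_bound _ X) ?k0// /moeb -rmorph_sum /= sum_moebius//.
    by case: eqP.
  rewrite !mulr_suml big_nat_cond [RHS]big_nat_cond; apply: eq_bigr => d /andP[/andP[d0 _] dk].
  by have ek : (d * (k %/ d))%N = k; [rewrite mulnC divnK|rewrite ek -[moeb R d / d%:R / _]mulrA -invfM -natrM ek].
rewrite (sum_div_pairs X (fun d e => moeb R d / d%:R / e%:R * gsum (X %/ (d * e)))).
transitivity (\sum_(1 <= d < X.+1) \sum_(1 <= b < (X %/ d).+1) (moeb R d / d%:R * (dh b / b%:R))).
  apply: eq_bigr => d _; rewrite -mulr_sumr E mulr_sumr; apply: eq_bigr => e _.
  by rewrite divnMA mulrA.
rewrite (sum_pairs_sym X (fun d b => moeb R d / d%:R * (dh b / b%:R))); apply: eq_bigr => b _.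
by rewrite -mulr_suml mulrC.
Qed.

End OneConv.

Section SmoothMeanBound.
Variable R : realType.
Implicit Types (g : nat -> R) (n m p y X Z : nat).

Lemma gsum_bound : exists2 C : R, 0 < C & forall g y X, cmult g -> (forall n, `|g n| <= 1) ->
  (forall p, prime p -> (y < p)%N -> g p = 0) -> (1 < y)%N -> (y ^ 2 <= X)%N ->
  `|gsum g X| <= C * euler (fun n => g n / n%:R) y.
Proof.
have [C1 C10 H1] := euler_nat_le R; have [C2 C20 H2] := mobs_le R.
exists (240 * C1 * C2); first by apply: mulr_gt0 => //; apply: mulr_gt0 => //; clear; lra.
move=> g y X gM g1 gy y1 yX; set F := euler _ y.
have y0 : (0 < y)%N by exact: ltnW.
have F0 : 0 < F by apply: euler_gt0 => p pp; exact: gn_prime_lt1.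
have eF Z : (y <= Z)%N -> euler (fun n => g n / n%:R) Z = F.
  elim: Z => [|Z IH]; first by rewrite leqn0 => /eqP e; move: y1; rewrite e.
  rewrite leq_eqVlt => /orP[/eqP <-//|yZ]; rewrite ltnS in yZ.
  have [pp|pp] := boolP (prime Z.+1); last by rewrite euler_nonprime// IH.
  by rewrite euler_prime// IH// gy ?ltnS// mul0r subr0 invr1 mulr1.
have hsB Z : (y <= Z)%N -> hs g Z Z <= C1 * ln Z%:R * F.
  move=> yZ; apply: le_trans (hs_le_euler gM g1 Z Z) _; rewrite eF// ler_wpM2r ?(ltW F0)//.
  by apply: H1; apply: leq_trans yZ.
have KB Z : (y <= Z)%N -> dhsum g Z <= 9 * C1 * F * Z%:R.
  move=> yZ; have Z1 : (1 < Z)%N by apply: leq_trans yZ.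
  have lZ : 0 < ln (Z%:R : R) by rewrite ln_gt0// ltr1n.
  rewrite -(ler_pM2r lZ); apply: le_trans (dhsum_ln_le gM g1 (ltnW Z1)) _.
  apply: le_trans (ler_wpM2l _ (hsB Z yZ)) _; first by rewrite mulr_ge0.
  by rewrite le_eqVlt; apply/orP; left; apply/eqP; ring.
have a0 b : 0 <= dh g b / b%:R by rewrite divr_ge0// dh_ge0.
set a : R := 1 + 12^-1.
have X0 : (0 < X)%N by apply: leq_trans yX; rewrite expn_gt0 y0.
have yyX : (y <= X)%N by apply: leq_trans yX; rewrite -{1}(expn1 y) leq_pexp2l.
rewrite gsum_dh_mobs//; apply: le_trans (ler_norm_sum _ _ _) _.
have nE b : `|dh g b / b%:R * mobs R (X %/ b)| = dh g b / b%:R * `|mobs R (X %/ b)| by rewrite normrM ger0_norm.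
under eq_bigr do rewrite nE.
rewrite (@big_cat_nat _ _ _ y)//=; last exact: leqW.
have A : \sum_(1 <= b < y) dh g b / b%:R * `|mobs R (X %/ b)| <= C1 * C2 * F.
  have ly : 0 < ln (y%:R : R) by rewrite ln_gt0// ltr1n.
  apply: (@le_trans _ _ (\sum_(1 <= b < y) dh g b / b%:R * (C2 / ln y%:R))).
    rewrite big_nat [leRHS]big_nat; apply: ler_sum => b /andP[b0 b_y]; rewrite ler_wpM2l//.
    have /andP[j1 j2] := trunc_log_bounds (ltnSn 1) y0.
    set j := trunc_log 2 y in j1 j2.
    have yb : (y <= X %/ b)%N by rewrite leq_divRL//; apply: leq_trans yX; rewrite expnS expn1 leq_mul2l (ltnW b_y) orbT.
    apply: le_trans (H2 _ j (leq_trans y0 yb) (leq_trans j1 yb)) _; rewrite ler_wpM2l ?(ltW C20)//.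
    apply: (@le_trans _ _ (rnp 1 j.+1)).
      by rewrite rnpD -[leRHS]mulr1 ler_wpM2l ?(ltW (rnp_gt0 _ _))// rnp_le1.
    rewrite rnp_nat// lef_pV2 ?posrE//.
    have : ln (y%:R : R) <= ln (2 ^+ j.+1).
      by rewrite ler_ln ?posrE ?exprn_gt0 ?ltr0n// -natrX ler_nat ltnW.
    rewrite lnXn// -[_ *+ j.+1]mulr_natr.
    have l2 : ln (2 : R) <= 1.
      by have := @le_ln1Dx R 1; rewrite (_ : 1 + 1 = 2 :> R)//; apply; lra.
    move/le_trans; apply; rewrite -[leRHS]mul1r ler_wpM2r//.
  rewrite -mulr_suml.
  have h : \sum_(1 <= b < y) dh g b / b%:R <= C1 * ln y%:R * F.
    apply: le_trans (hsB y (leqnn y)); rewrite /hs ssum_total//.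
    by apply: ler_sum_nat_subset.
  apply: le_trans (ler_wpM2r _ h) _; first by rewrite divr_ge0 ?ltW.
  by rewrite le_eqVlt; apply/orP; left; apply/eqP; field; rewrite gt_eqF.
have B : \sum_(y <= b < X.+1) dh g b / b%:R * `|mobs R (X %/ b)| <= 234 * C1 * C2 * F.
  pose jj b := trunc_log 2 (X %/ b).
  have X0' : (0 : R) < X%:R by rewrite ltr0n.
  apply: (@le_trans _ _ (\sum_(y <= b < X.+1) \sum_(0 <= j < X.+1 | jj b == j) dh g b / b%:R * (C2 * rnp a j.+1))).
    rewrite big_nat [leRHS]big_nat; apply: ler_sum => b /andP[b_y bX].
    have b0 : (0 < b)%N by apply: leq_trans b_y.
    have d0 : (0 < X %/ b)%N by rewrite divn_gt0// -ltnS.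
    have /andP[j1 j2] := trunc_log_bounds (ltnSn 1) d0.
    under eq_bigl do rewrite eq_sym.
    rewrite big_nat1_eq ifT.
      by rewrite ler_wpM2l// H2.
    rewrite /= ltnS /jj; apply: leq_trans (leq_div X b); apply: leq_trans j1.
    exact: ltnW (ltn_expl _ _).
  under eq_bigr do rewrite big_mkcond.
  rewrite exchange_big_nat /=.
  have inner j : \sum_(y <= b < X.+1 | jj b == j) dh g b / b%:R <= 18 * C1 * F.
    have cc : 0 <= 18 * C1 * F by rewrite !mulr_ge0 ?ltW.
    have p0 : (0 < 2 ^ j)%N by rewrite expn_gt0.
    set Z := (X %/ 2 ^ j)%N.
    have bnd b : (y <= b)%N -> (b < X.+1)%N -> jj b == j -> (b <= Z)%N /\ (X < b * 2 ^ j.+1)%N.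
      move=> b_y bX /eqP jE; have b0 : (0 < b)%N by apply: leq_trans b_y.
      have d0 : (0 < X %/ b)%N by rewrite divn_gt0// -ltnS.
      have /andP[j1 j2] := trunc_log_bounds (ltnSn 1) d0; rewrite -/(jj b) jE in j1 j2.
      rewrite /Z leq_divRL// mulnC -leq_divRL//; split=> //.
      by rewrite mulnC -ltn_divLR.
    have [yZ|Zy] := leqP y Z; last first.
      rewrite big_nat_cond big_pred0// => b; apply/negP => /andP[/andP[b_y bX] jb].
      by have [h _] := bnd b b_y bX jb; move: (leq_ltn_trans h Zy); rewrite ltnNge b_y.
    apply: (@le_trans _ _ (\sum_(y <= b < X.+1) (if (b <= Z)%N then dh g b * (2 * 2 ^+ j / X%:R) else 0))).
      rewrite big_mkcond big_nat [leRHS]big_nat; apply: ler_sum => b /andP[b_y bX].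
      have b0 : (0 < b)%N by apply: leq_trans b_y.
      have t0 : 0 <= dh g b * (2 * 2 ^+ j / X%:R) by rewrite mulr_ge0 ?dh_ge0// divr_ge0// mulr_ge0// exprn_ge0.
      case: ifP => [jb|_]; last by case: ifP.
      have [h1 h2] := bnd b b_y bX jb; rewrite h1 ler_wpM2l ?dh_ge0//.
      rewrite ler_pdivlMr// mulrC ler_pdivrMr ?ltr0n// -exprS -natrX -natrM ler_nat mulnC ltnW//.
    rewrite -big_mkcond /= -mulr_suml.
    have h : \sum_(y <= b < X.+1 | (b <= Z)%N) dh g b <= dhsum g Z.
      have ZX : (Z.+1 <= X.+1)%N by rewrite ltnS leq_div.
      have -> : dhsum g Z = \sum_(1 <= b < X.+1 | (b <= Z)%N) dh g b by rewrite /dhsum (big_nat_widen _ _ _ _ _ ZX).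
      rewrite [leRHS](@big_cat_nat _ _ _ y)//=; last exact: leqW.
      by rewrite lerDr sumr_ge0// => i _; exact: dh_ge0.
    apply: le_trans (ler_wpM2r _ (le_trans h (KB Z yZ))) _.
      by rewrite divr_ge0// mulr_ge0// exprn_ge0.
    have ZE : Z%:R * (2 * 2 ^+ j / X%:R) <= 2 :> R.
      rewrite mulrA ler_pdivrMr// mulrCA ler_pM2l// -natrX -natrM ler_nat; exact: leq_trunc_div.
    rewrite -(mulrA (9 * C1 * F)); apply: le_trans (ler_wpM2l _ ZE) _; last lra.
    by rewrite !mulr_ge0 ?ltW.
  apply: (@le_trans _ _ (\sum_(0 <= j < X.+1) 18 * C1 * F * (C2 * rnp a j.+1))).
    apply: ler_sum => j _; rewrite -big_mkcond -mulr_suml /= ler_wpM2r ?inner//.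
    by rewrite mulr_ge0 ?(ltW C20) ?(ltW (rnp_gt0 _ _)).
  rewrite -!mulr_sumr -(big_add1 _ _ 0 X.+2 xpredT (fun j => rnp a j)).
  have := @sum_rnp_le R 12^-1 X.+2 ltac:(lra); rewrite invrK -/a.
  have cc : 0 <= 18 * C1 * F * C2 by rewrite !mulr_ge0 ?ltW.
  move=> h; rewrite mulrA; apply: le_trans (ler_wpM2l cc h) _; lra.
apply: le_trans (lerD A B) _.
have : 0 <= C1 * C2 * F by rewrite !mulr_ge0 ?ltW.
lra.
Qed.

End SmoothMeanBound.

(** * The delay inequality and the lower bound *)

Section PrimePowerTail.
Variable R : realType.
Implicit Types (n m p q y M : nat).

Lemma ln_half_le m : ln (m%:R : R) <= 2 * rnp (- 2^-1) m.
Proof.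
by have := @expR_ge1Dx R (2^-1 * ln m%:R); rewrite /rnp opprK; move: (expR _) => e; lra.
Qed.

Lemma prime_power_tail y M : (0 < y)%N ->
  \sum_(y.+1 <= q < M.+1 | smooth y q) mangoldt R q / q%:R <= 28 * rnp 9^-1 y.
Proof.
move=> y0; pose z m : R := 2 * rnp 9^-1 y * rnp (1 + 6^-1) m.
have z0 m : 0 <= z m by rewrite !mulr_ge0 ?(ltW (rnp_gt0 _ _)).
pose s q m : R := (q == m ^ 2)%N%:R + (q == m ^ 2 * pdiv m)%N%:R.
have s0 q m : 0 <= s q m by rewrite addr_ge0.
apply: (@le_trans _ _ (\sum_(y.+1 <= q < M.+1 | smooth y q) \sum_(1 <= m < M.+1) s q m * z m)).
  rewrite big_mkcond [leRHS]big_mkcond big_nat [leRHS]big_nat; apply: ler_sum => q /andP[yq qM].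
  case: ifP => // sq; have [->|L0] := eqVneq (mangoldt R q) 0.
    by rewrite mul0r sumr_ge0// => m _; rewrite mulr_ge0.
  have [p [k [k0 pp] qE]] := mangoldt_neq0 L0.
  have p1 := prime_gt1 pp; have p0 := prime_gt0 pp.
  have py : (p <= y)%N.
    by move: sq; rewrite qE /smooth primesX// primes_prime//= andbT.
  have k2 : (1 < k)%N.
    rewrite ltnNge; apply/negP => k1; have kE : k = 1%N by move: k0 k1; clear; lia.
    by move: yq; rewrite qE kE expn1 ltnNge py.
  set m := (p ^ k./2)%N; have h0 : (0 < k./2)%N by move: k2; clear; lia.
  have m0 : (0 < m)%N by rewrite expn_gt0 p0.
  have mp : pdiv m = p by rewrite /m; case: (k./2) h0 => // h _; rewrite pdiv_pfactor.
  have pm : (p <= m)%N by rewrite -{1}(expn1 p) leq_pexp2l.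
  have qm : q = (m ^ 2)%N \/ q = (m ^ 2 * p)%N.
    have [ok|ek] := boolP (odd k).
      by right; rewrite qE /m -expnM -expnSr; congr (p ^ _)%N; move: ok; clear; lia.
    by left; rewrite qE /m -expnM; congr (p ^ _)%N; move: ek; clear; lia.
  have m2q : (m ^ 2 <= q)%N by case: qm => ->; rewrite ?leq_pmulr.
  have qm3 : (q <= m ^ 3)%N.
    case: qm => ->; first by rewrite leq_pexp2l.
    by rewrite (expnSr m 2) leq_mul2l pm orbT.
  have mM : (m < M.+1)%N.
    by apply: leq_ltn_trans qM; apply: leq_trans m2q; rewrite -{1}(expn1 m) leq_pexp2l.
  rewrite (bigD1_seq m) ?mem_index_iota ?iota_uniq ?m0//=.
  apply: (@le_trans _ _ (s q m * z m)); last by rewrite lerDl sumr_ge0// => i _; rewrite mulr_ge0.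
  apply: (@le_trans _ _ (z m)); last first.
    rewrite -[leLHS]mul1r ler_wpM2r// /s mp; case: qm => ->; rewrite eqxx ?lerDl ?lerDr//.
  have lm : mangoldt R q <= 2 * rnp (- 2^-1) m.
    rewrite qE mangoldt_prime//; apply: le_trans (ln_half_le m).
    by rewrite ler_ln ?posrE ?ltr0n// ler_nat.
  have q2 : (q%:R^-1 : R) <= rnp 2 m.
    have -> : rnp 2 m = (m ^ 2)%:R^-1 :> R by rewrite (_ : 2 = 1 + 1 :> R)// rnpD rnp_nat// -invfM -natrM mulnn.
    have q0 : (0 < q)%N by apply: leq_trans m2q; rewrite expn_gt0 m0.
    have mm0 : (0 < m ^ 2)%N by rewrite expn_gt0 m0.
    have mm0' : (0 : R) < (m ^ 2)%:R by rewrite ltr0n.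
    have q0' : (0 : R) < q%:R by rewrite ltr0n.
    by rewrite lef_pV2// ler_nat.
  have r1 : (1 : R) <= rnp 9^-1 y * rnp (- 3^-1) m.
    have -> : rnp (- 3^-1) m = rnp (- 9^-1) (m ^ 3) :> R.
      rewrite (_ : (m ^ 3 = m * (m * m))%N); last by rewrite mulnn -expnS.
      by rewrite !rnpM ?muln_gt0 ?m0// -!rnpD; congr (rnp _ m); field.
    have rm : (rnp 9^-1 (m ^ 3) : R) <= rnp 9^-1 y.
      by apply: rnp_mono; rewrite ?invr_ge0// y0 (leq_trans (ltnW yq) qm3).
    by rewrite rnpN ler_pdivlMr ?rnp_gt0// mul1r.
  apply: (@le_trans _ _ (2 * rnp (- 2^-1) m * rnp 2 m)).
    by apply: ler_pM => //; rewrite ?mangoldt_ge0 ?invr_ge0.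
  have -> : z m = 2 * rnp (- 2^-1) m * rnp 2 m * (rnp 9^-1 y * rnp (- 3^-1) m).
    have -> : z m = 2 * rnp 9^-1 y * (rnp (- 2^-1) m * rnp 2 m * rnp (- 3^-1) m).
      by rewrite /z -!rnpD; congr (_ * rnp _ m); field.
    by ring.
  by rewrite ler_peMr// !mulr_ge0 ?(ltW (rnp_gt0 _ _)).
rewrite exchange_big /=.
have one c : \sum_(y.+1 <= q < M.+1 | smooth y q) (q == c)%:R <= 1 :> R.
  apply: (@le_trans _ _ (\sum_(y.+1 <= q < M.+1 | q == c) 1)).
    rewrite big_mkcond [leRHS]big_mkcond; apply: ler_sum => q _.
    by case: (q == c); case: ifP.
  by rewrite big_nat1_eq; case: ifP.
apply: (@le_trans _ _ (\sum_(1 <= m < M.+1) 2 * z m)).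
  apply: ler_sum => m _; rewrite -mulr_suml ler_wpM2r// big_split /=.
  by rewrite (_ : 2 = 1 + 1 :> R)// lerD// one.
rewrite -mulr_sumr /z -mulr_sumr.
have := @sum_rnp_le R 6^-1 M.+1 ltac:(lra); rewrite invrK => h.
rewrite mulrA; apply: le_trans (ler_wpM2l _ h) _; first by rewrite !mulr_ge0 ?(ltW (rnp_gt0 _ _)).
by move: (rnp 9^-1 y) => t; rewrite (_ : 2 * (2 * t) * (1 + 6) = 28 * t)//; ring.
Qed.

End PrimePowerTail.

Section SmoothTail.
Variable R : realType.
Variables (g : nat -> R) (y : nat).
Hypothesis gM : cmult g.
Hypothesis g1 : forall n, `|g n| <= 1.
Hypothesis gy : forall p, prime p -> (y < p)%N -> g p = 0.
Hypothesis y1 : (1 < y)%N.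
Implicit Types (n m p q M N X i k : nat).

Let y0 : (0 < y)%N. Proof. exact: ltnW. Qed.
Let F := euler (fun n => g n / n%:R) y.
Let ly : R := ln y%:R.

Lemma g_nonsmooth n : (0 < n)%N -> ~~ smooth y n -> g n = 0.
Proof.
move=> n0 /allPn[p]; rewrite mem_primes => /and3P[pp _ pn]; rewrite -ltnNge => yp.
have h1 : (0 < n %/ p)%N by rewrite divn_gt0 ?prime_gt0// dvdn_leq.
by have := gM.2 _ _ h1 (prime_gt0 pp); rewrite divnK// (gy pp yp) mulr0.
Qed.

Lemma gsum_ssum X : gsum g X = ssum (fun n => g n / n%:R) y X.
Proof.
rewrite /gsum /ssum [RHS]big_mkcond; apply: eq_big_nat => n /andP[n0 _].
by case: ifP => // /negbT sn; rewrite g_nonsmooth// mul0r.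
Qed.

Lemma gn_cmult : cmult (fun n => g n / n%:R).
Proof.
split; first by rewrite gM.1 invr1 mulr1.
by move=> m n m0 n0; rewrite gM.2// natrM invfM mulrACA.
Qed.

Lemma inv_half p : prime p -> 0 < (p%:R^-1 : R) <= 2^-1.
Proof. by move=> pp; rewrite invr_gt0 ltr0n prime_gt0//= lef_pV2 ?posrE ?ltr0n ?prime_gt0// ler_nat prime_gt1. Qed.

Lemma euler_lower : (euler (fun n => n%:R^-1 : R) y)^-1 <= F.
Proof.
rewrite /F /euler -prodfV; apply: ler_prod => p pp; rewrite invrK.
have /andP[h0 h1] := inv_half pp; have := g1 p; rewrite ler_norml => /andP[l1 l2].
set u : R := p%:R^-1 in h0 h1 *.
have a1 : - u <= g p * u by rewrite -[leLHS]mulN1r ler_wpM2r// ltW.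
have a2 : g p * u <= u by rewrite -[leRHS]mul1r ler_wpM2r// ltW.
have v0 : 0 < 1 - g p * u by lra.
apply/andP; split; first lra.
rewrite -[leRHS]mul1r ler_pdivlMr//.
have : (1 - u) * (1 - g p * u) <= (1 - u) * (1 + u) by rewrite ler_wpM2l; lra.
have : 0 <= u * u by rewrite mulr_ge0 ?(ltW h0).
lra.
Qed.

Lemma gsum_rate (C : R) i m : euler (fun n => n%:R^-1 : R) y <= C * ly -> (y ^ i <= m)%N ->
  `|F - gsum g m| <= (C * ly) ^+ 2 * (2 / 3) ^+ i.
Proof.
move=> HC im; have y0' : (0 : R) < y%:R by rewrite ltr0n.
have ly0 : 0 < ly by rewrite ln_gt0// ltr1n.
set l32 : R := ln (3 / 2); have l320 : 0 < l32 by rewrite ln_gt0//; lra.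
set b : R := l32 / ly; have b0 : 0 < b by rewrite divr_gt0.
have w1 n : (0 < n)%N -> 1 <= rnp (- b) n by rewrite rnpN invf_ge1 ?rnp_gt0 ?rnp_le1// ltW.
have wm m' n : (0 < m' <= n)%N -> rnp (- b) m' <= rnp (- b) n.
  by move=> h; rewrite !rnpN lef_pV2 ?posrE ?rnp_gt0// rnp_mono// ltW.
have wy : rnp (- b) y = 3 / 2 by rewrite /rnp opprK /b -/ly divfK ?gt_eqF// lnK// posrE; lra.
have gw p : prime p -> (p <= y)%N -> `|g p / p%:R| * rnp (- b) p <= 3 / 2 * p%:R^-1.
  move=> pp py; rewrite normrM (@ger0_norm _ (p%:R^-1)) ?invr_ge0// mulrC.
  apply: ler_pM; rewrite ?mulr_ge0 ?invr_ge0 ?(ltW (rnp_gt0 _ _))//.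
    by rewrite -wy wm// prime_gt0.
  by rewrite -[leRHS]mul1r ler_wpM2r ?invr_ge0.
have gw1 p : prime p -> (p <= y)%N -> `|g p / p%:R| * rnp (- b) p < 1.
  by move=> pp py; have := gw p pp py; have /andP[] := inv_half pp; lra.
have := @euler_sub_ssum _ (fun n => g n / n%:R) (rnp (- b)) y m gn_cmult (fun n => rnp_gt0 _ _).
move=> /(_ w1 (rnp1 _) wm (@rnpM R (- b)) gw1); rewrite -gsum_ssum -/F => H.
have E : euler (fun n => `|g n / n%:R| * rnp (- b) n) y <= (C * ly) ^+ 2.
  apply: (@le_trans _ _ (euler (fun n => n%:R^-1 : R) y ^+ 2)); last first.
    rewrite lerXn2r ?nnegrE//; first by apply/ltW/euler_gt0 => p; exact: invn_prime_lt1.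
    by apply: le_trans HC; apply/ltW/euler_gt0 => p; exact: invn_prime_lt1.
  rewrite /euler -prodrXl big_nat_cond [leRHS]big_nat_cond.
  apply: ler_prod => p /andP[/andP[_ py] pp]; rewrite ltnS in py.
  have /andP[h0 h1] := inv_half pp; have h2 := gw p pp py; set u : R := p%:R^-1 in h0 h1 h2 *.
  rewrite invr_ge0 subr_ge0 ltW ?gw1//= exprVn lef_pV2 ?posrE ?exprn_gt0 ?subr_gt0 ?gw1//; last lra.
  have : u * u <= 2^-1 * u by rewrite ler_wpM2r// ltW.
  by rewrite expr2; lra.
have wl : (3 / 2) ^+ i <= rnp (- b) m.+1.
  apply: (@le_trans _ _ (rnp (- b) (y ^ i))); last by rewrite wm// expn_gt0 y0 (leq_trans im).
  elim: i {im} => [|i IH]; first by rewrite expn0 rnp1 expr0.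
  by rewrite expnS rnpM ?expn_gt0 ?y0// wy exprS ler_wpM2l//; lra.
have p0 : (0 : R) < (3 / 2) ^+ i by rewrite exprn_gt0//; lra.
have -> : (2 / 3) ^+ i = ((3 / 2) ^+ i)^-1 :> R by rewrite -exprVn invf_div.
rewrite ler_pdivlMr//; apply: le_trans E; apply: le_trans H; rewrite ler_wpM2l//.
Qed.

Variable M : nat.
Let U X := gsum g M - gsum g X.
Definition lnw m : R := ln m.+1%:R - ln m%:R.

Lemma tail_abel N : (N <= M)%N -> \sum_(N.+1 <= n < M.+1) g n / n%:R * ln n%:R =
  U N * ln N%:R + \sum_(N <= m < M) lnw m * U m.
Proof.
move=> NM; rewrite -(subKn NM); move: (M - N)%N (leq_subr N M) => d.
elim: d => [|d IH] dM; first by rewrite subn0 !big_geq// /U subrr mul0r addr0.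
have {}IH := IH (ltnW dM); have e : (M - d = (M - d.+1).+1)%N by move: dM; clear; lia.
have h : (M - d.+1 < M)%N by move: dM; clear; lia.
move: IH; rewrite e; move: (M - d.+1)%N h => K h IH.
rewrite big_ltn//= IH [in RHS]big_ltn//.
have -> : lnw K = ln K.+1%:R - ln K%:R by [].
have -> : U K = U K.+1 + g K.+1 / K.+1%:R.
  by rewrite /U /gsum [X in _ - X + _]big_nat_recr//=; ring.
ring.
Qed.

Lemma gsum_ln X : (X <= M)%N -> \sum_(1 <= n < X.+1) g n / n%:R * ln n%:R =
  \sum_(1 <= q < M.+1) mangoldt R q * (g q / q%:R) * gsum g (X %/ q).
Proof.
move=> XM.
transitivity (\sum_(1 <= n < X.+1) \sum_(1 <= q < X.+1 | (q %| n)%N) mangoldt R q * (g q / q%:R) * (g (n %/ q)%N / (n %/ q)%:R)).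
  apply: eq_big_nat => n /andP[n0 nX].
  rewrite -(sum_mangoldt R n0) -(@sum_divisors_bound _ X) ?n0// mulr_sumr.
  rewrite big_mkcond [RHS]big_mkcond; apply: eq_big_nat => q /andP[q0 _]; case: ifP => // qn.
  have nq : (0 < n %/ q)%N by rewrite divn_gt0// dvdn_leq.
  by rewrite -[in LHS](divnK qn) mulnC gn_cmult.2//; ring.
rewrite (sum_div_pairs X (fun q e => mangoldt R q * (g q / q%:R) * (g e / e%:R))).
rewrite [RHS](@big_cat_nat _ _ _ X.+1)//= [X in _ = _ + X]big_nat_cond [X in _ = _ + X]big1 ?addr0; last first.
  by move=> q /andP[/andP[Xq _] _]; rewrite divn_small// /gsum big_geq// mulr0.
by apply: eq_bigr => q _; rewrite -mulr_sumr.
Qed.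

Lemma abs_gsum_le X : (X <= M)%N -> (0 < M)%N -> `|gsum g X| <= 1 + ln M%:R.
Proof.
move=> XM M0; apply: le_trans (harmonic_ln_le _ M0).
apply: le_trans (ler_norm_sum _ _ _) _.
apply: (@le_trans _ _ (\sum_(1 <= i < X.+1) i%:R^-1)); last exact: ler_sum_nat_subset.
apply: ler_sum => n _; rewrite normrM (@ger0_norm _ (n%:R^-1)) ?invr_ge0//.
by rewrite -[leRHS]mul1r ler_wpM2r ?invr_ge0.
Qed.

Lemma tail_ineq N (e : R) : (0 < N <= M)%N -> (y <= M)%N ->
  (forall q, (0 < q <= y)%N -> `|U (M %/ q)| <= e) ->
  `|U N| * ln N%:R <= \sum_(N <= m < M) lnw m * `|U m| +
   \sum_(1 <= q < y.+1) mangoldt R q / q%:R * `|U (N %/ q)| +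
   (56 * rnp 9^-1 y * (1 + ln M%:R) + (ly + 4) * e).
Proof.
move=> /andP[N0 NM] yM He; have M0 : (0 < M)%N by apply: leq_trans NM.
have lnw0 m : 0 <= lnw m.
  rewrite subr_ge0; case: m => [|m]; first by rewrite ln1 ln0.
  by rewrite ler_ln ?posrE ?ltr0n// ler_nat.
have -> : `|U N| * ln N%:R = `|U N * ln N%:R| by rewrite normrM (ger0_norm (ln_nat_ge0 _ _)).
have -> : U N * ln N%:R = \sum_(N.+1 <= n < M.+1) g n / n%:R * ln n%:R - \sum_(N <= m < M) lnw m * U m.
  by rewrite tail_abel// addrK.
rewrite -addrA addrC; apply: le_trans (ler_normB _ _) _; rewrite lerD//; last first.
  apply: le_trans (ler_norm_sum _ _ _) _; apply: ler_sum => m _.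
  by rewrite normrM (ger0_norm (lnw0 m)).
have -> : \sum_(N.+1 <= n < M.+1) g n / n%:R * ln n%:R =
   \sum_(1 <= q < M.+1) mangoldt R q * (g q / q%:R) * (gsum g (M %/ q) - gsum g (N %/ q)).
  have -> : \sum_(1 <= q < M.+1) mangoldt R q * (g q / q%:R) * (gsum g (M %/ q) - gsum g (N %/ q)) =
     \sum_(1 <= n < M.+1) g n / n%:R * ln n%:R - \sum_(1 <= n < N.+1) g n / n%:R * ln n%:R.
    by rewrite !gsum_ln// -sumrB; apply: eq_bigr => q _; rewrite mulrBr.
  by rewrite (@big_cat_nat _ _ _ N.+1 1 M.+1)//= addrAC subrr add0r.
rewrite (@big_cat_nat _ _ _ y.+1 1 M.+1)//=; apply: le_trans (ler_normD _ _) _.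
have A : `|\sum_(1 <= q < y.+1) mangoldt R q * (g q / q%:R) * (gsum g (M %/ q) - gsum g (N %/ q))| <=
   \sum_(1 <= q < y.+1) mangoldt R q / q%:R * `|U (N %/ q)| + (ly + 4) * e.
  apply: le_trans (ler_norm_sum _ _ _) _.
  apply: (@le_trans _ _ (\sum_(1 <= q < y.+1) (mangoldt R q / q%:R * `|U (N %/ q)| + mangoldt R q / q%:R * e))).
    rewrite big_nat [leRHS]big_nat; apply: ler_sum => q /andP[q0 qy].
    rewrite -mulrDr normrM; apply: ler_pM => //.
      rewrite normrM (ger0_norm (mangoldt_ge0 _ _)) ler_wpM2l ?mangoldt_ge0//.
      rewrite normrM (@ger0_norm _ (q%:R^-1)) ?invr_ge0//.
      by rewrite -[leRHS]mul1r ler_wpM2r ?invr_ge0.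
    have -> : gsum g (M %/ q) - gsum g (N %/ q) = U (N %/ q) - U (M %/ q) by rewrite /U; ring.
    by apply: le_trans (ler_normB _ _) _; rewrite lerD2l He// q0.
  rewrite big_split /= lerD2l -mulr_suml ler_wpM2r//; last exact: sum_mangoldt_div_le.
  by apply: le_trans (He y _) => //; rewrite y0 leqnn.
have B : `|\sum_(y.+1 <= q < M.+1) mangoldt R q * (g q / q%:R) * (gsum g (M %/ q) - gsum g (N %/ q))| <=
   56 * rnp 9^-1 y * (1 + ln M%:R).
  apply: le_trans (ler_norm_sum _ _ _) _.
  apply: (@le_trans _ _ (\sum_(y.+1 <= q < M.+1 | smooth y q) mangoldt R q / q%:R * (2 * (1 + ln M%:R)))).
    rewrite big_nat [leRHS]big_mkcond [leRHS]big_nat; apply: ler_sum => q /andP[yq qM].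
    have q0 : (0 < q)%N by apply: leq_trans yq.
    case: ifP => [_|/negbT sq]; last by rewrite g_nonsmooth// mul0r mulr0 mul0r normr0.
    rewrite normrM; apply: ler_pM => //.
      rewrite normrM (ger0_norm (mangoldt_ge0 _ _)) ler_wpM2l ?mangoldt_ge0//.
      rewrite normrM (@ger0_norm _ (q%:R^-1)) ?invr_ge0//.
      by rewrite -[leRHS]mul1r ler_wpM2r ?invr_ge0.
    apply: le_trans (ler_normB _ _) _; rewrite mulr_natl mulr2n lerD// abs_gsum_le ?leq_div//.
    by apply: leq_trans NM; rewrite leq_div.
  rewrite -mulr_suml; apply: le_trans (ler_wpM2r _ (prime_power_tail _ _ y0)) _.
    by rewrite mulr_ge0// addr_ge0 ?ln_nat_ge0.
  by rewrite le_eqVlt; apply/orP; left; apply/eqP; ring.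
by apply: le_trans (lerD A B) _; rewrite -addrA [_ * e + _]addrC.
Qed.

Lemma lnw_group (u : nat -> R) q a b : (0 < q)%N -> (0 < a <= b)%N ->
  \sum_(q * a <= m < q * b) lnw m * u (m %/ q)%N = \sum_(a <= m < b) lnw m * u m.
Proof.
move=> q0 /andP[a0 ab]; rewrite -(subnKC ab); elim: (b - a)%N => [|d IH].
  by rewrite addn0 !big_geq.
rewrite addnS [RHS]big_nat_recr ?leq_addr//= -IH.
rewrite (@big_cat_nat _ _ _ (q * (a + d)))//= ?leq_mul2l ?leq_addr ?leqnSn ?orbT//; congr (_ + _).
have -> : \sum_(q * (a + d) <= m < q * (a + d).+1) lnw m * u (m %/ q)%N =
  \sum_(q * (a + d) <= m < q * (a + d).+1) lnw m * u (a + d)%N.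
  apply: eq_big_nat => m /andP[m1 m2]; congr (_ * u _).
  apply/eqP; rewrite eqn_leq leq_divRL// [(_ * q)%N]mulnC m1 andbT -ltnS ltn_divLR//.
  by rewrite mulnC.
rewrite -mulr_suml; congr (_ * _).
rewrite /lnw telescope_sumr ?leq_mul2l ?leqnSn ?orbT//.
have ad : (0 : R) < (a + d)%:R by rewrite ltr0n addn_gt0 a0.
by rewrite !natrM !lnM ?posrE ?ltr0n ?addn_gt0 ?a0// opprD addrACA subrr add0r.
Qed.

End SmoothTail.

Section DelayRecursion.
Variable R : realType.
Implicit Types (n m p q M N X i k : nat).

(* The gain after [i] iterations of the delay inequality. *)
Definition cfac i : R := 2 ^+ i / i`!%:R.

Lemma cfac_gt0 i : 0 < cfac i.
Proof. by rewrite divr_gt0// ?exprn_gt0// ltr0n fact_gt0. Qed.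

Lemma cfacS i : i.+1%:R * cfac i.+1 = 2 * cfac i.
Proof.
rewrite /cfac factS natrM exprS.
have h1 : (i.+1%:R : R) != 0 by rewrite pnatr_eq0.
have h2 : (i`!%:R : R) != 0 by rewrite pnatr_eq0 -lt0n fact_gt0.
by move: (i.+1%:R) h1 (i`!%:R) h2 (2 ^+ i) => a ha b hb c; field; rewrite ha hb.
Qed.

Lemma lnw_ge0 m : 0 <= lnw R m.
Proof.
rewrite subr_ge0; case: m => [|m]; first by rewrite ln1 ln0.
by rewrite ler_ln ?posrE ?ltr0n// ler_nat.
Qed.

Lemma lnw_le1 m : (0 < m)%N -> lnw R m <= 1.
Proof.
move=> m0; have m0' : (0 : R) < m%:R by rewrite ltr0n.
have -> : lnw R m = ln (1 + m%:R^-1).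
  rewrite /lnw -ln_div ?posrE ?ltr0n//; congr ln.
  by rewrite -natr1 mulrDl divff ?gt_eqF// mul1r.
apply: le_trans (le_ln1Dx _) _; first by apply: (@lt_trans _ _ 0); rewrite ?invr_gt0//; lra.
by rewrite invf_le1// ler1n.
Qed.

Variables (u : nat -> R) (y v : nat) (B D tau : R).
Let ly : R := ln y%:R.
Let M := (y ^ v)%N.
Hypothesis u0 : forall N, 0 <= u N.
Hypothesis ly6 : 6 <= ly.
Hypothesis vly : v%:R <= 2 * ly.
Hypothesis tau0 : 0 <= tau.
Hypothesis HM : forall N, (0 < N <= M)%N -> u N * ln N%:R <=
  \sum_(N <= m < M) lnw R m * u m + \sum_(1 <= q < y.+1) mangoldt R q / q%:R * u (N %/ q)%N + tau.
Hypothesis HB : forall N, (y ^ 2 <= N <= M)%N -> u N <= B.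
Let J N := \sum_(N <= m < M) lnw R m * u m.
Hypothesis HD : J (y ^ 2) <= D.

Let y1 : (1 < y)%N.
Proof.
rewrite ltnNge; apply/negP => h; have : ly <= 0 by apply: ln_le0; rewrite -[1]/(1%:R) ler_nat.
by move=> h1; have := le_trans ly6 h1; rewrite -[0]/(0%:R) ler_nat.
Qed.
Let y0 : (0 < y)%N. Proof. exact: ltnW. Qed.
Let ly0 : 0 < ly. Proof. exact: lt_le_trans ly6. Qed.

Lemma delay_weights : \sum_(1 <= q < y.+1) mangoldt R q / q%:R <= 2 * ly - 2.
Proof. apply: le_trans (sum_mangoldt_div_le _ y0) _; rewrite -/ly; move: ly6; lra. Qed.

Lemma delay_lnX i : ln (y ^ i)%:R = i%:R * ly.
Proof. by rewrite natrX lnXn ?ltr0n// mulr_natl. Qed.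

Lemma delay_ge0 N : 0 <= J N.
Proof. by apply: sumr_ge0 => m _; rewrite mulr_ge0 ?lnw_ge0. Qed.

Lemma delay_mono N X : (N <= X)%N -> J X <= J N.
Proof.
move=> NX; have [XM|MX] := leqP X M; last by rewrite /J big_geq ?(ltnW MX)// delay_ge0.
rewrite /J [leRHS](@big_cat_nat _ _ _ X)//= lerDr sumr_ge0// => m _; by rewrite mulr_ge0 ?lnw_ge0.
Qed.

Lemma delay_avg N q : (0 < q <= N)%N -> (N <= M)%N ->
  \sum_(N <= m < M) lnw R m * u (m %/ q)%N <= J (N %/ q).
Proof.
move=> /andP[q0 qN] NM; have a0 : (0 < N %/ q)%N by rewrite divn_gt0.
have aM : (N %/ q <= M)%N by apply: leq_trans NM; rewrite leq_div.
rewrite /J -(@lnw_group R u q (N %/ q) M q0) ?a0//.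
rewrite [leRHS](@big_cat_nat _ _ _ N)//=; last 2 first.
- by rewrite mulnC leq_trunc_div.
- by apply: leq_trans NM _; rewrite leq_pmull.
rewrite [X in _ + X](@big_cat_nat _ _ _ M)//=; last by rewrite leq_pmull.
rewrite -[leLHS]add0r lerD//.
  by apply: sumr_ge0 => m _; rewrite mulr_ge0 ?lnw_ge0.
by rewrite lerDl sumr_ge0// => m _; rewrite mulr_ge0 ?lnw_ge0.
Qed.

Lemma delay_J i : (1 < i <= v)%N -> J (y ^ i) <= cfac i * D + 2 * i%:R * tau * ly.
Proof.
have D0 : 0 <= D by apply: le_trans HD; exact: delay_ge0.
elim: i => // i IH /andP[i2 iv].
have [i1|i1] := leqP i 1.
  have -> : i = 1%N by move: i1 i2; clear; lia.
  apply: le_trans HD _; rewrite -[leLHS]addr0 lerD// ?mulr_ge0//.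
    by rewrite ler_peMl// /cfac (_ : 2`! = 2)%N// expr2; lra.
  exact: ltW.
have {}IH := IH ltac:(by rewrite i1 ltnW).
set N := (y ^ i.+1)%N; have NM : (N <= M)%N by rewrite leq_pexp2l.
have N0 : (0 < N)%N by rewrite expn_gt0 y0.
have lnM : ln (M%:R : R) <= 2 * ly * ly by rewrite delay_lnX ler_wpM2r// ltW.
have J0 := delay_ge0 N; have J0' := delay_ge0 (y ^ i).
have key : J N * (i.+1%:R * ly - 1) <= (2 * ly - 2) * J (y ^ i) + tau * (2 * ly * ly).
  have E1 : \sum_(N <= m < M) lnw R m * u m * ln m%:R <=
    \sum_(N <= m < M) lnw R m * J m +
    \sum_(1 <= q < y.+1) mangoldt R q / q%:R * \sum_(N <= m < M) lnw R m * u (m %/ q)%N +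
    tau * \sum_(N <= m < M) lnw R m.
    have -> : \sum_(1 <= q < y.+1) mangoldt R q / q%:R * \sum_(N <= m < M) lnw R m * u (m %/ q)%N =
      \sum_(N <= m < M) lnw R m * \sum_(1 <= q < y.+1) mangoldt R q / q%:R * u (m %/ q)%N.
      under eq_bigr do rewrite mulr_sumr.
      rewrite exchange_big_nat /=; apply: eq_bigr => m _; rewrite mulr_sumr; apply: eq_bigr => q _; ring.
    rewrite mulr_sumr -!big_split /= big_nat [leRHS]big_nat; apply: ler_sum => m /andP[Nm mM].
    rewrite -mulrA [tau * _]mulrC -!mulrDr ler_wpM2l ?lnw_ge0//; apply: HM.
    by rewrite (leq_trans N0 Nm) ltnW.
  have E2 : \sum_(N <= m < M) lnw R m * J m = \sum_(N <= m < M) lnw R m * u m * (ln m.+1%:R - ln N%:R).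
    transitivity (\sum_(N <= m < M) \sum_(N <= k < M | (m <= k)%N) lnw R m * (lnw R k * u k)).
      apply: eq_big_nat => m /andP[Nm mM]; rewrite /J mulr_sumr.
      rewrite (@big_cat_nat _ _ _ m N M)//=; last exact: ltnW.
      rewrite [X in _ = X + _]big1_seq ?add0r.
        rewrite [LHS]big_nat_cond [RHS]big_nat_cond; apply: eq_bigl => k.
        by case: (m <= k)%N; rewrite ?andbT ?andbF.
      by move=> k; rewrite mem_index_iota => /andP[mk /andP[_ km]]; move: km; rewrite ltnNge mk.
    under eq_bigr do rewrite big_mkcond.
    rewrite exchange_big_nat /=; apply: eq_big_nat => k /andP[Nk kM].
    rewrite -big_mkcond -mulr_suml mulrC; congr (_ * _).
    transitivity (\sum_(N <= m < k.+1) lnw R m); last by rewrite telescope_sumr// leqW.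
    by rewrite (big_nat_widen _ _ _ _ _ kM).
  have E3 : J N * (i.+1%:R * ly - 1) <= \sum_(N <= m < M) lnw R m * u m * ln m%:R - \sum_(N <= m < M) lnw R m * J m.
    rewrite E2 -sumrB /J mulr_suml big_nat [leRHS]big_nat; apply: ler_sum => m /andP[Nm mM].
    rewrite -mulrBr ler_wpM2l ?mulr_ge0 ?lnw_ge0// -delay_lnX -/N.
    have := @lnw_le1 m (leq_trans N0 Nm); rewrite /lnw; lra.
  apply: le_trans E3 _; rewrite lerBlDl; apply: le_trans E1 _; rewrite -addrA lerD2l lerD//.
    apply: (@le_trans _ _ (\sum_(1 <= q < y.+1) mangoldt R q / q%:R * J (y ^ i))); last first.
      by rewrite -mulr_suml ler_wpM2r// delay_weights.
    rewrite big_nat [leRHS]big_nat; apply: ler_sum => q /andP[q0 qy]; rewrite ltnS in qy.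
    rewrite ler_wpM2l ?mulr_ge0 ?mangoldt_ge0 ?invr_ge0//.
    have yN : (y <= N)%N by rewrite -{1}(expn1 y) leq_pexp2l.
    apply: le_trans (delay_avg _ NM) _; first by rewrite q0 (leq_trans qy).
    by apply: delay_mono; rewrite leq_divRL// /N expnSr leq_mul2l qy orbT.
  rewrite ler_wpM2l// telescope_sumr//; apply: le_trans lnM; rewrite gerBl.
  exact: ln_nat_ge0.
have I3 : 3 <= i.+1%:R :> R by rewrite ler_nat.
have cS := cfacS i; have c0 := cfac_gt0 i.+1.
have iE : i%:R = i.+1%:R - 1 :> R by rewrite -natr1 addrK.
rewrite iE in IH; set I : R := i.+1%:R in I3 key cS IH *.
have cE : cfac i = I * cfac i.+1 / 2 by rewrite cS; field.
rewrite cE in IH; set c := cfac i.+1 in c0 IH *.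
have Il : 0 < I * ly - 1.
  have h : 3 * 6 <= I * ly by apply: ler_pM.
  by move: h; lra.
have l2 : 0 <= 2 * ly - 2 by move: ly6; lra.
rewrite -(ler_pM2r Il); apply: le_trans key _.
have h1 := ler_wpM2l l2 IH.
apply: le_trans (lerD h1 (lexx _)) _; rewrite -subr_ge0.
have -> : (c * D + 2 * I * tau * ly) * (I * ly - 1) -
  ((2 * ly - 2) * (I * c / 2 * D + 2 * (I - 1) * tau * ly) + tau * (2 * ly * ly)) =
  (I - 1) * (c * D) + tau * ly * (2 * ly * (I - 1) ^+ 2) + tau * ly * (2 * I - 4) by field.
have c0' := ltW c0; have l0' := ltW ly0.
have I1 : 0 <= I - 1 by lra.
have I4 : 0 <= 2 * I - 4 by lra.
apply: addr_ge0; [apply: addr_ge0|].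
- exact: mulr_ge0 I1 (mulr_ge0 c0' D0).
- by rewrite mulr_ge0 ?mulr_ge0 ?sqr_ge0.
- by rewrite mulr_ge0 ?mulr_ge0.
Qed.

Lemma delay_U i : (1 < i <= v)%N -> forall N, (y ^ i <= N <= M)%N ->
  u N <= cfac i * (B + i%:R * (D / ly)) + 3 * i%:R * tau.
Proof.
have D0 : 0 <= D by apply: le_trans HD; exact: delay_ge0.
have d0 : 0 <= D / ly by rewrite divr_ge0// ltW.
elim: i => // i IH /andP[i2 iv] N /andP[iN NM].
have v2 : (2 <= v)%N by apply: leq_trans iv.
have B0 : 0 <= B by apply: le_trans (u0 M) (HB _); rewrite leqnn andbT leq_pexp2l.
have [i1|i1] := leqP i 1.
  have iE : i = 1%N by move: i1 i2; clear; lia.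
  rewrite iE in iN *; apply: le_trans (HB _) _; first by rewrite iN.
  rewrite -[leLHS]addr0 lerD// ?mulr_ge0// /cfac (_ : 2`! = 2)%N// expr2 mulfK ?pnatr_eq0//.
  by have := mulr_ge0 (ler0n R 2) d0; lra.
have {}IH := IH ltac:(by rewrite i1 ltnW).
have N0 : (0 < N)%N by apply: leq_trans iN; rewrite expn_gt0 y0.
have I3 : 3 <= i.+1%:R :> R by rewrite ler_nat.
have cS := cfacS i; have c0 := cfac_gt0 i.+1.
have iE : i%:R = i.+1%:R - 1 :> R by rewrite -natr1 addrK.
have DE : D = D / ly * ly by rewrite divfK ?gt_eqF.
have JN : J N <= cfac i.+1 * D + 2 * i.+1%:R * tau * ly.
  by apply: le_trans (delay_mono iN) _; apply: delay_J; rewrite i2 iv.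
have lN : i.+1%:R * ly <= ln N%:R.
  by rewrite -delay_lnX ler_ln ?posrE ?ltr0n ?expn_gt0 ?y0// ler_nat.
set A := cfac i * (B + i%:R * (D / ly)) + 3 * i%:R * tau in IH.
have A0 : 0 <= A.
  apply: le_trans (u0 M) (IH _ _); rewrite leqnn andbT leq_pexp2l//; exact: ltnW.
have key : u N * (i.+1%:R * ly) <= cfac i.+1 * D + 2 * i.+1%:R * tau * ly + (2 * ly - 2) * A + tau.
  apply: le_trans (ler_wpM2l (u0 N) lN) _; apply: le_trans (HM _) _; first by rewrite N0.
  rewrite lerD2r lerD//.
  apply: (@le_trans _ _ (\sum_(1 <= q < y.+1) mangoldt R q / q%:R * A)); last first.
    by rewrite -mulr_suml ler_wpM2r// delay_weights.
  rewrite big_nat [leRHS]big_nat; apply: ler_sum => q /andP[q0 qy]; rewrite ltnS in qy.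
  rewrite ler_wpM2l ?mulr_ge0 ?mangoldt_ge0 ?invr_ge0//; apply: IH.
  rewrite (leq_trans (leq_div _ _) NM) andbT leq_divRL//; apply: leq_trans iN.
  by rewrite expnSr leq_mul2l qy orbT.
rewrite /A iE {1}DE in key; set I : R := i.+1%:R in I3 key cS *.
have cE : cfac i = I * cfac i.+1 / 2 by rewrite cS; field.
rewrite cE in key; set c := cfac i.+1 in c0 key *; set d := D / ly in d0 key *.
have Il : 0 < I * ly by rewrite mulr_gt0//; lra.
rewrite -(ler_pM2r Il); apply: le_trans key _; rewrite -subr_ge0.
have -> : (c * (B + I * d) + 3 * I * tau) * (I * ly) -
  (c * (d * ly) + 2 * I * tau * ly +
  (2 * ly - 2) * (I * c / 2 * (B + (I - 1) * d) + 3 * (I - 1) * tau) + tau) =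
  I * c * B + c * d * ly * (I - 1) + I * c * (I - 1) * d +
  tau * (ly * (3 * (I - 3) ^+ 2 + 10 * (I - 3) + 9) + (6 * I - 7)) by field.
have I1 : 0 <= I - 1 by lra.
have I0 : 0 <= I by lra.
have I33 : 0 <= I - 3 by lra.
have I6 : 0 <= 6 * I - 7 by lra.
have c0' := ltW c0; have l0' := ltW ly0.
apply: addr_ge0; [apply: addr_ge0; [apply: addr_ge0|]|].
- exact: mulr_ge0 (mulr_ge0 I0 c0') B0.
- exact: mulr_ge0 (mulr_ge0 (mulr_ge0 c0' d0) l0') I1.
- exact: mulr_ge0 (mulr_ge0 (mulr_ge0 I0 c0') I1) d0.
apply: mulr_ge0 => //; apply: addr_ge0 => //; apply: mulr_ge0 => //; apply: addr_ge0 => //.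
by apply: addr_ge0; rewrite mulr_ge0 ?sqr_ge0.
Qed.

End DelayRecursion.

Section SmoothLower.
Variable R : realType.
Implicit Types (g : nat -> R) (n m p q y M N X i k : nat).

Lemma sum_window_le (w : nat -> R) a M Z : (forall m, 0 <= w m) ->
  \sum_(a <= m < M | (m < Z)%N) w m <= \sum_(0 <= m < Z) w m.
Proof.
move=> w0; have w1 m : 0 <= (if (m < Z)%N then w m else 0) by case: ifP.
rewrite (big_nat_widen _ _ _ _ _ (leq_addr (a + M) Z)) big_mkcond [leRHS]big_mkcond.
have aM : (a <= Z + (a + M))%N by clear; lia.
apply: (@le_trans _ _ (\sum_(a <= m < Z + (a + M)) (if (m < Z)%N then w m else 0))).
  by apply: ler_sum_nat_subset => //; clear; lia.
rewrite [leRHS](@big_cat_nat _ _ _ a)//= lerDr sumr_ge0//.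
Qed.

Lemma two_thirds_pow i : (2 / 3) ^+ i <= expR (- (i%:R / 3)) :> R.
Proof.
have -> : - (i%:R / 3) = i%:R * (- 3^-1) :> R by rewrite mulrN.
rewrite expRM_natl lerXn2r ?nnegrE ?expR_ge0//.
by apply: le_trans (expR_ge1Dx _); lra.
Qed.

Lemma gsum_lower : exists (C : R) (y0 : nat), 0 < C /\
  forall g y i k N, cmult g -> (forall n, `|g n| <= 1) ->
    (forall p, prime p -> (y < p)%N -> g p = 0) -> (y0 <= y)%N -> (1 < i)%N ->
    i%:R <= ln (y%:R : R) -> k%:R <= ln (y%:R : R) -> C * i%:R * ln (ln y%:R) * cfac R i <= 1 ->
    (y ^ i <= N <= y ^ k)%N -> (C * ln y%:R)^-1 <= gsum g N.
Proof.
have [C1 C10 H1] := euler_nat_le R; have [C C0 HC] := gsum_bound R.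
set K1 : R := 24 * C1 * (56 + 8 * C1 ^+ 2).
have K10 : 0 < K1 by rewrite !mulr_gt0// addr_gt0// mulr_gt0// exprn_gt0.
have [u0 u01 Hu] := @ln_pow_le R (K1 * 9 ^+ 5) 5 (mulr_ge0 (ltW K10) (exprn_ge0 _ (ler0n _ _))).
set K2 : R := 32 * C + 4 * C1 ^+ 3.
have C13 : 0 < C1 ^+ 3 by rewrite exprn_gt0.
set C' : R := 4 * (2 * C + K2) + 2 * C1 + 1.
have C'0 : 0 < C' by rewrite /C' /K2; lra.
exists C', (Num.truncn (expR (6 + 9 * ln u0))).+2; split=> //.
move=> g y i k N gM g1 gy hy i2 ily kly ci /andP[iN Nk].
have y1 : (1 < y)%N by apply: leq_trans hy.
have y0 : (0 < y)%N by exact: ltnW.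
have y0' : (0 : R) < y%:R by rewrite ltr0n.
set ly : R := ln y%:R in ily kly ci *.
have hly : 6 + 9 * ln u0 <= ly.
  rewrite -[leLHS]expRK ler_ln ?posrE ?expR_gt0//; apply: ltW; apply: lt_le_trans (truncnS_gt _) _.
  by rewrite ler_nat; apply: ltnW.
have lu0 := ln_ge0 u01; have ly6 : 6 <= ly by lra.
have ly0 : 0 < ly by lra.
set F := euler (fun n => g n / n%:R) y.
have F0 : 0 < F by apply: euler_gt0 => p pp; exact: gn_prime_lt1.
have HE : euler (fun n => n%:R^-1 : R) y <= C1 * ly by exact: H1.
have E0 : 0 < euler (fun n => n%:R^-1 : R) y by apply: euler_gt0 => p pp; exact: invn_prime_lt1.
have Flow : (C1 * ly)^-1 <= F.
  by apply: le_trans (euler_lower y g1); rewrite lef_pV2 ?posrE// mulr_gt0.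
set ep : R := rnp 9^-1 y; have ep0 : 0 < ep by exact: rnp_gt0.
have T : K1 * ly ^+ 5 * ep <= 1.
  have h : u0 <= expR (ly / 9).
    by rewrite -[leLHS]lnK ?posrE ?ler_expR; move: u01 lu0 hly; clear; lra.
  have := Hu _ h; rewrite expRK => h1.
  rewrite /ep /rnp -/ly mulNr expRN mulrC ler_pdivrMl ?expR_gt0// mulr1 [9^-1 * ly]mulrC.
  apply: le_trans h1; rewrite -mulrA -exprMn ler_wpM2l ?(ltW K10)// lerXn2r ?nnegrE ?(ltW ly0)//; move: ly0; clear; lra.
have lyX m n : (m <= n)%N -> ly ^+ m <= ly ^+ n by move=> mn; rewrite ler_weXn2l//; move: ly6; clear; lra.
have t23 j : ly / 9 <= j%:R / 3 -> (2 / 3) ^+ j <= ep.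
  move=> h; apply: le_trans (two_thirds_pow j) _; rewrite /ep /rnp -/ly ler_expR; move: h; clear; lra.
set v := (Num.truncn ly).+1; set M := (y ^ v)%N.
have /andP[v1 v2] := truncn_itv (ltW ly0).
have vE : v%:R = (Num.truncn ly)%:R + 1 :> R by rewrite /v -natr1.
rewrite -/v in v2; have v2l : v%:R <= 2 * ly by move: v1 vE ly6; clear; lra.
have lt_v j : j%:R <= ly -> (j < v)%N by move=> h; rewrite -(ltr_nat R); move: h v2; clear; lra.
have kv := lt_v _ kly; have iv := lt_v _ ily.
have v3 : (2 <= v)%N by apply: leq_trans (ltnW iv).
have yX a b : (a <= b)%N -> (y ^ a <= y ^ b)%N by move=> ab; rewrite leq_pexp2l.
have NM : (N <= M)%N by apply: leq_trans Nk _; apply: yX; exact: ltnW.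
have yM : (y <= M)%N by rewrite -{1}(expn1 y) yX.
have M0 : (0 < M)%N by exact: leq_trans yM.
have lnM : ln (M%:R : R) <= 2 * ly ^+ 2.
  rewrite /M natrX lnXn// -[_ *+ v]mulr_natl expr2 mulrA -/ly ler_wpM2r// ltW//.
have rate j m : (y ^ j <= m)%N -> `|F - gsum g m| <= (C1 * ly) ^+ 2 * (2 / 3) ^+ j.
  exact: (gsum_rate gM g1 gy y1 HE).
have cl0 : 0 <= (C1 * ly) ^+ 2 by rewrite sqr_ge0.
pose U X := gsum g M - gsum g X.
have dist j m : (y ^ j <= m <= M)%N -> `|U m| <= 2 * (C1 * ly) ^+ 2 * (2 / 3) ^+ j.
  move=> /andP[jm mM]; have -> : U m = (F - gsum g m) - (F - gsum g M) by rewrite /U; ring.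
  apply: le_trans (ler_normB _ _) _; have := rate j m jm; have := rate j M (leq_trans jm mM).
  by clear; lra.
set e : R := 2 * (C1 * ly) ^+ 2 * ep.
have ep0' := ltW ep0; have ly0' := ltW ly0; have C10' := ltW C10; have F0' := ltW F0.
have e0 : 0 <= e by exact: mulr_ge0 (mulr_ge0 (ler0n _ 2) cl0) ep0'.
have He q : (0 < q <= y)%N -> `|U (M %/ q)%N| <= e.
  move=> /andP[q0 qy]; apply: le_trans (dist (Num.truncn ly) _ _) _.
    by rewrite leq_div andbT leq_divRL// /M /v expnSr leq_mul2l qy orbT.
  by rewrite ler_wpM2l ?mulr_ge0// t23//; move: v2 vE ly6; clear; lra.
set tau : R := 56 * ep * (1 + ln M%:R) + (ly + 4) * e.
have tau0 : 0 <= tau.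
  apply: addr_ge0; first by apply: mulr_ge0 (mulr_ge0 (ler0n _ 56) ep0') _; rewrite addr_ge0 ?ln_nat_ge0.
  by apply: mulr_ge0 e0; rewrite addr_ge0.
have tle : tau <= (56 + 8 * C1 ^+ 2) * (ly ^+ 3 * ep).
  have l3 : 6 * ly ^+ 2 <= ly ^+ 3 by rewrite [leRHS]exprS ler_wpM2r ?sqr_ge0.
  have l2 : 6 * 6 <= ly ^+ 2 by rewrite expr2 ler_pM.
  have a1 : 56 * ep * (1 + ln M%:R) <= 56 * ep * ly ^+ 3.
    by rewrite (ler_wpM2l (mulr_ge0 (ler0n _ 56) ep0'))//; move: lnM l3 l2; clear; lra.
  have a2 : (ly + 4) * e <= 2 * ly * e by rewrite ler_wpM2r//; move: ly6; clear; lra.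
  have a3 : 2 * ly * e = 4 * C1 ^+ 2 * (ly ^+ 3 * ep) by rewrite /e; ring.
  have a4 : 0 <= C1 ^+ 2 * (ly ^+ 3 * ep) by apply: mulr_ge0 (sqr_ge0 _) (mulr_ge0 (exprn_ge0 _ ly0') ep0').
  by rewrite /tau; move: a1 a2 a3 a4; clear; lra.
have tauF : 3 * i%:R * tau <= F / 8.
  have h1 : 3 * i%:R * tau <= 3 * ly * ((56 + 8 * C1 ^+ 2) * (ly ^+ 3 * ep)).
    by apply: ler_pM => //; rewrite ?mulr_ge0// ler_pM2l.
  apply: le_trans h1 _; rewrite ler_pdivlMr//.
  have -> : 3 * ly * ((56 + 8 * C1 ^+ 2) * (ly ^+ 3 * ep)) * 8 = (K1 * ly ^+ 5 * ep) / (C1 * ly).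
    by rewrite /K1; field; rewrite !gt_eqF.
  apply: le_trans Flow; rewrite -[leRHS]mul1r ler_wpM2r// invr_ge0 mulr_ge0// ltW//.
have rateM : `|F - gsum g M| <= F / 8.
  apply: le_trans (rate v M (leqnn _)) _.
  have h1 : (2 / 3) ^+ v <= ep by apply: t23; move: v2 ly0; clear; lra.
  apply: le_trans (ler_wpM2l cl0 h1) _; rewrite ler_pdivlMr//.
  apply: le_trans Flow; rewrite -[leRHS]mul1r ler_pdivlMr ?mulr_gt0//.
  apply: le_trans T.
  have -> : (C1 * ly) ^+ 2 * ep * 8 * (C1 * ly) = 8 * C1 ^+ 3 * ly ^+ 3 * ep by ring.
  rewrite ler_wpM2r ?(ltW ep0)//; apply: ler_pM; rewrite ?mulr_ge0 ?exprn_ge0 ?(ltW C10) ?(ltW ly0)//.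
    have -> : K1 = 24 * 56 * C1 + 192 * C1 ^+ 3 by rewrite /K1; ring.
    by move: C13 C10'; clear; lra.
  exact: lyX.
set L := ln ly; have L1 : 1 <= L.
  apply: (@le_trans _ _ (ln (2 ^+ 2))); last by rewrite ler_ln ?posrE ?exprn_gt0// expr2; move: ly6; clear; lra.
  by rewrite lnXn// -[_ *+ 2]mulr_natl; have := @ln2_ge R; clear; lra.
have L0 : 0 <= 15 * L by move: L1; clear; lra.
set i0 := (Num.truncn (15 * L)).+1.
have /andP[i01 i02] := truncn_itv L0; rewrite -/i0 in i02.
have i03 : i0%:R <= 16 * L by rewrite /i0 -natr1; move: i01 L1; clear; lra.
have t23' : (2 / 3) ^+ i0 <= ly ^- 5.
  apply: le_trans (two_thirds_pow i0) _; rewrite -(lnK ly0) -expRM_natl -expRN ler_expR -/L; move: i02; clear; lra.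
set B := 2 * (C * F).
have HB X : (y ^ 2 <= X <= M)%N -> `|U X| <= B.
  move=> /andP[yX2 XM]; apply: le_trans (ler_normB _ _) _; rewrite /B mulr_natl mulr2n lerD//.
    by apply: HC => //; exact: leq_trans yX2 XM.
  exact: HC.
have B0 : 0 <= B by rewrite !mulr_ge0// ltW.
set D := K2 * F * L * ly.
have HD : \sum_(y ^ 2 <= m < M) lnw R m * `|U m| <= D.
  set ee : R := 2 * (C1 * ly) ^+ 2 * (2 / 3) ^+ i0.
  have ee0 : 0 <= ee by rewrite mulr_ge0 ?mulr_ge0// exprn_ge0//; lra.
  apply: (@le_trans _ _ (\sum_(y ^ 2 <= m < M) ((if (m < y ^ i0)%N then lnw R m else 0) * B + lnw R m * ee))).
    rewrite big_nat [leRHS]big_nat; apply: ler_sum => m /andP[m1 m2].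
    case: ltnP => h.
      rewrite -[leLHS]addr0 lerD ?mulr_ge0 ?lnw_ge0// ler_wpM2l ?lnw_ge0// HB// m1 ltnW//.
    by rewrite mul0r add0r ler_wpM2l ?lnw_ge0// dist// h ltnW.
  rewrite big_split /= -!mulr_suml -big_mkcond /=.
  have s1 : \sum_(y ^ 2 <= m < M | (m < y ^ i0)%N) lnw R m <= 16 * L * ly.
    apply: le_trans (sum_window_le _ _ _ (@lnw_ge0 R)) _.
    rewrite telescope_sumr// [ln 0%:R]ln0// subr0 natrX lnXn// -[_ *+ i0]mulr_natl -/ly; exact: ler_wpM2r.
  have s2 : \sum_(y ^ 2 <= m < M) lnw R m <= 2 * ly ^+ 2.
    rewrite telescope_sumr; last exact: yX.
    by apply: le_trans lnM; rewrite gerBl ln_nat_ge0.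
  apply: le_trans (lerD (ler_wpM2r B0 s1) (ler_wpM2r ee0 s2)) _.
  have s3 : 2 * ly ^+ 2 * ee <= 4 * C1 ^+ 2 / ly.
    have -> : 4 * C1 ^+ 2 / ly = 4 * C1 ^+ 2 * ly ^+ 4 * ly ^- 5 by field; rewrite gt_eqF.
    have -> : 2 * ly ^+ 2 * ee = 4 * C1 ^+ 2 * ly ^+ 4 * (2 / 3) ^+ i0 by rewrite /ee; move: ((2 / 3) ^+ i0) => z; ring.
    by rewrite ler_wpM2l// !mulr_ge0 ?exprn_ge0 ?(ltW C10) ?(ltW ly0).
  have s4 : 4 * C1 ^+ 2 / ly <= 4 * C1 ^+ 3 * F.
    have -> : 4 * C1 ^+ 2 / ly = 4 * C1 ^+ 3 * (C1 * ly)^-1 by field; rewrite !gt_eqF.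
    by rewrite ler_wpM2l// mulr_ge0// exprn_ge0 ?(ltW C10).
  have s5 : 4 * C1 ^+ 3 * F <= 4 * C1 ^+ 3 * F * (L * ly).
    have ly1 : 1 <= ly by move: ly6; clear; lra.
    have Lly : 1 <= L * ly by rewrite -[leLHS]mulr1; apply: ler_pM.
    by rewrite ler_peMr//; exact: mulr_ge0 (mulr_ge0 (ler0n _ 4) (exprn_ge0 _ C10')) F0'.
  have -> : D = 16 * L * ly * B + 4 * C1 ^+ 3 * F * (L * ly) by rewrite /D /K2 /B; ring.
  by rewrite lerD2l; apply: le_trans s3 (le_trans s4 s5).
have HM X : (0 < X <= M)%N -> `|U X| * ln X%:R <=
  \sum_(X <= m < M) lnw R m * `|U m| + \sum_(1 <= q < y.+1) mangoldt R q / q%:R * `|U (X %/ q)%N| + tau.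
  by move=> hX; exact: (tail_ineq gM g1 gy y1 hX yM He).
have := @delay_U R (fun X => `|U X|) y v B D tau (fun _ => normr_ge0 _) ly6 v2l tau0 HM HB HD i _ N _.
rewrite i2 (ltnW iv) iN NM => /(_ isT isT).
have -> : D / ln y%:R = K2 * F * L by rewrite /D mulfK ?gt_eqF.
move=> HU.
have c0 := cfac_gt0 R i.
have fin : cfac R i * (B + i%:R * (K2 * F * L)) <= F / 4.
  have i1 : 1 <= i%:R :> R by rewrite ler1n ltnW.
  have iL : 1 <= i%:R * L by rewrite -[leLHS]mulr1 ler_pM.
  have h1 : B + i%:R * (K2 * F * L) <= (2 * C + K2) * F * (i%:R * L).
    have : B <= B * (i%:R * L) by rewrite ler_peMr.
    by rewrite /B; move=> h; rewrite (_ : (2 * C + K2) * F * (i%:R * L) = 2 * (C * F) * (i%:R * L) + i%:R * (K2 * F * L)) ?lerD2r//; ring.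
  apply: le_trans (ler_wpM2l (ltW c0) h1) _.
  have h2 : 4 * (2 * C + K2) * i%:R * L * cfac R i <= 1.
    rewrite -/L in ci; have q0 : 0 <= i%:R * L * cfac R i by exact: mulr_ge0 (le_trans ler01 iL) (ltW c0).
    have cC : 4 * (2 * C + K2) <= C' by rewrite /C'; move: C10'; clear; lra.
    have ci' : C' * (i%:R * L * cfac R i) <= 1 by rewrite (mulrA C') (mulrA C').
    have -> : 4 * (2 * C + K2) * i%:R * L * cfac R i = 4 * (2 * C + K2) * (i%:R * L * cfac R i).
      by move: (cfac R i) (i%:R) => a b; ring.
    exact: le_trans (ler_wpM2r q0 cC) ci'.
  have -> : cfac R i * ((2 * C + K2) * F * (i%:R * L)) = 4 * (2 * C + K2) * i%:R * L * cfac R i * F / 4.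
    by move: (cfac R i) (i%:R) => a b; field.
  by rewrite ler_pM2r//; have := ler_wpM2r F0' h2; rewrite mul1r.
have SN : F / 2 <= gsum g N.
  have -> : gsum g N = F - (F - gsum g M) - U N by rewrite /U; ring.
  have := ler_norm (F - gsum g M); have := ler_norm (U N); move: HU fin tauF rateM; clear; lra.
apply: le_trans SN; rewrite ler_pdivlMr//; apply: le_trans Flow.
rewrite -[2]invrK -invfM lef_pV2 ?posrE ?mulr_gt0 ?invr_gt0//.
rewrite mulrAC ler_wpM2r// /C' /K2; move: C10' C13 C0; clear; lra.
Qed.

End SmoothLower.

(** * Random signs *)

Section SignAverages.
Variable R : realType.
Implicit Types (g h : nat -> R) (p q n m X y : nat) (s : seq nat).

Definition cmext g n : R := \prod_(1 <= p < n.+1 | prime p) g p ^+ logn p n.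

Lemma cmext_bound g n B : (0 < n)%N -> (n <= B)%N ->
  cmext g n = \prod_(1 <= p < B.+1 | prime p) g p ^+ logn p n.
Proof.
move=> n0 nB; rewrite /cmext [RHS](@big_cat_nat _ _ _ n.+1)//= [X in _ * X]big1_seq ?mulr1// => p.
by rewrite mem_index_iota => /andP[pp /andP[np _]]; rewrite ltn_log0.
Qed.

Lemma cmext_cmult g : cmult (cmext g).
Proof.
split; first by rewrite /cmext big_mkcond big_nat1.
move=> m n m0 n0; have mn0 : (0 < m * n)%N by rewrite muln_gt0 m0.
rewrite (@cmext_bound g (m * n) _ mn0 (leqnn _)) (@cmext_bound g m (m * n))// ?leq_pmulr//.
rewrite (@cmext_bound g n (m * n))// ?leq_pmull// -big_split /=.
by apply: eq_bigr => p pp; rewrite lognM// exprD.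
Qed.

Lemma cmext_prime g p : prime p -> cmext g p = g p.
Proof.
move=> pp; have p0 := prime_gt0 pp; rewrite /cmext big_mkcond (bigD1_seq p) ?mem_index_iota ?iota_uniq ?p0 ?ltnSn//=.
rewrite pp logn_prime// eqxx expr1 big1 ?mulr1// => q qp; case: ifP => // qq.
by rewrite logn_prime// (negbTE qp) expr0.
Qed.

Lemma cmext_le1 g n : (forall p, `|g p| <= 1) -> `|cmext g n| <= 1.
Proof.
move=> g1; rewrite normr_prod.
apply: (@le_trans _ _ (\prod_(1 <= p < n.+1 | prime p) 1)); last by rewrite big1.
apply: ler_prod => p _; by rewrite normr_ge0 normrX exprn_ile1.
Qed.

Lemma eq_cmext g h n : (0 < n)%N -> (forall p, prime p -> (p %| n)%N -> g p = h p) -> cmext g n = cmext h n.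
Proof.
move=> n0 gh; apply: eq_bigr => p pp; have [d|d] := boolP (p %| n)%N; first by rewrite gh.
have -> : logn p n = 0%N by apply/eqP; rewrite -leqn0 leqNgt logn_gt0 mem_primes pp n0.
by rewrite !expr0.
Qed.

Lemma cmult_eq_primes (a b : nat -> R) X : cmult a -> cmult b ->
  (forall p, prime p -> (p <= X)%N -> a p = b p) -> forall n, (0 < n <= X)%N -> a n = b n.
Proof.
move=> aM bM ab; elim/ltn_ind => n IH /andP[n0 nX].
have [n1|n1] := leqP n 1.
  have -> : n = 1%N by move: n0 n1; clear; lia.
  by rewrite aM.1 bM.1.
have pp := pdiv_prime n1; have pn := pdiv_dvd n; set p := pdiv n in pp pn.
have p0 := prime_gt0 pp; have d0 : (0 < n %/ p)%N by rewrite divn_gt0// dvdn_leq.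
have dn : (n %/ p < n)%N by rewrite ltn_Pdiv// prime_gt1.
have := aM.2 _ _ d0 p0; have := bM.2 _ _ d0 p0; rewrite divnK// => -> ->.
rewrite IH// ?d0 ?(leq_trans (ltnW dn) nX)// ab//.
by apply: leq_trans nX; rewrite dvdn_leq.
Qed.

Definition upd g p (c : R) n : R := if n == p then c else g n.

Fixpoint Ex s (Phi : (nat -> R) -> R) g : R :=
  if s is p :: s' then (Ex s' Phi (upd g p 1) + Ex s' Phi (upd g p (-1))) / 2 else Phi g.

Lemma Ex_cat s1 s2 Phi g : Ex (s1 ++ s2) Phi g = Ex s1 (Ex s2 Phi) g.
Proof. by elim: s1 g => //= p s1 IH g; rewrite !IH. Qed.

Lemma Ex_le s Phi Psi g : uniq s ->
  (forall h, (forall n, n \in s -> `|h n| = 1) -> (forall n, n \notin s -> h n = g n) -> Phi h <= Psi h) ->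
  Ex s Phi g <= Ex s Psi g.
Proof.
elim: s g => [|p s IH] g /=; first by move=> _; apply.
move=> /andP[ps us] H; rewrite ler_pM2r//; apply: lerD; apply: IH => // h h1 h2; apply: H => n.
- rewrite inE => /orP[/eqP ->|/h1//]; by rewrite h2// /upd eqxx normr1.
- by rewrite inE negb_or => /andP[np ns]; rewrite h2// /upd (negbTE np).
- rewrite inE => /orP[/eqP ->|/h1//]; by rewrite h2// /upd eqxx normrN normr1.
- by rewrite inE negb_or => /andP[np ns]; rewrite h2// /upd (negbTE np).
Qed.

Lemma Ex_const s (c : R) g : Ex s (fun=> c) g = c.
Proof. by elim: s g => //= p s IH g; rewrite !IH; field. Qed.

Lemma Ex_mull s (c : R) Phi g : Ex s (fun h => c * Phi h) g = c * Ex s Phi g.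
Proof. by elim: s g => //= p s IH g; rewrite !IH; field. Qed.

Lemma cosh_le (x : R) : `|x| <= 2^-1 -> (expR x + expR (- x)) / 2 <= expR (2 * x ^+ 2).
Proof.
have main (t : R) : 0 <= t -> t <= 2^-1 -> (expR t + expR (- t)) / 2 <= expR (2 * t ^+ 2).
  move=> t0 t1; have /andP[h1 h2] := expRN_bounds t0.
  have e1 : expR t * expR (- t) = 1 by rewrite -expRD subrr expR0.
  have h3 : expR t * (1 - t) <= 1 by rewrite -e1 ler_wpM2l ?expR_ge0//; lra.
  have h4 : 1 <= (1 + t + 2 * t ^+ 2) * (1 - t).
    have -> : (1 + t + 2 * t ^+ 2) * (1 - t) = 1 + t ^+ 2 * (1 - 2 * t) by ring.
    by rewrite lerDl mulr_ge0 ?sqr_ge0//; lra.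
  have h5 : expR t <= 1 + t + 2 * t ^+ 2.
    by rewrite -(@ler_pM2r _ (1 - t)); [exact: le_trans h3 h4|lra].
  apply: le_trans (expR_ge1Dx _); have := sqr_ge0 t; lra.
move=> x1; have [x0|x0] := leP 0 x; first by apply: main => //; move: x1; rewrite (ger0_norm x0).
have := main (- x); rewrite opprK sqrrN addrC; apply; first by rewrite oppr_ge0 ltW.
by rewrite -(ltr0_norm x0).
Qed.

Variable X : nat.
Let L : R := 1 + ln X%:R.
Definition an g n : R := cmext g n / n%:R.
(* The terms whose largest prime factor is [p], to the first power only, so that
   the sign at [p] factors out. *)
Definition mdiff g p : R := an g p * ssum (an g) p.-1 (X %/ p).

Lemma an_cmult g : cmult (an g).
Proof. exact: gn_cmult (cmext_cmult g). Qed.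

Lemma an_le g n : (forall p, `|g p| <= 1) -> `|an g n| <= n%:R^-1.
Proof.
move=> g1; rewrite normrM (@ger0_norm _ (n%:R^-1)) ?invr_ge0//.
by rewrite -[leRHS]mul1r ler_wpM2r ?invr_ge0// cmext_le1.
Qed.

Lemma ssum_an_le g q m : (0 < X)%N -> (m <= X)%N -> (forall p, `|g p| <= 1) -> `|ssum (an g) q m| <= L.
Proof.
move=> X0 mX g1; apply: le_trans (harmonic_ln_le _ X0); rewrite /ssum.
apply: le_trans (ler_norm_sum _ _ _) _.
apply: (@le_trans _ _ (\sum_(1 <= i < m.+1) i%:R^-1)); last exact: ler_sum_nat_subset.
rewrite big_mkcond; apply: ler_sum => n _; case: ifP => _; last by rewrite invr_ge0.
exact: an_le.
Qed.

Lemma eq_ssum_an g h q m : (forall p, prime p -> (p <= q)%N -> g p = h p) -> ssum (an g) q m = ssum (an h) q m.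
Proof.
move=> gh; rewrite /ssum big_mkcond [RHS]big_mkcond; apply: eq_big_nat => n /andP[n0 _].
case: ifP => // /allP sn; rewrite /an; congr (_ / _); apply: eq_cmext => // p pp pn.
by apply: gh => //; apply: sn; rewrite mem_primes pp n0.
Qed.

Lemma azuma s (theta : R) g : (0 < X)%N -> (forall p, `|g p| <= 1) -> path.sorted ltn s -> all prime s ->
  0 <= theta -> (forall p, p \in s -> theta * (L / p%:R) <= 2^-1) ->
  Ex s (fun h => expR (- theta * \sum_(q <- s) mdiff h q)) g <=
  expR (2 * theta ^+ 2 * L ^+ 2 * \sum_(q <- s) (q%:R ^+ 2)^-1).
Proof.
move=> X0; elim: s g => [|p s IH] g g1 /=.
  by move=> *; rewrite !big_nil !mulr0.
move=> ps /andP[pp sp] th0 ths; have ss := path_sorted ps.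
have p0 : (0 : R) < p%:R by rewrite ltr0n prime_gt0.
have sgt q : q \in s -> (p < q)%N by move/allP: (order_path_min ltn_trans ps); apply.
pose c := ssum (an g) p.-1 (X %/ p) / p%:R.
have cle : `|c| <= L / p%:R.
  by rewrite normrM (@ger0_norm _ (p%:R^-1)) ?invr_ge0 ?(ltW p0)// ler_wpM2r ?invr_ge0 ?(ltW p0)// ssum_an_le// leq_div.
have us : uniq s by apply: (sorted_uniq ltn_trans ltnn).
have step (e : R) : `|e| = 1 -> Ex s (fun h => expR (- theta * \sum_(q <- p :: s) mdiff h q)) (upd g p e) <=
   expR (- (theta * c) * e) * expR (2 * theta ^+ 2 * L ^+ 2 * \sum_(q <- s) (q%:R ^+ 2)^-1).
  move=> e1; apply: (@le_trans _ _ (Ex s (fun h => expR (- (theta * c) * e) * expR (- theta * \sum_(q <- s) mdiff h q)) (upd g p e))).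
    apply: Ex_le => // h h1 h2; rewrite big_cons mulrDr expRD.
    have -> : mdiff h p = c * e; last by rewrite mulrA mulNr.
    have hp : h p = e by rewrite h2 ?/upd ?eqxx//; apply/negP => /sgt; rewrite ltnn.
    rewrite /mdiff /an cmext_prime// hp /c (@eq_ssum_an h g).
      by move: (ssum _ _ _) => z; ring.
    move=> q qq qp; have qp' : (q < p)%N by rewrite -(ltn_predK (prime_gt0 pp)) ltnS.
    rewrite h2 /upd ?ltn_eqF//; apply/negP => /sgt; rewrite ltnNge ltnW//.
  rewrite Ex_mull ler_wpM2l ?expR_ge0//; apply: IH => //.
    by move=> q; rewrite /upd; case: eqP => // _; rewrite e1.
  by move=> q qs; apply: ths; rewrite inE qs orbT.
have H1 := step 1 (normr1 _); have H2 := step (-1) ltac:(by rewrite normrN normr1).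
rewrite mulr1 in H1; rewrite mulrN1 opprK in H2.
apply: (@le_trans _ _ ((expR (theta * c) + expR (- (theta * c))) / 2 *
  expR (2 * theta ^+ 2 * L ^+ 2 * \sum_(q <- s) (q%:R ^+ 2)^-1))).
  by move: H1 H2; move: (expR _) (expR _) (expR _) (Ex _ _ _) (Ex _ _ _) => a b d e f; lra.
rewrite big_cons mulrDr expRD ler_wpM2r ?expR_ge0//.
have tc : `|theta * c| <= theta * (L / p%:R) by rewrite normrM (ger0_norm th0) ler_wpM2l.
apply: le_trans (cosh_le (le_trans tc (ths p (mem_head _ _)))) _; rewrite ler_expR.
have -> : 2 * theta ^+ 2 * L ^+ 2 * (p%:R ^+ 2)^-1 = 2 * (theta * (L / p%:R)) ^+ 2.
  by field; rewrite gt_eqF.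
rewrite ler_wpM2l// -(sqr_norm (theta * c)) lerXn2r ?nnegrE//.
exact: le_trans tc.
Qed.

End SignAverages.

Section SignBound.
Variable R : realType.
Implicit Types (g h : nat -> R) (p q n m y Z : nat) (s : seq nat).

Lemma ssum_decomp (a : nat -> R) y Z m : cmult a -> (y <= Z)%N ->
  ssum a Z m = ssum a y m + \sum_(y.+1 <= p < Z.+1 | prime p) a p * ssum a p (m %/ p).
Proof.
move=> aM; elim: Z => [|Z IH]; first by rewrite leqn0 => /eqP ->; rewrite big_geq// addr0.
rewrite leq_eqVlt => /orP[/eqP <-|yZ]; first by rewrite big_geq// addr0.
rewrite ltnS in yZ; rewrite [X in _ + X]big_mkcond big_nat_recr//= -big_mkcond /= addrA -IH//.
by case: ifP => [pp|/negbT pp]; [rewrite ssum_prime|rewrite ssum_nonprime// addr0].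
Qed.

Variable X : nat.
Hypothesis X0 : (0 < X)%N.
Let L : R := 1 + ln X%:R.
Let L1 : 1 <= L. Proof. by rewrite lerDl ln_nat_ge0. Qed.

Lemma sign_decomp g y : (forall p, `|g p| <= 1) -> (0 < y <= X)%N ->
  `|ssum (an g) X X - ssum (an g) y X - \sum_(y.+1 <= p < X.+1 | prime p) mdiff X g p| <= 2 * L / y%:R.
Proof.
move=> g1 /andP[y0 yX]; have aM := an_cmult g; have L0 : 0 <= L by apply: le_trans L1.
rewrite (ssum_decomp X aM yX) [X in `|X - _|]addrAC subrr add0r -sumrB.
apply: le_trans (ler_norm_sum _ _ _) _.
apply: (@le_trans _ _ (\sum_(y.+1 <= p < X.+1) (p%:R ^+ 2)^-1 * L)); last first.
  rewrite -mulr_suml mulrAC ler_wpM2r//; apply: le_trans (sum_inv_sqr_le _ _ _) _ => //.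
  by rewrite ler_pM2l// lef_pV2 ?posrE ?ltr0n// ler_nat.
rewrite big_mkcond big_nat [leRHS]big_nat; apply: ler_sum => p /andP[yp pX].
have t0 : 0 <= (p%:R ^+ 2)^-1 * L by rewrite mulr_ge0 ?invr_ge0 ?sqr_ge0.
case: ifP => // pp; have p0 := prime_gt0 pp.
have e : ssum (an g) p (X %/ p) = ssum (an g) p.-1 (X %/ p) + an g p * ssum (an g) p (X %/ p %/ p).
  by case: p pp {yp pX t0 p0} => // p pp; rewrite ssum_prime.
rewrite /mdiff e mulrDr addrAC subrr add0r mulrA normrM; apply: ler_pM => //.
  rewrite normrM -exprVn expr2; apply: ler_pM => //; exact: an_le.
by apply: ssum_an_le => //; apply: leq_trans (leq_div _ _) (leq_div _ _).
Qed.

Definition primes_upto Z : seq nat := [seq p <- index_iota 1 Z.+1 | prime p].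
Definition primes_between y Z : seq nat := [seq p <- index_iota y.+1 Z.+1 | prime p].

Lemma primes_upto_cat y Z : (y <= Z)%N -> primes_upto Z = primes_upto y ++ primes_between y Z.
Proof.
move=> yZ; rewrite /primes_upto /primes_between -filter_cat.
have -> // : index_iota 1 Z.+1 = index_iota 1 y.+1 ++ index_iota y.+1 Z.+1.
by rewrite /index_iota !subSS !subn0 -[in LHS](subnKC yZ) iotaD add1n.
Qed.

Lemma sign_bound y (lam : R) : (0 < y <= X)%N -> 0 <= lam -> lam <= 1 -> 2 * L / y%:R <= lam ->
  (forall h, cmult h -> (forall n, `|h n| <= 1) -> (forall p, prime p -> (y < p)%N -> h p = 0) ->
     2 * lam <= gsum h X) ->
  Ex (primes_upto X) (fun h => (ssum (an h) X X < 0)%R%:R) (fun=> 0) <= expR (- (lam ^+ 2 * y%:R / (16 * L ^+ 2))).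
Proof.
move=> /andP[y0 yX] lam0 lam1 Ly H; have y0' : (0 : R) < y%:R by rewrite ltr0n.
have L0 : 0 < L by apply: lt_le_trans L1.
rewrite (primes_upto_cat yX) Ex_cat.
set s1 := primes_upto y; set s2 := primes_between y X.
have u1 : uniq s1 by rewrite filter_uniq// iota_uniq.
have u2 : uniq s2 by rewrite filter_uniq// iota_uniq.
have m2 p : p \in s2 -> (y < p)%N by rewrite mem_filter mem_index_iota => /andP[_ /andP[]].
rewrite -[leRHS](Ex_const s1 _ (fun=> 0)); apply: Ex_le => // h h1 h2.
have hle n : `|h n| <= 1 by have [/h1 ->|/h2 ->] := boolP (n \in s1); rewrite ?normr0.
pose theta := lam * y%:R / (8 * L ^+ 2).
have th0 : 0 <= theta by apply: divr_ge0 (mulr_ge0 lam0 (ltW y0')) (mulr_ge0 (ler0n _ 8) (sqr_ge0 _)).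
apply: (@le_trans _ _ (Ex s2 (fun h' => expR (- theta * lam) * expR (- theta * \sum_(q <- s2) mdiff X h' q)) h)).
  apply: Ex_le => // h' k1 k2.
  have kle n : `|h' n| <= 1 by have [/k1 ->|/k2 ->] := boolP (n \in s2).
  case: ltP => S0; last by rewrite mulr_ge0 ?expR_ge0.
  rewrite -expRD -mulrDr -[leLHS]expR0 ler_expR mulNr oppr_ge0 mulr_ge0_le0//.
  pose h2' p : R := if (p <= y)%N then h' p else 0.
  have h2le p : `|h2' p| <= 1 by rewrite /h2'; case: ifP; rewrite ?normr0.
  have Hv p : prime p -> (y < p)%N -> cmext h2' p = 0.
    by move=> pp yp; rewrite cmext_prime// /h2' leqNgt yp.
  have := H (cmext h2') (cmext_cmult _) (fun n => cmext_le1 n h2le) Hv.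
  rewrite (gsum_ssum (cmext_cmult _) Hv) -/(an h2') (@eq_ssum_an _ h2' h'); last first.
    by move=> p _ py; rewrite /h2' py.
  have := sign_decomp kle (_ : (0 < y <= X)%N); rewrite y0 yX => /(_ isT).
  rewrite -[X in _ - X]big_filter -/(primes_between y X) -/s2 ler_norml => /andP[+ _].
  by move: S0 Ly; move: (ssum _ X X) (ssum _ y X) (\sum_(_ <- _) _) (_ / _) => a b c d; lra.
rewrite Ex_mull.
have az : Ex s2 (fun h' => expR (- theta * \sum_(q <- s2) mdiff X h' q)) h <=
   expR (2 * theta ^+ 2 * L ^+ 2 * \sum_(q <- s2) (q%:R ^+ 2)^-1).
  apply: azuma => //.
  - by apply: sorted_filter; [exact: ltn_trans|exact: iota_ltn_sorted].
  - exact: filter_all.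
  move=> p /m2 yp; have p0 : (0 : R) < p%:R by rewrite ltr0n (ltn_trans y0 yp).
  rewrite mulrA ler_pdivrMr//.
  have -> : theta * L = lam * y%:R / (8 * L) by rewrite /theta; field; rewrite gt_eqF.
  rewrite ler_pdivrMr ?mulr_gt0//.
  have yp' : y%:R <= p%:R :> R by rewrite ler_nat ltnW.
  have a1 : lam * y%:R <= 1 * p%:R by rewrite ler_pM ?(ltW y0').
  have a2 : p%:R * 1 <= p%:R * L by rewrite ler_wpM2l ?(ltW p0).
  by rewrite -mulrA mulrCA [p%:R * _]mulrCA; lra.
apply: le_trans (ler_wpM2l (expR_ge0 _) az) _; rewrite -expRD ler_expR.
have sq : \sum_(q <- s2) (q%:R ^+ 2)^-1 <= 2 / y%:R :> R.
  apply: (@le_trans _ _ (\sum_(y.+1 <= q < X.+1) (q%:R ^+ 2)^-1)).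
    have v0 (q : nat) : (0 : R) <= (q%:R ^+ 2)^-1 by rewrite invr_ge0 sqr_ge0.
    rewrite big_filter [leRHS](bigID prime) /= lerDl sumr_ge0// => q _; exact: v0.
  apply: le_trans (sum_inv_sqr_le _ _ _) _ => //.
  by rewrite ler_pM2l// lef_pV2 ?posrE ?ltr0n// ler_nat.
have t2 : 0 <= 2 * theta ^+ 2 * L ^+ 2 by apply: mulr_ge0 (mulr_ge0 (ler0n _ 2) (sqr_ge0 _)) (sqr_ge0 _).
apply: le_trans (lerD (lexx _) (ler_wpM2l t2 sq)) _.
rewrite le_eqVlt; apply/orP; left; apply/eqP; rewrite /theta; field.
by rewrite !gt_eqF.
Qed.

End SignBound.

Section CylinderProbability.
Context {R : realType} {d : measure_display} {T : measurableType d}.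
Variables (P : probability T R) (f : nat -> {RV P >-> R}).
Hypothesis fM : random_completely_multiplicative f.
Local Open Scope ereal_scope.

Lemma measurable_fiber p (c : R) : measurable [set w | f p w = c].
Proof.
by have := measurable_funPTI (f p) (measurable_set1 c).
Qed.

Definition cyl (s : seq nat) (e : nat -> R) : set T := [set w | forall i, i \in s -> f i w = e i].

Lemma measurable_cyl s e : measurable (cyl s e).
Proof.
elim: s => [|p s IH].
  by rewrite (_ : cyl _ _ = setT)//; apply/seteqP; split => // w _ i.
rewrite (_ : cyl _ _ = [set w | f p w = e p] `&` cyl s e).
  by apply: measurableI => //; exact: measurable_fiber.
apply/seteqP; split => w /=.
  by move=> h; split => [|i si]; apply: h; rewrite inE ?eqxx// si orbT.
by move=> [h1 h2] i; rewrite inE => /orP[/eqP ->//|/h2].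
Qed.

Lemma prob_cyl s e : uniq s -> all prime s -> (forall p, p \in s -> e p = 1%R \/ e p = (-1)%R) ->
  P (cyl s e) = ((2^-1)%R ^+ size s)%:E.
Proof.
move=> us ps he; have [_ fp fi] := fM.
have := fi s (fun i => [set e i]) us.
have h1 i : i \in s -> [set p | prime p] i by move/(allP ps).
have h2 i : i \in s -> measurable [set e i] by move=> _; exact: measurable_set1.
move=> /(_ h1 h2) => ->.
rewrite (eq_big_seq (fun=> (2^-1)%R%:E)).
  by elim: s {us ps he h1 h2} => [|p s IH]; rewrite ?big_nil// big_cons IH -EFinM exprS.
move=> p sp; have [e1 e2] := fp p (allP ps p sp).
by case: (he p sp) => ->.
Qed.

Lemma prob_not_sign p : prime p -> P (~` ([set w | f p w = 1%R] `|` [set w | f p w = (-1)%R])) = 0.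
Proof.
move=> pp; have [_ fp _] := fM; have [e1 e2] := fp p pp.
rewrite probability_setC; last by apply: measurableU; exact: measurable_fiber.
have -> : P ([set w | f p w = 1%R] `|` [set w | f p w = (-1)%R]) =
  P [set w | f p w = 1%R] + P [set w | f p w = (-1)%R]; last first.
  rewrite e1 e2; have -> : (2^-1)%:E + (2^-1)%:E = 1%:E :> \bar R by rewrite -EFinD; congr EFin; field.
  by rewrite subee.
apply: measureU; [exact: measurable_fiber|exact: measurable_fiber|].
apply/seteqP; split => // w /= [-> h].
by have := @ltrN10 R; rewrite -h ltr10.
Qed.

Lemma prob_cyl_le (bad : set T) (bad' : (nat -> R) -> bool) s1 s2 e :
  measurable bad -> uniq (s1 ++ s2) -> all prime (s1 ++ s2) ->
  (forall p, p \in s1 -> e p = 1%R \/ e p = (-1)%R) ->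
  (forall w e', bad w -> (forall p, p \in s1 ++ s2 -> f p w = e' p) -> (forall p, p \notin s1 ++ s2 -> e' p = e p) -> bad' e') ->
  P (cyl s1 e `&` bad) <= ((2^-1) ^+ size s1 * Ex s2 (fun e' => (bad' e')%:R) e)%R%:E.
Proof.
move=> mb; elim: s2 s1 e => [|p s2 IH] s1 e.
  rewrite cats0 => us ps he H /=.
  have mc : measurable (cyl s1 e `&` bad) by apply: measurableI => //; exact: measurable_cyl.
  case B: (bad' e).
    rewrite mulr1 -(prob_cyl us ps he); apply: le_measure.
    - by rewrite inE.
    - by rewrite inE; exact: measurable_cyl.
    - exact: subIsetl.
  rewrite mulr0 (_ : _ `&` _ = set0) ?measure0//.
  apply/seteqP; split => // w /= [c b]; move: B; rewrite (H w e)//.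
move=> us ps he H.
have pp : prime p by move: ps; rewrite all_cat /= => /and3P[].
have perm : perm_eq (s1 ++ p :: s2) ((p :: s1) ++ s2) by apply/permPl; exact: (perm_catCA s1 [:: p] s2).
have ps1 : p \notin s1 by move: us; rewrite cat_uniq /= negb_or => /and3P[_ /andP[]].
have ps2 : p \notin s2 by move: us; rewrite cat_uniq /= => /and3P[_ _ /andP[]].
have mc c : measurable (cyl (p :: s1) (upd e p c) `&` bad) by apply: measurableI => //; exact: measurable_cyl.
have B c : c = 1%R \/ c = (-1)%R -> P (cyl (p :: s1) (upd e p c) `&` bad) <=
   ((2^-1) ^+ (size s1).+1 * Ex s2 (fun e' => (bad' e')%:R) (upd e p c))%R%:E.
  move=> hc; apply: IH.
  - by rewrite -(perm_uniq perm).
  - by rewrite -(perm_all _ perm).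
  - move=> q; rewrite inE /upd; case: eqP => [->|_] //= qs; exact: he.
  - move=> w e' bw h1 h2; apply: (H w e' bw) => q.
      by rewrite (perm_mem perm); exact: h1.
    rewrite (perm_mem perm) => qs; rewrite h2// /upd; case: eqP => // qp.
    by move: qs; rewrite qp inE eqxx.
set N := ~` ([set w | f p w = 1%R] `|` [set w | f p w = (-1)%R]).
have mN : measurable N by apply: measurableC; apply: measurableU; exact: measurable_fiber.
have sub : cyl s1 e `&` bad `<=` (cyl (p :: s1) (upd e p 1) `&` bad) `|` ((cyl (p :: s1) (upd e p (-1)) `&` bad) `|` N).
  have cc w c : cyl s1 e w -> f p w = c -> cyl (p :: s1) (upd e p c) w.
    move=> h fc q; rewrite inE /upd; case: eqP => [->//|_ /=]; exact: h.
  move=> w /= [c b]; have [h1|h1] := pselect (f p w = 1%R); first by left; split => //; exact: cc.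
  have [h2|h2] := pselect (f p w = (-1)%R); first by right; left; split => //; exact: cc.
  by right; right => -[].
apply: le_trans (le_measure _ _ _ sub) _; rewrite ?inE.
- by apply: measurableI => //; exact: measurable_cyl.
- by apply: measurableU => //; exact: measurableU.
apply: le_trans (measureU2 _ _ _) _ => //; first exact: measurableU.
apply: le_trans (leeD (B 1%R (or_introl erefl)) (le_trans (measureU2 _ _ _) (leeD (B (-1)%R (or_intror erefl)) (lexx _)))) _ => //.
set z := (X in _ + (_ + X) <= _); have -> : z = 0 by exact: prob_not_sign.
rewrite adde0 -EFinD lee_fin /= le_eqVlt; apply/orP; left; apply/eqP.
by rewrite exprS; move: (_ ^+ _)%R (Ex _ _ _) (Ex _ _ _) => a b c'; field.
Qed.

Lemma prob_neg_sum_le (x : R) (X := Num.truncn x) :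
  prob_neg_sum f x <= (Ex (primes_upto X) (fun h => (ssum (an h) X X < 0)%R%:R) (fun=> 0%R))%:E.
Proof.
rewrite /prob_neg_sum -/X; set bad := [set w | _].
have mbad : measurable bad.
  have mf : measurable_fun setT (fun w => (\sum_(1 <= n < X.+1) f n w / n%:R)%R).
    by apply: measurable_sum => n; apply: measurable_funM => //; exact: measurable_cst.
  have := mf measurableT `]-oo, 0%R[%classic (measurable_itv _); rewrite setTI.
  congr measurable; apply/seteqP; split => w /=; by rewrite in_itv /=.
have := @prob_cyl_le bad (fun h => ssum (an h) X X < 0)%R [::] (primes_upto X) (fun=> 0%R) mbad.
rewrite mul1r; have -> : cyl [::] (fun=> 0%R) `&` bad = bad.
  by apply/seteqP; split => w /=; [case|move=> ?; split].
apply => //.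
- by rewrite filter_uniq// iota_uniq.
- exact: filter_all.
move=> w e' bw h1 h2; have [fc _ _] := fM; have [f1 f2] := fc w.
have fcm : cmult (fun n => f n w) by [].
rewrite ssum_total//; move: bw; rewrite /bad /=; congr (_ < _)%R.
apply: eq_big_nat => n nX; rewrite /an; congr (_ / _)%R.
apply: (cmult_eq_primes fcm (cmext_cmult e')) nX => p pp pX.
by rewrite cmext_prime// h1// mem_filter pp mem_index_iota prime_gt0.
Qed.

End CylinderProbability.

(** * Asymptotics *)

Section Asymptotics.
Variable R : realType.
Implicit Types (b x : R) (i n : nat).

(* For [b = log_4 x], about the least [i] for which [i!] exceeds
   [i 2^i log log y], where [log log y <= expR (expR b)]. *)
Definition level b : nat := (Num.truncn (expR b / (b - ln b - 4))).+1.

Lemma fact_lower i : i%:R ^+ i * expR (- i%:R) <= i`!%:R :> R.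
Proof.
case: i => [|i]; first by rewrite expr0 mul1r oppr0 expR0.
rewrite expRN ler_pdivrMr ?expR_gt0//.
have f0 : (0 : R) < i.+1`!%:R by rewrite ltr0n fact_gt0.
rewrite mulrC -ler_pdivrMr//; apply: le_trans (expR_ge1Dxn i (ler0n _ _)); lra.
Qed.

Lemma cube_le_expR (t : R) : 0 <= t -> t ^+ 3 <= 6 * expR t.
Proof.
by move=> t0; have := expR_ge1Dxn 2 t0; rewrite (_ : 3`!%:R = 6 :> R)//; lra.
Qed.

Lemma sqr_le_expR (t : R) : 0 <= t -> t ^+ 2 <= 2 * expR t.
Proof.
by move=> t0; have := expR_ge1Dxn 1 t0; rewrite (_ : 2`!%:R = 2 :> R)//; lra.
Qed.

Lemma id_le_expR (t : R) : t <= expR t.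
Proof. by apply: le_trans (expR_ge1Dx t); lra. Qed.

Lemma level_cfac (C : R) : 1 <= C -> exists2 b0 : R, 32 <= b0 & forall b, b0 <= b ->
  [/\ (1 < level b)%N, (level b)%:R <= 2 * expR b, expR b <= b * (level b)%:R,
     ((level b).+1)%:R * b / expR b - 1 <= 12 * (1 + ln b) / b &
     C * (level b)%:R * expR (expR b) * cfac R (level b) <= 1].
Proof.
move=> C1; have C0 : 0 < C by lra.
have lC := ln_ge0 C1.
have [u0 u01 Hu] := @ln_pow_le R 8 1 (ler0n _ _).
exists (32 + u0 + 2 * ln C); first by lra.
move=> b hb; have b32 : 32 <= b by lra.
have b0 : 0 < b by lra.
have hub : u0 <= b by lra.
have lb : 8 * (1 + ln b) <= b by rewrite -[X in _ * X]expr1; exact: Hu.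
have lb0 : 0 <= ln b by rewrite ln_ge0//; lra.
set W := b - ln b - 4; have W1 : b / 2 <= W by rewrite /W; lra.
have W0 : 0 < W by lra.
have Wb : W <= b by rewrite /W; lra.
set A := expR b; have A0 : 0 < A by exact: expR_gt0.
have A2 : b ^+ 2 <= 2 * A by apply: sqr_le_expR; lra.
have b2 : 32 * b <= b ^+ 2 by rewrite expr2 ler_pM2r.
have AW0 : 0 <= A / W by rewrite divr_ge0// ltW.
have /andP[t1 t2] := truncn_itv AW0.
set i := level b; rewrite -/i in t2.
have iE : i%:R = (Num.truncn (A / W))%:R + 1 :> R by rewrite /i /level -/A -/W natr1.
clearbody i.
have iA : A <= W * i%:R.
  by rewrite mulrC -ler_pdivrMr// iE natr1; exact: ltW.
have i0 : 0 < i%:R :> R.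
  by rewrite iE; have := ler0n R (Num.truncn (A / W)); lra.
have iAb : A <= b * i%:R by apply: le_trans iA _; rewrite ler_pM2r.
have i16 : 16 <= i%:R :> R.
  have h : b * 16 <= b * i%:R by apply: le_trans iAb; lra.
  by move: h; rewrite ler_pM2l.
have AWle : A / W <= 2 * A / b.
  have -> : 2 * A / b = A / (b / 2) by field; rewrite gt_eqF.
  rewrite ler_wpM2l ?(ltW A0)// lef_pV2 ?posrE//; lra.
have A1 : 2 * A / b <= A.
  by rewrite ler_pdivrMr// [_ * b]mulrC ler_pM2r//; lra.
split.
- by rewrite -(ltr_nat R); lra.
- rewrite iE; lra.
- by [].
- rewrite -natr1 iE.
  have h1 : ((Num.truncn (A / W))%:R + 1 + 1) * b / A <= (A / W + 2) * b / A.
    by rewrite ler_pM2r ?invr_gt0// ler_pM2r//; move: t1; clear; lra.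
  apply: (@le_trans _ _ ((A / W + 2) * b / A - 1)); first by rewrite lerD2r.
  have -> : (A / W + 2) * b / A - 1 = (ln b + 4) / W + 2 * b / A.
    have e : b = W + (ln b + 4) by rewrite /W; ring.
    have -> : (A / W + 2) * b / A - 1 = (b - W) / W + 2 * b / A by field; rewrite !gt_eqF.
    by congr (_ / _ + _); rewrite {1}e; ring.
  have h2 : (ln b + 4) / W <= 2 * (ln b + 4) / b.
    have -> : 2 * (ln b + 4) / b = (ln b + 4) / (b / 2) by field; rewrite gt_eqF.
    rewrite ler_wpM2l ?addr_ge0// lef_pV2 ?posrE//; move: b0; clear; lra.
  have h3 : 2 * b / A <= 4 / b.
    by rewrite ler_pdivrMr// mulrAC ler_pdivlMr// -mulrA -expr2; move: A2; clear; lra.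
  apply: le_trans (lerD h2 h3) _; rewrite -mulrDl ler_pM2r ?invr_gt0//; move: lb0; clear; lra.
- have fi : 0 < i`!%:R :> R by rewrite ltr0n fact_gt0.
  rewrite /cfac mulrA ler_pdivrMr// mul1r; apply: le_trans (fact_lower i).
  have li : b - ln b <= ln i%:R.
    have -> : b - ln b = ln (A / b) by rewrite ln_div ?posrE// expRK.
    by rewrite ler_ln ?posrE ?divr_gt0// ler_pdivrMr// mulrC.
  have p2 : 2 ^+ i <= expR i%:R :> R.
    have -> : expR i%:R = expR 1 ^+ i :> R by rewrite -expRM_natl mulr1.
    by rewrite lerXn2r ?nnegrE ?expR_ge0//; have := @expR_ge1Dx R 1; lra.
  have pi : i%:R <= expR i%:R :> R by exact: id_le_expR.
  have ii : i%:R ^+ i = expR (i%:R * ln i%:R) :> R by rewrite expRM_natl lnK.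
  rewrite ii -expRD.
  apply: (@le_trans _ _ (expR (ln C) * expR i%:R * expR A * expR i%:R)).
    by rewrite lnK// !ler_pM ?mulr_ge0 ?expR_ge0 ?exprn_ge0 ?(ltW C0).
  rewrite -!expRD ler_expR.
  have h1 : i%:R * (W + 1) <= i%:R * (ln i%:R - 3).
    by apply: ler_wpM2l; [exact: ltW|rewrite /W; move: li; clear; lra].
  have h2 : ln C <= i%:R.
    have h : b * ln C <= b * i%:R.
      apply: le_trans iAb; have : b * (2 * ln C) <= b * b by rewrite ler_pM2l//; move: hb b32 u01; clear; lra.
      by rewrite -expr2; move: A2; clear; lra.
    by move: h; rewrite ler_pM2l.
  by move: h1 h2 iA; clear; lra.
Qed.

Lemma prob_bound : exists2 b0 : R, 1 <= b0 & forall b, b0 <= b ->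
  forall (x : R) (d : measure_display) (T : measurableType d) (P : probability T R)
    (f : nat -> {RV P >-> R}), ln x = expR (expR (expR b)) -> 0 < x ->
  random_completely_multiplicative f ->
  (prob_neg_sum f x <= (expR (- expR (ln x / (level b).+1%:R)))%:E)%E.
Proof.
have [C0 [y0 [C00 HC0]]] := gsum_lower R.
set C := C0 + 1; have C1 : 1 <= C by rewrite /C; lra.
have CC : C0 <= C by rewrite /C; lra.
have [b1 b132 Hb] := level_cfac C1.
set c : R := ln (8 * 64 * C ^+ 2).
have Cp : 0 < C by lra.
have C2 : 0 < 8 * 64 * C ^+ 2 by rewrite mulr_gt0// exprn_gt0.
have c0 : 0 <= c.
  apply: ln_ge0; have : 1 <= C ^+ 2 by rewrite exprn_ege1.
  move: C2; clear; lra.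
exists (b1 + 6 * (48 + 12 * c) + y0%:R); first by have := ler0n R y0; lra.
move=> b hb x d T P f lx x0 fM; have y00 := ler0n R y0.
have [|i2 iA _ _ ci] := Hb b; first by lra.
set i := level b in i2 iA ci *.
set A := expR b in iA ci lx; set l2 := expR A in ci lx; set l1 := expR l2 in lx.
have bA : b <= A by exact: id_le_expR.
have Al2 : A <= l2 by exact: id_le_expR.
have l21 : l2 <= l1 by exact: id_le_expR.
have A0 : 0 < A by exact: expR_gt0.
have l20 : 0 < l2 by exact: expR_gt0.
have l10 : 0 < l1 by exact: expR_gt0.
have y0l1 : y0%:R <= l1 by lra.
have l11 : 1 <= l1 by lra.
have l2_1 : 1 <= l2 by lra.
have A2 : A ^+ 2 <= 2 * l2 by apply: sqr_le_expR; exact: ltW.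
have l23 : l2 ^+ 3 <= 6 * l1 by apply: cube_le_expR; exact: ltW.
have l1E : l1 = expR l2 by [].
have cE : expR c = 8 * 64 * C ^+ 2 by rewrite lnK.
clearbody c l1 l2 A i C.
have i0 : 0 < i%:R :> R by rewrite ltr0n ltnW.
have i1 : 1 <= i%:R :> R by rewrite ler1n ltnW.
have ii1 : i%:R * i.+1%:R <= 12 * l2.
  rewrite -natr1; have a1 : i%:R + 1 <= 3 * A by lra.
  have : i%:R * (i%:R + 1) <= 2 * A * (3 * A) by rewrite ler_pM//; move: iA a1; clear; lra.
  have -> : 2 * A * (3 * A) = 6 * A ^+ 2 by ring.
  move: A2; clear; lra.
have gap : i%:R * i.+1%:R * (4 * l2 + c) <= l1.
  have c4 : 0 <= 4 * l2 + c by move: c0 l20; clear; lra.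
  apply: le_trans (ler_wpM2r c4 ii1) _.
  have : l2 * l2 * (6 * (48 + 12 * c)) <= l2 * l2 * l2 by rewrite ler_pM2l ?mulr_gt0//; move: hb b132 bA Al2 y00; clear; lra.
  have -> : l2 * l2 * l2 = l2 ^+ 3 by ring.
  have : 12 * c * l2 <= 12 * c * (l2 * l2).
    by rewrite ler_wpM2l ?mulr_ge0 ?ler_peMr// ltW.
  have -> : 12 * l2 * (4 * l2 + c) = 48 * (l2 * l2) + 12 * c * l2 by ring.
  by move: l23; clear; lra.
clear A2 l23 ii1 bA iA A0 Al2 hb b132 Hb.
set I1 : R := i.+1%:R in gap *; have I10 : 0 < I1 by rewrite ltr0n.
have IE : I1 = i%:R + 1 by rewrite /I1 natr1.
clearbody I1.
have gap2 : l1 / I1 + (4 * l2 + c) <= l1 / i%:R.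
  rewrite -(ler_pM2r (mulr_gt0 i0 I10)).
  have -> : l1 / i%:R * (i%:R * I1) = l1 * I1 by field; rewrite gt_eqF.
  have -> : (l1 / I1 + (4 * l2 + c)) * (i%:R * I1) = l1 * i%:R + i%:R * I1 * (4 * l2 + c).
    by field; rewrite gt_eqF.
  by rewrite IE; rewrite IE in gap; move: gap; clear; lra.
have li1 : 0 <= l1 / I1 by rewrite divr_ge0// ltW.
set z := expR (l1 / i%:R).
have z0 : 0 <= z by exact: expR_ge0.
have z1 : 1 <= z by rewrite -expR0 ler_expR divr_ge0// ltW.
have zbig : 8 * 64 * C ^+ 2 * l1 ^+ 4 * expR (l1 / I1) <= z.
  have -> : 8 * 64 * C ^+ 2 * l1 ^+ 4 * expR (l1 / I1) = expR (c + 4 * l2 + l1 / I1).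
    by rewrite !expRD cE l1E expRM_natl.
  by rewrite ler_expR; move: gap2; clear; lra.
clear cE C2 gap2.
set y := Num.truncn z; have /andP[yz zy] := truncn_itv z0; rewrite -/y in yz zy.
have zy' : z < y%:R + 1 by rewrite natr1.
have y1' : (0 < y)%N by rewrite truncn_gt0.
have zE : z = expR (l1 / i%:R) by [].
clearbody y z.
have y1 : 1 <= y%:R :> R by rewrite ler1n.
have zy2 : z <= 2 * y%:R by move: zy' y1; clear; lra.
have C21 : 1 <= C ^+ 2 by rewrite exprn_ege1.
have e1 : 1 <= expR (l1 / I1) by rewrite -expR0 ler_expR.
have ybig : 4 * 64 * C ^+ 2 * l1 ^+ 4 * expR (l1 / I1) <= y%:R by move: zbig zy2; clear; lra.
clear zbig zy'.
have l14 : l1 ^+ 2 <= l1 ^+ 4 by rewrite ler_weXn2l.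
have l12 : l1 <= l1 ^+ 2 by rewrite ler_eXnr.
have Cl : 0 <= C ^+ 2 * l1 ^+ 4 by rewrite mulr_ge0 ?exprn_ge0// ltW.
have y256 : 4 * 64 * (C ^+ 2 * l1 ^+ 4) <= y%:R.
  have h : C ^+ 2 * l1 ^+ 4 <= C ^+ 2 * l1 ^+ 4 * expR (l1 / I1) by rewrite ler_peMr.
  by move: h ybig; clear; lra.
have yl1 : 8 * C * l1 ^+ 2 <= y%:R.
  apply: le_trans y256; have : C * l1 ^+ 2 <= C ^+ 2 * l1 ^+ 4.
    by rewrite ler_pM ?exprn_ge0// ?ler_eXnr// ltW.
  have : 0 <= C * l1 ^+ 2 by rewrite mulr_ge0 ?exprn_ge0// ltW.
  clear; lra.
have y0' : (0 : R) < y%:R by rewrite ltr0n.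
have yl : l1 <= y%:R.
  apply: le_trans yl1; apply: le_trans l12 _; rewrite ler_peMl ?exprn_ge0 ?(ltW l10)//.
  by move: C1; clear; lra.
have y2 : (1 < y)%N.
  rewrite -(ltr_nat R); have : 1 <= C ^+ 2 * l1 ^+ 4.
    by rewrite -[leLHS]mulr1 ler_pM// exprn_ege1.
  by move: y256; clear; lra.
clear l14 l12 Cl y256 C21 e1.
have zp : 0 < z by exact: lt_le_trans z1.
have lz : ln z = l1 / i%:R by rewrite zE expRK.
have lyz : ln y%:R <= l1 / i%:R by rewrite -lz ler_ln ?posrE//.
have lyl : ln y%:R <= l1.
  by apply: le_trans lyz _; rewrite ler_pdivrMr// ler_peMr// ltW.
have ly2 : l1 / i%:R - 1 <= ln y%:R.
  have : ln z <= ln (2 * y%:R) by rewrite ler_ln ?posrE ?mulr_gt0//.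
  rewrite lnM ?posrE// lz; have : ln 2 <= 1 :> R.
    by have := @le_ln1Dx R 1; rewrite (_ : 1 + 1 = 2 :> R)//; apply; clear; lra.
  clear; lra.
have ki : (2 * i)%:R <= ln (y%:R : R).
  apply: le_trans ly2; rewrite lerBrDr ler_pdivlMr// natrM; apply: le_trans gap.
  have : i%:R * I1 * 4 <= i%:R * I1 * (4 * l2 + c) by rewrite ler_wpM2l ?mulr_ge0 ?(ltW I10) ?(ltW i0)//; move: c0 l2_1; clear; lra.
  rewrite IE; have : i%:R <= i%:R * i%:R :> R by rewrite ler_peMr// ltW.
  move: i0; clear; lra.
have ily : i%:R <= ln (y%:R : R) by apply: le_trans ki; rewrite natrM ler_peMl ?(ltW i0)// ler1n.
have ly0 : 0 < ln (y%:R : R) by exact: lt_le_trans ily.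
clear gap c0 IE ly2 lyz lz zy2 l21.
have yy0 : (y0 <= y)%N by rewrite -(ler_nat R); exact: le_trans yl.
clear y0l1 y00.
have zi : z ^+ i = x by rewrite zE -expRM_natl mulrC divfK ?gt_eqF// -lx lnK.
set X := Num.truncn x.
have yiX : (y ^ i <= X)%N.
  rewrite truncn_ge_nat ?(ltW x0)// natrX -zi lerXn2r ?nnegrE//.
have Xyk : (X <= y ^ (2 * i))%N.
  have : (X%:R : R) <= (y ^ (2 * i))%:R; last by rewrite ler_nat.
  apply: (@le_trans _ _ x); first by have /andP[] := truncn_itv (ltW x0).
  rewrite -zi expnM natrX lerXn2r ?nnegrE//; apply: le_trans (ltW zy) _.
  by rewrite ler_nat -mulnn; move: y2; clear; nia.
have yX : (0 < y <= X)%N.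
  by rewrite y1' (leq_trans _ yiX)// -{1}(expn1 y) leq_pexp2l// ltnW.
have X0 : (0 < X)%N by move: yX => /andP[]; exact: leq_trans.
have lnX : ln X%:R <= l1.
  rewrite -lx ler_ln ?posrE ?ltr0n//; by have /andP[] := truncn_itv (ltW x0).
set L : R := 1 + ln X%:R; have L1 : 1 <= L by rewrite lerDl ln_nat_ge0.
have L2 : L <= 2 * l1 by rewrite /L; move: lnX l11; clear; lra.
set lam : R := (2 * C * ln y%:R)^-1.
have lam0 : 0 < lam by rewrite invr_gt0 !mulr_gt0.
have lam1 : lam <= 1.
  rewrite invf_le1 ?mulr_gt0//; have : 1 * 1 <= C * ln y%:R.
    by rewrite ler_pM// (le_trans i1).
  clear; lra.
apply: le_trans (prob_neg_sum_le fM x) _; rewrite lee_fin -/X.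
apply: le_trans (@sign_bound R X X0 y lam yX (ltW lam0) lam1 _ _) _.
- rewrite -/L ler_pdivrMr// /lam ler_pdivlMl ?mulr_gt0//; apply: le_trans yl1.
  have : C * (ln y%:R * L) <= C * (l1 * (2 * l1)) by rewrite ler_pM2l// ler_pM// ?(ltW ly0)// (le_trans ler01).
  have -> : C * (l1 * (2 * l1)) = 2 * (C * l1 ^+ 2) by ring.
  clear; lra.
- move=> h hM h1 hv.
  have := HC0 h y i (2 * i)%N X hM h1 hv yy0 i2 ily ki _ _; rewrite yiX Xyk.
  have cnd : C0 * i%:R * ln (ln y%:R) * cfac R i <= 1.
    apply: le_trans ci; rewrite ler_pM2r ?cfac_gt0//.
    have lly : ln (ln y%:R) <= l2 by rewrite -[leRHS]expRK -l1E ler_ln ?posrE.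
    apply: (@le_trans _ _ (C0 * i%:R * l2)); first by rewrite ler_wpM2l// mulr_ge0// ltW.
    by rewrite ler_pM2r// ler_pM2r.
  move=> /(_ cnd isT); apply: le_trans.
  have -> : 2 * lam = (C * ln y%:R)^-1 by rewrite /lam; field; rewrite !gt_eqF.
  by rewrite lef_pV2 ?posrE ?mulr_gt0// ler_pM2r.
rewrite ler_expR lerN2 -/L lx.
have Lp : 0 < L by exact: lt_le_trans L1.
have -> : lam ^+ 2 * y%:R / (16 * L ^+ 2) = y%:R / (64 * C ^+ 2 * (ln y%:R ^+ 2 * L ^+ 2)).
  by rewrite /lam; field; rewrite !gt_eqF.
rewrite ler_pdivlMr ?mulr_gt0 ?exprn_gt0//; apply: le_trans ybig.
have q1 : ln y%:R ^+ 2 * L ^+ 2 <= l1 ^+ 2 * (2 * l1) ^+ 2.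
  by rewrite ler_pM ?sqr_ge0// lerXn2r ?nnegrE// ?mulr_ge0 ?(ltW l10) ?(ltW ly0) ?(ltW Lp).
have -> : 4 * 64 * C ^+ 2 * l1 ^+ 4 * expR (l1 / I1) = expR (l1 / I1) * (64 * C ^+ 2 * (l1 ^+ 2 * (2 * l1) ^+ 2)).
  by move: (expR _) => e; ring.
by rewrite ler_wpM2l ?expR_ge0// ler_wpM2l// mulr_ge0// exprn_ge0// ltW.
Qed.

Lemma iter_ln_tower (M x : R) : 0 <= M -> expR (expR (expR (expR M))) <= x ->
  [/\ M <= iter_ln 4 x, iter_ln 3 x = expR (iter_ln 4 x),
      ln x = expR (expR (expR (iter_ln 4 x))) & 0 < x].
Proof.
move=> M0 h; rewrite /iter_ln /=.
have step (a t : R) : expR a <= t -> 0 < t /\ a <= ln t.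
  move=> ht; have t0 : 0 < t by apply: lt_le_trans ht; exact: expR_gt0.
  by split=> //; rewrite -[leLHS]expRK ler_ln ?posrE ?expR_gt0.
have [x0 h1] := step _ _ h; have [x1 h2] := step _ _ h1.
have [x2 h3] := step _ _ h2; have [x3 h4] := step _ _ h3.
by rewrite !lnK.
Qed.

End Asymptotics.

Theorem theorem2 (R : realType) :
  exists (K : R) (o : R -> R),
    [/\ 0 < K, o x @[x --> +oo] --> (0 : R) &
      \forall x \near +oo,
        forall (d : measure_display) (T : measurableType d)
          (P : probability T R) (f : nat -> {RV P >-> R}),
          random_completely_multiplicative f ->
          (prob_neg_sum f x <=
            (K * expR (- expR (ln x * iter_ln 4 x /
                               ((1 + o x) * iter_ln 3 x))))%:E)%E].
Proof.
exists 1, (fun x => (level (iter_ln 4 x)).+1%:R * iter_ln 4 x / iter_ln 3 x - 1).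
split=> //.
  have [b0 b01 Hb] := level_cfac (lexx (1 : R)).
  apply/cvgrPdist_le => e e0.
  have [u0 u01 Hu] := @ln_pow_le R (12 / e) 1 (divr_ge0 (ler0n _ _) (ltW e0)).
  exists (expR (expR (expR (expR (b0 + u0))))); split; first exact: num_real.
  move=> x /ltW /iter_ln_tower[|]; first by lra.
  move: (iter_ln 4 x) => b bM -> _ _.
  have [|_ _ A1 A2 _] := Hb b; first by lra.
  have b_gt0 : 0 < b by lra.
  have := expR_gt0 b; move: (expR b) A1 A2 => A A1 A2 A0.
  rewrite sub0r normrN ger0_norm.
    apply: le_trans A2 _; rewrite ler_pdivrMr// -ler_pdivrMl//.
    rewrite mulrA [_^-1 * _]mulrC -[X in _ * X]expr1; apply: Hu; lra.
  rewrite subr_ge0 ler_pdivlMr// mul1r mulrC; apply: le_trans A1 _.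
  by rewrite ler_pM2l// ler_nat.
have [b0 b01 Hb] := prob_bound R.
exists (expR (expR (expR (expR b0)))); split; first exact: num_real.
move=> x /ltW /iter_ln_tower[|hb E3 El x0 d T P f fM]; first by lra.
apply: le_trans (Hb _ hb _ _ _ _ _ El x0 fM) _.
rewrite E3 mul1r lee_fin ler_expR lerN2 ler_expR.
move: (iter_ln 4 x) hb => b hb.
have b_gt0 : 0 < b by lra.
have n0 : 0 < (level b).+1%:R :> R by rewrite ltr0n.
rewrite addrC subrK divfK ?gt_eqF ?expR_gt0//.
by rewrite le_eqVlt; apply/orP; left; apply/eqP; field; rewrite !gt_eqF.
Qed.
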